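(* Let $n\ge 2$, let $B$ be a bounded domain in $\mathbb{R}^n$ and let $f\in\mathcal{E}'(\mathbb{R}^n;\mathbb{R}^n)$ be a vector field supported in $B$. Assume that a smooth curve $\boldsymbol{\gamma}\subset\mathbb{R}^n$ encompasses $B$ and satisfies the Kirillov-Tuy condition of order $(n-1)$ with respect to $B$. Then the potential part of $f$ can be determined uniquely if its restricted first integral moment transform $I_{\boldsymbol{\gamma}}f$ and its solenoidal part $f^s_{\mathbb{R}^n}$ are known; that is, if $f,g\in\mathcal{E}'(\mathbb{R}^n;\mathbb{R}^n)$ are both supported in $B$, $I_{\boldsymbol{\gamma}}f=I_{\boldsymbol{\gamma}}g$ and $f^s_{\mathbb{R}^n}=g^s_{\mathbb{R}^n}$, then the potential parts of $f$ and $g$ coincide.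
   Context: Summation over repeated indices is assumed. $\mathcal{E}'(\mathbb{R}^n;\mathbb{R}^n)$ is the space of (co)vector fields $f=(f_1,\dots,f_n)$ on $\mathbb{R}^n$ whose components are compactly supported distributions; $\mathcal{S}'(\mathbb{R}^n)$ and $\mathcal{S}'(\mathbb{R}^n;\mathbb{R}^n)$ are the spaces of tempered distributions and of fields with tempered distribution components. Curve: $\boldsymbol{\gamma}$ is a fixed curve parametrized by $\boldsymbol{\gamma}(s)$, $s\in[a,b]$. It encompasses a bounded domain $B$ if $\boldsymbol{\gamma}\cap B=\emptyset$ and for each $a\in\boldsymbol{\gamma}$ and $\xi\in\mathbb{R}^n\setminus\{0\}$ only one of the rays $\{a+t\xi:t\ge 0\}$ and $\{a+t\xi:t\le 0\}$ can intersect $B$. Kirillov-Tuy condition: for $\omega\in\mathbb{S}^{n-1}$, $p\in\mathbb{R}$ let $H(\omega,p)=\{x\in\mathbb{R}^n:\langle\omega,x\rangle=p\}$. A smooth curve $\boldsymbol{\gamma}$ satisfies the Kirillov-Tuy condition of order $(n-1)$ (with respect to $B$) if for almost every hyperplane $H(\omega,p)$ intersecting $B$ there is a set of points $\gamma_1,\dots,\gamma_{n-1}\in H(\omega,p)\cap\boldsymbol{\gamma}$, which locally depends smoothly on $(\omega,p)$, such that for almost every point $x\in H(\omega,p)\cap B$ the vectors $x-\gamma_1,\dots,x-\gamma_{n-1}$ are linearly independent. Restricted first integral moment transform: for a smooth compactly supported $f$ supported in $B$, with $\boldsymbol{\gamma}$ encompassing $B$, $I_{\boldsymbol{\gamma}}f(\boldsymbol{\gamma}(s),\xi)=\int_0^\infty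 t\,f_i(\boldsymbol{\gamma}(s)+t\xi)\,\xi^i\,dt$ for $s\in[a,b]$, $\xi\in\mathbb{S}^{n-1}$. For $f\in\mathcal{E}'(\mathbb{R}^n;\mathbb{R}^n)$ supported in $B$, $I_{\boldsymbol{\gamma}}f$ is defined by duality: $\langle I_{\boldsymbol{\gamma}}f,\phi\rangle=\langle f,I_{\boldsymbol{\gamma}}^*\phi\rangle$ for smooth test functions $\phi(\boldsymbol{\gamma}(s),\xi)$, where $$(I_{\boldsymbol{\gamma}}^*\phi)_i(x)=\int_a^b\frac{(x-\boldsymbol{\gamma}(s))^i}{|x-\boldsymbol{\gamma}(s)|^{n-1}}\,\phi\!\left(\boldsymbol{\gamma}(s),\frac{x-\boldsymbol{\gamma}(s)}{|x-\boldsymbol{\gamma}(s)|}\right)ds.$$ Solenoidal and potential parts: every $f\in\mathcal{E}'(\mathbb{R}^n;\mathbb{R}^n)$ has uniquely determined $f^s_{\mathbb{R}^n}\in\mathcal{S}'(\mathbb{R}^n;\mathbb{R}^n)$ and $v_{\mathbb{R}^n}\in\mathcal{S}'(\mathbb{R}^n)$, smooth outside $\operatorname{supp} f$ and tending to zero at infinity, such that $f=f^s_{\mathbb{R}^n}+\mathrm{d}v_{\mathbb{R}^n}$ and $\delta f^s_{\mathbb{R}^n}=0$, where $\mathrm{d}$ is the gradient and $\delta$ the divergence. $f^s_{\mathbb{R}^n}$ is the solenoidal part and $v_{\mathbb{R}^n}$ the potential part of $f$. *)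

(* Defs.v *)
From HB Require Import structures.
From mathcomp Require Import all_boot all_order all_algebra.
From mathcomp Require Import all_classical all_reals all_analysis.

Set Implicit Arguments.
Unset Strict Implicit.
Unset Printing Implicit Defensive.

Import Order.TTheory GRing.Theory Num.Theory numFieldNormedType.Exports.

Local Open Scope classical_set_scope.
Local Open Scope ring_scope.

Section Smooth.
Context {R : realType}.

Definition iter_derive {V W : normedModType R} (s : seq V) (f : V -> W) :
    V -> W :=
  foldr (fun v g => 'D_v g) f s.

(* C^oo on the open set U, for a finite-dimensional V: all iterated
   directional derivatives exist and are continuous at every point of U. *)
Definition smooth_on {V W : normedModType R} (U : set V) (f : V -> W) : Prop :=
  forall (s : seq V) (x : V), U x ->
    {for x, continuous (iter_derive s f)} /\
    (forall v : V, derivable (iter_derive s f) x v).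

Definition smooth {V W : normedModType R} (f : V -> W) : Prop :=
  smooth_on setT f.

(* Zero d-dimensional Hausdorff measure. On a smooth d-dimensional submanifold
   this is the usual notion of a null set; for d = n in R^n (whose balls are
   cubes) it is literally the notion of a Lebesgue null set. *)
Definition null_dim {V : normedModType R} (d : nat) (A : set V) : Prop :=
  forall e : R, 0 < e -> exists (c : nat -> V) (r : nat -> R),
    [/\ forall k, 0 < r k,
        A `<=` \bigcup_k ball (c k) (r k) &
        (\sum_(0 <= k <oo) ((r k) ^+ d)%:E < e%:E)%E].

End Smooth.

Section Euclid.
Context {R : realType} {n : nat}.
Implicit Types x y : 'rV[R]_n.

(* The library norm `|x| on 'rV[R]_n is the sup norm; it is used below only
   where any equivalent norm will do. *)
Definition dot x y : R := \sum_(i < n) x 0 i * y 0 i.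
Definition enorm x : R := Num.sqrt (dot x x).

Definition basis_vec (i : 'I_n) : 'rV[R]_n := delta_mx 0 i.

Definition partial (s : seq 'I_n) (phi : 'rV[R]_n -> R) : 'rV[R]_n -> R :=
  iter_derive [seq basis_vec i | i <- s] (phi : 'rV[R]_n -> R^o).

Definition smooth_fun (phi : 'rV[R]_n -> R) : Prop :=
  smooth (phi : 'rV[R]_n -> R^o).

End Euclid.

(* Integral over R^n as an iterated Lebesgue integral; it is only applied to
   continuous compactly supported integrands. *)
Fixpoint int_Rn {R : realType} (n : nat) : ('rV[R]_n -> R) -> R :=
  match n with
  | 0%N => fun g => g 0
  | m.+1 => fun g =>
      \int[lebesgue_measure]_(t in [set: R])
        int_Rn (fun y : 'rV[R]_m => g (row_mx (const_mx t : 'rV[R]_1) y))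
  end.

Section Distributions.
Context {R : realType} {n : nat}.
Implicit Types (phi psi : 'rV[R]_n -> R) (U K B : set 'rV[R]_n).

Definition test_on U phi : Prop :=
  smooth_fun phi /\
  (compact (closure [set x | phi x != 0]) /\
   closure [set x | phi x != 0] `<=` U).

Definition schwartz phi : Prop :=
  smooth_fun phi /\
  forall (N : nat) (s : seq 'I_n), exists M : R,
    forall x, (1 + `|x|) ^+ N * `|partial s phi x| <= M.

(* A distribution is a functional on all functions whose values off the relevant
   space of test functions are irrelevant; in particular the inclusion of the
   compactly supported distributions (functionals on C^oo) into the tempered
   ones (functionals on the smaller Schwartz space) is the identity. *)
Definition distr : Type := ('rV[R]_n -> R) -> R.
Implicit Types u v w : distr.

Definition linear_on (T : set ('rV[R]_n -> R)) u : Prop :=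
  forall (c : R) phi psi, T phi -> T psi ->
    u (fun x => c * phi x + psi x) = c * u phi + u psi.

Definition smooth_seminorm K (N : nat) phi : R :=
  sup [set y | exists (s : seq 'I_n) (x : 'rV[R]_n),
         [/\ (size s <= N)%N, K x & y = `|partial s phi x|]].

Definition schwartz_seminorm (N : nat) phi : R :=
  sup [set y | exists (s : seq 'I_n) (x : 'rV[R]_n),
         (size s <= N)%N /\ y = (1 + `|x|) ^+ N * `|partial s phi x|].

(* The dual of C^oo(R^n). *)
Definition compact_distr u : Prop :=
  linear_on smooth_fun u /\
  exists K (N : nat) (C : R), compact K /\
    forall phi, smooth_fun phi -> `|u phi| <= C * smooth_seminorm K N phi.

(* The dual of the Schwartz space. *)
Definition tempered_distr u : Prop :=
  linear_on schwartz u /\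
  exists (N : nat) (C : R),
    forall phi, schwartz phi -> `|u phi| <= C * schwartz_seminorm N phi.

Definition tempered_eq u v : Prop := forall phi, schwartz phi -> u phi = v phi.

Definition supp u : set 'rV[R]_n :=
  [set x | forall U, open U -> U x -> exists2 phi, test_on U phi & u phi != 0].

Definition distr_partial (i : 'I_n) u : distr :=
  fun phi => - u (partial [:: i] phi).

(* The value of a compactly supported u on a psi which is only defined and
   smooth near supp u: extend psi to a smooth function on R^n without changing
   it near supp u. The value does not depend on the extension. *)
Definition pair_near_supp u psi : R :=
  u (xget (cst 0) [set phi | smooth_fun phi /\
       exists U, [/\ open U, supp u `<=` U & forall x, U x -> phi x = psi x]]).

(* On the exterior of K, u is a smooth function tending to zero at infinity. *)
Definition smooth_decaying_off K u : Prop :=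
  exists h : 'rV[R]_n -> R,
    [/\ smooth_on (~` K) (h : 'rV[R]_n -> R^o),
        forall phi, test_on (~` K) phi ->
          u phi = int_Rn (fun x => h x * phi x) &
        forall e : R, 0 < e -> exists M : R,
          forall x, M < `|x| -> `|h x| < e].

(* Vector fields with distribution components. *)
Definition field : Type := 'I_n -> distr.
Implicit Types f g : field.

Definition compact_field f : Prop := forall i, compact_distr (f i).
Definition tempered_field f : Prop := forall i, tempered_distr (f i).
Definition tempered_field_eq f g : Prop := forall i, tempered_eq (f i) (g i).

Definition field_supp f : set 'rV[R]_n := \bigcup_i supp (f i).

Definition grad v : field := fun i => distr_partial i v.
Definition divergence f : distr :=
  fun phi => \sum_(i < n) distr_partial i (f i) phi.

(* fs and v are the solenoidal and the potential part of f. *)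
Definition solenoidal_potential_parts f (fs : field) v : Prop :=
  [/\ tempered_field fs /\ tempered_distr v,
      (forall i, smooth_decaying_off (field_supp f) (fs i)) /\
        smooth_decaying_off (field_supp f) v,
      tempered_field_eq f (fun i phi => fs i phi + grad v i phi) &
      tempered_eq (divergence fs) (fun=> 0)].

Definition bounded_domain B : Prop :=
  [/\ open B, connected B, B !=set0 & bounded_set B].

End Distributions.

Arguments distr R n : clear implicits.
Arguments field R n : clear implicits.

Section Curve.
Context {R : realType} {n : nat}.
Variables (a b : R) (gamma : R -> 'rV[R]_n).

(* Smooth up to the end points: gamma restricted to [a, b] extends smoothly. *)
Definition smooth_curve : Prop :=
  exists G : R^o -> 'rV[R]_n,
    smooth G /\ forall s, s \in `[a, b] -> gamma s = G s.

Definition curve : set 'rV[R]_n := gamma @` [set s | s \in `[a, b]].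

Definition encompasses (B : set 'rV[R]_n) : Prop :=
  curve `&` B = set0 /\
  forall p xi, curve p -> xi != 0 ->
    ~ ((exists2 t : R, 0 <= t & B (p + t *: xi)) /\
       (exists2 t : R, t <= 0 & B (p + t *: xi))).

Definition hyperplane (omega : 'rV[R]_n) (p : R) : set 'rV[R]_n :=
  [set x | dot omega x = p].

(* The condition on one hyperplane H(omega, p). Smooth dependence on
   (omega, p) in S^{n-1} x R is smoothness of a local extension of the points
   to an open subset U of R^n x R. *)
Definition tuy_at (B : set 'rV[R]_n) (omega : 'rV[R]_n) (p : R) : Prop :=
  exists (U : set ('rV[R]_n * R^o)%type)
         (pt : 'I_n.-1 -> ('rV[R]_n * R^o)%type -> 'rV[R]_n),
    [/\ open U /\ U (omega, p),
        forall i, smooth_on U (pt i),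
        forall i omega' p', U (omega', p') -> enorm omega' = 1 ->
          (hyperplane omega' p' `&` curve) (pt i (omega', p')) &
        null_dim n.-1 [set x | (hyperplane omega p `&` B) x /\
          ~~ row_free (\matrix_(i < n.-1) (x - pt i (omega, p)))]].

(* S^{n-1} x R has dimension n. *)
Definition kirillov_tuy (B : set 'rV[R]_n) : Prop :=
  null_dim n [set z : ('rV[R]_n * R^o)%type |
    [/\ enorm z.1 = 1, hyperplane z.1 z.2 `&` B !=set0 & ~ tuy_at B z.1 z.2]].

Definition moment_adjoint (phi : 'rV[R]_n * 'rV[R]_n -> R) (i : 'I_n) :
    'rV[R]_n -> R := fun x =>
  \int[lebesgue_measure]_(s in [set s : R | s \in `[a, b]])
    let y := x - gamma s in
    (y 0 i / enorm y ^+ n.-1 * phi (gamma s, (enorm y)^-1 *: y)).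

(* The restricted first integral moment transform of f, as a functional of the
   test function phi. The test functions on curve x S^{n-1} are restrictions of
   smooth functions on R^n x R^n. *)
Definition moment_transform (f : field R n)
    (phi : 'rV[R]_n * 'rV[R]_n -> R) : R :=
  \sum_(i < n) pair_near_supp (f i) (moment_adjoint phi i).

Definition moment_transform_eq (f g : field R n) : Prop :=
  forall phi : 'rV[R]_n * 'rV[R]_n -> R,
    smooth (phi : ('rV[R]_n * 'rV[R]_n)%type -> R^o) ->
    moment_transform f phi = moment_transform g phi.

End Curve.

(* Main.v *)
(* The difference [w] of the two potentials satisfies [d w = f - g]. Translating
   test functions along a ray that avoids the supports of [f] and [g], and using
   the decay of [w], shows that [w] vanishes at the origin of the ray. Hence
   [supp w] is compact, disjoint from the curve, and seen from a point [q] of the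
   curve it lies in the cone over [B], which contains no two opposite rays.
   Testing the equality of the transforms with [beta p * K xi], where [K] is
   homogeneous of degree [1 - n] and [beta] concentrates at [q], and integrating
   by parts yields [w (K (x - q)) = 0] since [div (y K) = K].
   The Kirillov-Tuy condition is only needed to make the curve nonconstant. Then
   there are points of the curve tending to some [q] in a direction [e], and by
   Rolle's theorem [w] kills all [D_e^j K (x - q)], hence by induction on [j] all
   kernels which are smooth off [q] and homogeneous of degree [1 - n - j]: in the
   stereographic coordinates projected from [e], these are generated by
   [e]-derivatives. After the inversion [y / |y|^2] they contain all polynomials,
   whose density in the smooth functions gives [w = 0]. *)
From HB Require Import structures.
Require Import Defs.
From mathcomp Require Import all_boot all_order all_algebra.
From mathcomp Require Import all_classical all_reals all_analysis.
From mathcomp Require Import ring lra zify.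
Import Order.TTheory GRing.Theory Num.Theory numFieldNormedType.Exports.
Local Open Scope classical_set_scope.
Local Open Scope ring_scope.
Set Implicit Arguments.
Unset Strict Implicit.
Unset Printing Implicit Defensive.

(** * Smooth functions *)

(** The obstacle is that one source [q] sees only the angular part of [w]: kernels of degree [1 - n]
    cannot separate the points of a ray from [q]. Separating them takes kernels of all lower
    degrees, hence derivatives in the source, while the sources fill only a curve and offer one
    direction [e]. This suffices because [e . grad] maps onto the kernels of the next degree away
    from the ray of [e]: it has an explicit right inverse there, provided that the primitive still
    has negative degree, hence [n - 1 > 0]. The ray must avoid [supp w - q]; as [e] may be replaced
    by [- e], this is exactly what the absence of two opposite rays in the cone gives. Secants
    replace the tangent, since the velocity may vanish. Nothing controls how fast the secants turn,
    so higher divided differences along [e] are out of reach; Rolle's theorem is applied along each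
    secant separately and only its conclusion is passed to the limit. Kernels are singular at the
    source, so [w] is multiplied by a cutoff and then acts on functions that are smooth near a
    compact set only. *)

(* A wrapper that stops failing unifications from unfolding [smooth_on] down to
   limits. *)
Record smooth_in {R : realType} {V W : normedModType R} (U : set V)
  (f : V -> W) : Prop := SmoothIn { smooth_inW : smooth_on U f }.

Section SmoothAlgebra.
Context {R : realType} {V : normedModType R}.
Implicit Types (f g : V -> R^o) (U : set V) (P : (V -> R^o) -> Prop).

Lemma iter_derive_cat (W : normedModType R) (s t : seq V) (f : V -> W) :
  iter_derive (s ++ t) f = iter_derive s (iter_derive t f).
Proof. by rewrite /iter_derive foldr_cat. Qed.

Lemma smooth_in_iter {W : normedModType R} U (f : V -> W) (s : seq V) :
  smooth_in U f -> smooth_in U (iter_derive s f).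
Proof. by case=> h; split=> t x Ux; rewrite -iter_derive_cat; exact: h. Qed.

Lemma smooth_in_derive {W : normedModType R} U (f : V -> W) v :
  smooth_in U f -> smooth_in U ('D_v f).
Proof. exact: (@smooth_in_iter _ _ _ [:: v]). Qed.

Lemma smooth_in_cont {W : normedModType R} U (f : V -> W) x : smooth_in U f -> U x ->
  {for x, continuous f}.
Proof. by case=> h Ux; case: (h [::] x Ux). Qed.

Lemma smooth_in_is_derive {W : normedModType R} U (f : V -> W) x v :
  smooth_in U f -> U x -> is_derive x v f ('D_v f x).
Proof. by case=> h Ux; apply/derivableP; case: (h [::] x Ux). Qed.

Lemma smooth_in_sub {W : normedModType R} U U' (f : V -> W) : U' `<=` U ->
  smooth_in U f -> smooth_in U' f.
Proof. by move=> UU [h]; split=> s x /UU; exact: h. Qed.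

(** Smoothness concerns all iterated derivatives at once; it follows from any class of continuous
    functions that is stable under directional derivatives. Equality on [U] is enough for stability
    because derivatives are local and [U] is open. *)
Lemma smooth_coind U P : open U ->
  (forall f, P f -> (forall x, U x -> {for x, continuous f}) /\
     forall v, exists2 g, P g & forall x, U x -> is_derive x v f (g x)) ->
  forall f, P f -> smooth_in U f.
Proof.
move=> oU Pd f Pf; split=> s.
have [g [Pg gE]] : exists g, P g /\ forall x, U x -> iter_derive s f x = g x.
  elim: s => [|v s [g [Pg gE]]] /=; first by exists f.
  have [_ /(_ v)[h Ph hd]] := Pd _ Pg.
  exists h; split=> // x Ux; have [_ <-] := hd _ Ux.
  by apply: near_eq_derive; near=> y; apply: gE; near: y; exact: open_nbhs_nbhs.
move=> x Ux.
have E : \forall y \near x, g y = iter_derive s f y.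
  by near=> y; apply/esym/gE; near: y; exact: open_nbhs_nbhs.
have [gc gd] := Pd _ Pg; split.
  rewrite /prop_for/continuous_at gE//.
  by apply: cvg_trans (gc x Ux); exact: near_eq_cvg.
move=> v; have [h _ hd] := gd v; have [? _] := hd _ Ux.
exact: near_eq_derivable E _.
Unshelve. all: by end_near. Qed.

(* Coinduction up to sums and products: it suffices to differentiate the
   generators, with derivatives expressed algebraically. *)
Inductive alg U P : (V -> R^o) -> Prop :=
| alg_gen f : P f -> alg U P f
| alg_smooth f : smooth_in U f -> alg U P f
| alg_add f g : alg U P f -> alg U P g -> alg U P (fun x => f x + g x)
| alg_mul f g : alg U P f -> alg U P g -> alg U P (fun x => f x * g x).

Lemma smooth_alg U P : open U ->
  (forall f, P f -> (forall x, U x -> {for x, continuous f}) /\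
     forall v, exists2 g, alg U P g & forall x, U x -> is_derive x v f (g x)) ->
  forall f, alg U P f -> smooth_in U f.
Proof.
move=> oU Pd; apply: smooth_coind => // f; elim=> {f}.
- by move=> f /Pd.
- move=> f sf; split=> [x Ux|v]; first exact: smooth_in_cont sf Ux.
  exists ('D_v f); first exact/alg_smooth/smooth_in_derive.
  by move=> x; exact: smooth_in_is_derive.
- move=> f g _ [cf df] _ [cg dg]; split=> [x Ux|v].
    by apply: (@continuousD _ _ _ f g); [exact: cf|exact: cg].
  have [f' Pf' f'd] := df v; have [g' Pg' g'd] := dg v.
  exists (fun x => f' x + g' x); first exact: alg_add.
  move=> x Ux; exact: is_deriveD (f'd x Ux) (g'd x Ux).
- move=> f g af [cf df] ag [cg dg]; split=> [x Ux|v].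
    by apply: (@continuousM _ _ f g); [exact: cf|exact: cg].
  have [f' Pf' f'd] := df v; have [g' Pg' g'd] := dg v.
  exists (fun x => f x * g' x + g x * f' x).
    by apply: alg_add; exact: alg_mul.
  move=> x Ux; exact: is_deriveM (f'd x Ux) (g'd x Ux).
Qed.

Lemma smooth_inD U f g : open U -> smooth_in U f -> smooth_in U g ->
  smooth_in U (fun x => f x + g x : R^o).
Proof.
move=> oU sf sg; apply: (@smooth_alg U (fun=> False)) => //.
by apply: alg_add; exact: alg_smooth.
Qed.

Lemma smooth_inM U f g : open U -> smooth_in U f -> smooth_in U g ->
  smooth_in U (fun x => f x * g x : R^o).
Proof.
move=> oU sf sg; apply: (@smooth_alg U (fun=> False)) => //.
by apply: alg_mul; exact: alg_smooth.
Qed.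

Lemma smooth_in_ext U f g : open U -> (forall x, U x -> f x = g x) ->
  smooth_in U f -> smooth_in U g.
Proof.
move=> oU fg sf.
apply: (@smooth_coind U (fun h => exists2 k, smooth_in U k & forall x, U x -> k x = h x)) => //; last by exists f.
move=> {sf fg} {f}{g} h [k sk kh].
have E x : U x -> \forall y \near x, k y = h y.
  by move=> Ux; near=> y; apply/kh; near: y; exact: open_nbhs_nbhs.
split=> [x Ux|v].
  rewrite /prop_for/continuous_at -kh//.
  by apply: cvg_trans (smooth_in_cont sk Ux); apply: near_eq_cvg; exact: E.
exists ('D_v k).
  exists ('D_v k); [exact: smooth_in_derive|by move=> x _].
move=> x Ux; apply: near_eq_is_derive (E _ Ux) _.
exact: smooth_in_is_derive sk Ux.
Unshelve. all: by end_near. Qed.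

Lemma smooth_in_cst U (c : R^o) : smooth_in U (fun=> c).
Proof.
have : smooth_in setT (fun _ : V => c).
  apply: (@smooth_coind setT (fun h => exists c, h = fun=> c)) => //; last by exists c.
  - exact: openT.
  - move=> f [d ->]; split=> [x _|v]; first exact: cst_continuous.
    exists (fun=> 0); first by exists 0.
    by move=> x _; exact: is_derive_cst.
by apply: smooth_in_sub.
Qed.

Lemma smooth_inN U f : open U -> smooth_in U f -> smooth_in U (fun x => - f x : R^o).
Proof.
move=> oU sf; apply: (smooth_in_ext oU (f := fun x => -1 * f x)).
  by move=> x _; rewrite mulN1r.
by apply: smooth_inM => //; exact: smooth_in_cst.
Qed.

Lemma smooth_inB U f g : open U -> smooth_in U f -> smooth_in U g ->
  smooth_in U (fun x => f x - g x : R^o).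
Proof. by move=> oU sf sg; apply: smooth_inD => //; exact: smooth_inN. Qed.

Lemma smooth_in_sum U (I : Type) (r : seq I) (Q : pred I) (F : I -> V -> R^o) : open U ->
  (forall i, Q i -> smooth_in U (F i)) ->
  smooth_in U (fun x => \sum_(i <- r | Q i) F i x : R^o).
Proof.
move=> oU sF; elim: r => [|i r IH].
  apply: (smooth_in_ext oU (f := fun=> 0)); last exact: smooth_in_cst.
  by move=> x _; rewrite big_nil.
have [Qi|nQi] := boolP (Q i).
  apply: (smooth_in_ext oU (f := fun x => F i x + \sum_(i <- r | Q i) F i x)).
    by move=> x _; rewrite big_cons Qi.
  by apply: smooth_inD => //; exact: sF.
apply: smooth_in_ext oU _ IH.
by move=> x _; rewrite big_cons (negbTE nQi).
Qed.

Lemma smooth_in_prod U (I : Type) (r : seq I) (Q : pred I) (F : I -> V -> R^o) : open U ->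
  (forall i, Q i -> smooth_in U (F i)) ->
  smooth_in U (fun x => \prod_(i <- r | Q i) F i x : R^o).
Proof.
move=> oU sF; elim: r => [|i r IH].
  apply: (smooth_in_ext oU (f := fun=> 1)); last exact: smooth_in_cst.
  by move=> x _; rewrite big_nil.
have [Qi|nQi] := boolP (Q i).
  apply: (smooth_in_ext oU (f := fun x => F i x * \prod_(i <- r | Q i) F i x)).
    by move=> x _; rewrite big_cons Qi.
  by apply: smooth_inM => //; exact: sF.
apply: smooth_in_ext oU _ IH.
by move=> x _; rewrite big_cons (negbTE nQi).
Qed.

Lemma smooth_inX U f k : open U -> smooth_in U f -> smooth_in U (fun x => f x ^+ k : R^o).
Proof.
move=> oU sf; elim: k => [|k IH].
  by apply: (smooth_in_ext oU (f := fun=> 1)) => [x _|]; [rewrite expr0|exact: smooth_in_cst].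
apply: (smooth_in_ext oU (f := fun x => f x * f x ^+ k)) => [x _|]; first by rewrite exprS.
exact: smooth_inM.
Qed.

End SmoothAlgebra.

Section SmoothComp1.
Context {R : realType} {V : normedModType R}.
Implicit Types (f g : V -> R^o) (U : set V).

Lemma is_derive_comp1 (phi : R -> R) (f : V -> R) x v :
  derivable f x v -> derivable phi (f x) 1 ->
  is_derive x v (phi \o f) ('D_1 phi (f x) * 'D_v f x).
Proof.
move=> df dphi; pose l (h : R) : R := f (h *: v + x).
have dl : derivable l 0 1 := (derivable1P f x v).1 df.
have l0 : l 0 = f x by rewrite /l scale0r add0r.
have dph : derivable phi (l 0) 1 by rewrite l0.
have E (g : V -> R) : 'D_v g x = (fun h : R => g (h *: v + x))^`()%classic 0.
  rewrite derive1E /derive; set g1 := fun h => h^-1 *: _; set g2 := fun h => h^-1 *: _.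
  suff -> : g1 = g2 by [].
  by apply/funext => h; rewrite /g1 /g2 /= addr0 scale0r add0r [_%:A]mulr1.
apply: DeriveDef.
  apply: (derivable1P (phi \o f) x v).2.
  have dp := (derivable1_diffP _ _).1 dph; have dd := (derivable1_diffP _ _).1 dl.
  exact: ((derivable1_diffP (phi \o l) 0).2 (differentiable_comp dd dp)).
transitivity ((phi \o l)^`()%classic 0); first exact: E.
rewrite (derive1_comp dl dph) l0 derive1E (E f); reflexivity.
Qed.

Lemma smooth_in_comp1 U (A : set R^o) (phi : R^o -> R^o) f : open U ->
  smooth_in A phi -> smooth_in U f -> (forall x, U x -> A (f x)) ->
  smooth_in U (phi \o f : V -> R^o).
Proof.
move=> oU sphi sf fA.
apply: (@smooth_alg _ _ U (fun h => exists2 phi : R^o -> R^o, smooth_in A phi & h = phi \o f)) => //; last first.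
  by apply: alg_gen; exists phi.
move=> _ [{sphi}{}phi sphi ->]; split=> [x Ux|v].
  apply: continuous_comp; first exact: smooth_in_cont sf Ux.
  exact: (smooth_in_cont sphi (fA _ Ux)).
exists (fun x => ('D_1 phi \o f) x * 'D_v f x).
  apply: alg_mul; last exact/alg_smooth/smooth_in_derive.
  by apply: alg_gen; exists ('D_1 phi) => //; exact: smooth_in_derive.
move=> x Ux.
have [df _] := smooth_in_is_derive v sf Ux.
have [dphi _] := smooth_in_is_derive (1 : R^o) sphi (fA _ Ux).
exact (is_derive_comp1 df dphi).
Qed.

Lemma smooth_inV U f : open U -> smooth_in U f -> (forall x, U x -> f x != 0) ->
  smooth_in U (fun x => (f x)^-1 : R^o).
Proof.
move=> oU sf f0.
apply: (@smooth_alg _ _ U (fun h => h = fun x => (f x)^-1)) => //; last exact: alg_gen.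
move=> _ ->; split=> [x Ux|v].
  by apply: continuousV; [exact: f0|exact: smooth_in_cont sf Ux].
exists (fun x => (f x)^-1 * ((f x)^-1 * (- 'D_v f x))).
  apply: alg_mul; first exact: alg_gen.
  apply: alg_mul; first exact: alg_gen.
  by apply/alg_smooth/smooth_inN => //; exact: smooth_in_derive.
move=> x Ux; have [df _] := smooth_in_is_derive v sf Ux.
apply: DeriveDef; first by apply: derivableV => //; exact: f0.
rewrite (deriveV (f0 _ Ux) df) !mulrN mulrA -expr2 exprVn -mulNr; reflexivity.
Qed.

End SmoothComp1.

(** * The mean value theorem along lines and total differentials *)

Section LineMVT.
Context {R : realType} {V : normedModType R}.

Lemma near_normP (x : V) (P : V -> Prop) :
  (\forall y \near x, P y) <-> exists2 d : R, 0 < d & forall y, `|y - x| < d -> P y.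
Proof.
split=> [/nbhs_normP[d /= d0 Pd]|[d d0 Pd]].
  by exists d => // y yd; apply: Pd; rewrite /ball_ /= distrC.
by apply/nbhs_normP; exists d => // y; rewrite /ball_ /= distrC; exact: Pd.
Qed.

Lemma is_derive_line (W : normedModType R) (f : V -> W) x v t :
  derivable f (x + t *: v) v ->
  is_derive t (1 : R) (fun t : R => f (x + t *: v)) ('D_v f (x + t *: v)).
Proof.
move=> df.
have E : (fun h : R => h^-1 *: (((fun t : R => f (x + t *: v)) \o shift t) (h *: 1) - f (x + t *: v)))
  = (fun h => h^-1 *: ((f \o shift (x + t *: v)) (h *: v) - f (x + t *: v))).
  apply/funext => h /=; rewrite [h *: 1]mulr1; congr (_ *: (f _ - _)).
  by rewrite scalerDl addrCA.
by apply: DeriveDef; rewrite /derivable /derive E.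
Qed.

(** The step [c] may have any sign, and the intermediate point is given by its relative position
    [t], which spares the users a case analysis. The strict bound [0 < t] keeps successive zeros
    away from the origin when Rolle's theorem is iterated. *)
Lemma line_MVT_oo (f : V -> R) x v c :
  (forall t, 0 <= t <= 1 -> derivable f (x + (t * c) *: v) v) ->
  exists2 t, 0 < t < 1 & f (x + c *: v) - f x = c * 'D_v f (x + (t * c) *: v).
Proof.
move=> df; pose g (t : R) : R := f (x + t *: v).
have dg t : 0 <= t <= 1 -> is_derive (t * c) 1 g ('D_v f (x + (t * c) *: v)).
  by move=> /df; exact: is_derive_line.
have gE : f (x + c *: v) - f x = g c - g 0 by rewrite /g scale0r addr0.
have gd t : 0 <= t <= 1 -> {for t * c, continuous g}.
  by move=> /dg [dgt _]; apply/differentiable_continuous/derivable1_diffP.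
rewrite gE; case: (ltgtP c 0) => [c0|c0|->].
- have sc t : c <= t <= 0 -> 0 <= t / c <= 1 /\ t / c * c = t.
    move=> /andP[ct t0]; rewrite divfK ?lt_eqF//; split=> //.
    by rewrite ler_ndivrMr// mul1r ct ler_ndivlMr// mul0r t0.
  have [t| |t] := @MVT R g (fun t => 'D_v f (x + t *: v)) c 0 c0.
  + rewrite in_itv /= => /andP[ct t0].
    by have [/dg] := sc t (introT andP (conj (ltW ct) (ltW t0))) => + E; rewrite E.
  + apply: continuous_in_subspaceT => t; rewrite inE /= in_itv /= => /sc[/gd + E].
    by rewrite E.
  + rewrite in_itv /= => /andP[ct t0] E.
    have [_ tcE] := sc t (introT andP (conj (ltW ct) (ltW t0))).
    exists (t / c); last by rewrite tcE -opprB E sub0r mulrN opprK mulrC.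
    by rewrite ltr_ndivrMr// mul1r ct ltr_ndivlMr// mul0r t0.
- have sc t : 0 <= t <= c -> 0 <= t / c <= 1 /\ t / c * c = t.
    move=> /andP[t0 tc]; rewrite divfK ?gt_eqF//; split=> //.
    by rewrite ler_pdivrMr// mul1r tc ler_pdivlMr// mul0r t0.
  have [t| |t] := @MVT R g (fun t => 'D_v f (x + t *: v)) 0 c c0.
  + rewrite in_itv /= => /andP[ct t0].
    by have [/dg] := sc t (introT andP (conj (ltW ct) (ltW t0))) => + E; rewrite E.
  + apply: continuous_in_subspaceT => t; rewrite inE /= in_itv /= => /sc[/gd + E].
    by rewrite E.
  + rewrite in_itv /= => /andP[ct t0] E.
    have [_ tcE] := sc t (introT andP (conj (ltW ct) (ltW t0))).
    exists (t / c); last by rewrite tcE E subr0 mulrC.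
    by rewrite ltr_pdivrMr// mul1r t0 ltr_pdivlMr// mul0r ct.
- by exists 2^-1; rewrite ?subrr ?mul0r// invr_gt0 ltr0n invf_lt1 ?ltr1n.
Qed.

Lemma line_MVT (f : V -> R) x v c :
  (forall t, 0 <= t <= 1 -> derivable f (x + (t * c) *: v) v) ->
  exists2 t, 0 <= t <= 1 & f (x + c *: v) - f x = c * 'D_v f (x + (t * c) *: v).
Proof.
by move=> /line_MVT_oo[t /andP[t0 t1] E]; exists t; rewrite // (ltW t0) ltW.
Qed.

Lemma differentiable_near (W : normedModType R) (f : V -> W) (L : {linear V -> W}) x :
  continuous L ->
  (forall e : R, 0 < e -> exists2 d, 0 < d &
    forall h, `|h| < d -> `|f (x + h) - f x - L h| <= e * `|h|) ->
  differentiable f x /\ 'd f x = L :> (V -> W).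
Proof.
move=> Lc Hf.
have dd : f \o shift x = cst (f x) + L +o_ 0 id.
  apply/eqaddoP => e /Hf [d d0 Hd].
  apply/nbhs_norm0P; exists d => // h /= hd.
  by rewrite !fctE /= opprD addrA [h + x]addrC; exact: Hd.
have E := diff_unique Lc dd; split=> //.
by apply/diff_locallyP; rewrite E; split.
Qed.

Lemma is_derive_linear (f : V -> R^o) x v :
  (forall a x y, f (a *: x + y) = a * f x + f y) -> is_derive x v f (f v).
Proof.
move=> fl.
have E : \forall h \near 0^', h^-1 *: ((f \o shift x) (h *: v) - f x) = f v.
  near=> h; rewrite /= fl addrK /GRing.scale /= mulKf//.
  by near: h; exact: nbhs_dnbhs_neq.
apply: DeriveDef; first exact: is_cvg_near_cst E.
exact: lim_near_cst E.
Unshelve. all: by end_near. Qed.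

Lemma smooth_in_linear (U : set V) (f : V -> R^o) :
  (forall a x y, f (a *: x + y) = a * f x + f y) -> continuous f -> smooth_in U f.
Proof.
move=> fl fc; suff : smooth_in setT f by apply: smooth_in_sub.
apply: (@smooth_alg _ _ setT (fun h => h = f)); [exact: openT| |exact: alg_gen].
move=> _ ->; split=> [x _|v]; first exact: fc.
exists (fun=> f v); first exact/alg_smooth/smooth_in_cst.
move=> x _; exact: is_derive_linear.
Qed.

End LineMVT.

Section RowVectors.
Context {R : realType}.

Lemma norm_coord n (x : 'rV[R]_n) i : `|x 0 i| <= `|x|.
Proof.
rewrite {2}/Num.Def.normr /= mx_normrE.
exact: (le_bigmax _ (fun ij => `|x ij.1 ij.2|) (0, i)).
Qed.

Lemma norm_row_le n (x : 'rV[R]_n) (M : R) : 0 <= M ->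
  (forall i, `|x 0 i| <= M) -> `|x| <= M.
Proof.
move=> M0 xM; rewrite /Num.Def.normr /= mx_normrE.
by apply: bigmax_le => // -[i j] _ /=; rewrite (ord1 i).
Qed.

Lemma smooth_in_coord n (U : set 'rV[R]_n) i : smooth_in U (fun x => x 0 i : R^o).
Proof.
apply: smooth_in_linear => [a x y|x]; first by rewrite !mxE.
exact: coord_continuous.
Qed.

Lemma is_derive_coord n (x v : 'rV[R]_n) i : is_derive x v (fun x => x 0 i : R^o) (v 0 i).
Proof.
have fl (a : R) (y z : 'rV[R]_n) : (a *: y + z) 0 i = a * y 0 i + z 0 i by rewrite !mxE.
exact: (@is_derive_linear _ _ (fun x : 'rV[R]_n => x 0 i) x v fl).
Qed.

(** Walk from [x] to [x + h] one coordinate at a time and apply the mean value theorem to each leg;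
    all the intermediate points stay within sup norm [|h|] of [x]. *)
Lemma row_telescope n (f : 'rV[R]_n -> R) (x h : 'rV[R]_n) (e : R) (D : 'I_n -> R) :
  (forall i y, `|y| <= `|h| -> derivable f (x + y) (basis_vec i) /\
     `|'D_(basis_vec i) f (x + y) - D i| <= e) ->
  `|f (x + h) - f x - \sum_i h 0 i * D i| <= n%:R * (e * `|h|).
Proof.
move=> Hf.
pose H k : 'rV[R]_n := \row_i (if (i < k)%N then h 0 i else 0).
have H0 : H 0%N = 0 by apply/rowP => i; rewrite !mxE.
have Hn : H n = h by apply/rowP => i; rewrite !mxE ltn_ord.
have HS (i : 'I_n) : H i.+1 = H i + h 0 i *: basis_vec i.
  apply/rowP => j; rewrite !mxE eqxx /= ltnS leq_eqVlt -val_eqE /=.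
  case: eqP => [/val_inj ->|_] /=; first by rewrite ltnn mulr1 add0r.
  by rewrite mulr0 addr0.
have -> : f (x + h) - f x = \sum_(i < n) (f (x + H i.+1) - f (x + H i)).
  rewrite -(big_mkord xpredT (fun i => f (x + H i.+1) - f (x + H i))).
  rewrite (telescope_sumr (fun i => f (x + H i)) (leq0n n)) Hn H0 addr0; reflexivity.
rewrite -sumrB.
apply: le_trans (ler_norm_sum _ _ _) _.
suff L (i : 'I_n) : `|f (x + H i.+1) - f (x + H i) - h 0 i * D i| <= e * `|h|.
  apply: (le_trans (ler_sum _ (fun i _ => L i))).
  by rewrite sumr_const card_ord mulr_natl.
have bd t : 0 <= t <= 1 -> `|H i + (t * h 0 i) *: basis_vec i| <= `|h|.
  move=> /andP[t0 t1]; apply: norm_row_le => // j; rewrite !mxE eqxx /=.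
  have [ji|ji|ji] := ltngtP j i.
  - by rewrite -val_eqE /= ltn_eqF// mulr0 addr0 norm_coord.
  - by rewrite -val_eqE /= gtn_eqF// mulr0 addr0 normr0.
  - rewrite -val_eqE /= ji eqxx mulr1 add0r normrM (ger0_norm t0).
    by apply: le_trans (norm_coord h i); rewrite ler_piMl.
have [t t01|t t01 E] := @line_MVT R 'rV[R]_n f (x + H i) (basis_vec i) (h 0 i).
  by rewrite -addrA; have [] := Hf i _ (bd t t01).
rewrite HS addrA E -mulrBr normrM mulrC.
apply: ler_pM => //; last exact: norm_coord.
by rewrite -addrA; have [] := Hf i _ (bd t t01).
Qed.

(** Smoothness only provides directional derivatives, while the chain rule needs a total
    differential; continuity of the partial derivatives supplies it. *)
Lemma smooth_differentiable n (O : set 'rV[R]_n) (f : 'rV[R]_n -> R^o) x :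
  open O -> smooth_in O f -> O x ->
  differentiable f x /\ forall h, 'd f x h = \sum_i h 0 i * 'D_(basis_vec i) f x.
Proof.
move=> oO sf Ox.
pose L (h : 'rV[R]_n) : R^o := \sum_i h 0 i * 'D_(basis_vec i) f x.
have Llin : linear L.
  move=> a u v; rewrite /L scaler_sumr -big_split /=; apply: eq_bigr => i _.
  by rewrite !mxE mulrDl -mulrA.
pose HL := GRing.isLinear.Build R 'rV[R]_n R^o _ L Llin.
pose L' : {linear 'rV[R]_n -> R^o} := HB.pack L HL.
have Lc : continuous L'.
  move=> y; apply: (@smooth_in_cont _ _ _ setT) => //.
  apply: smooth_in_sum; first exact: openT.
  move=> i _; apply: smooth_inM; [exact: openT|exact: smooth_in_coord|exact: smooth_in_cst].
have [|df E] := @differentiable_near _ _ _ f L' x Lc.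
  move=> e e0.
  (* The telescoped error has [n] terms; dividing by [n.+1] also covers [n = 0]. *)
  have [d d0 Hd] : exists2 d, 0 < d & forall y, `|y| <= d -> O (x + y) /\
      forall i, `|'D_(basis_vec i) f (x + y) - 'D_(basis_vec i) f x| <= e / n.+1%:R.
    have : \forall y \near x, O y /\ forall i, `|'D_(basis_vec i) f y - 'D_(basis_vec i) f x| <= e / n.+1%:R.
      near=> y; split; first by near: y; exact: open_nbhs_nbhs.
      near: y; apply: filter_forall => i.
      have c : {for x, continuous ('D_(basis_vec i) f)}.
        by apply: (smooth_in_cont (smooth_in_derive (basis_vec i) sf) Ox).
      have /cvgrPdist_le/(_ (e / n.+1%:R)) := c.
      rewrite divr_gt0// => /(_ isT); apply: filterS => y.
      by rewrite distrC.
    move=> /near_normP[d d0 Hd]; exists (d / 2) => [|y yd]; first by rewrite divr_gt0.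
    apply: (Hd (x + y)); rewrite addrC addKr.
    by rewrite (le_lt_trans yd)// ltr_pdivrMr// ltr_pMr// ltr1n.
  exists d => // h /ltW hd.
  apply: le_trans (@row_telescope n f x h (e / n.+1%:R) (fun i => 'D_(basis_vec i) f x) _) _.
    move=> i y yh; have [Oy Dy] := Hd y (le_trans yh hd); split; last exact: Dy.
    by have [] := smooth_in_is_derive (basis_vec i) sf Oy.
  rewrite mulrA ler_wpM2r// mulrCA ler_piMr ?(ltW e0)// ler_pdivrMr// mul1r ler_nat.
  exact: leqnSn.
by split=> // h; rewrite E.
Unshelve. all: by end_near. Qed.

End RowVectors.

(** * Symmetry of mixed derivatives *)

Section Schwarz.
Context {R : realType} {V : normedModType R}.
Implicit Types (f g : V -> R^o) (O : set V).

(** The second difference is the increment in direction [u] of the increment in direction [v], so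
    the mean value theorem applies twice. *)
Lemma second_difference O f x u v (h d : R) : open O -> smooth_in O f -> 0 < h ->
  (forall y, `|y - x| < d -> O y) -> h * (`|u| + `|v|) < d ->
  exists2 y, `|y - x| < d &
    f (x + h *: u + h *: v) - f (x + h *: u) - (f (x + h *: v) - f x)
    = h * (h * 'D_v ('D_u f) y).
Proof.
move=> oO sf h0 dO hd.
have near_x (s t : R) : 0 <= s <= 1 -> 0 <= t <= 1 ->
    `|x + (s * h) *: u + (t * h) *: v - x| < d.
  move=> /andP[s0 s1] /andP[t0 t1]; apply: le_lt_trans hd.
  rewrite addrAC (addrAC x) subrr add0r; apply: le_trans (ler_normD _ _) _.
  rewrite mulrDr; apply: lerD; rewrite normrZ ger0_norm ?mulr_ge0// ?(ltW h0)//;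
    by rewrite ler_wpM2r// ler_piMl// ltW.
have Oin s t : 0 <= s <= 1 -> 0 <= t <= 1 -> O (x + (s * h) *: u + (t * h) *: v).
  by move=> s01 t01; apply/dO/near_x.
have z01 : 0 <= (0 : R) <= 1 by rewrite lexx ler01.
have o01 : 0 <= (1 : R) <= 1 by rewrite lexx ler01.
have shift_derive t y : O (y + (t * h) *: v) ->
    is_derive y u (fun y => f (y + (t * h) *: v)) ('D_u f (y + (t * h) *: v)).
  move=> /(smooth_in_is_derive u sf)[df _].
  have E : (fun k : R => k^-1 *: (((fun y => f (y + (t * h) *: v)) \o shift y) (k *: u) - f (y + (t * h) *: v)))
      = (fun k => k^-1 *: ((f \o shift (y + (t * h) *: v)) (k *: u) - f (y + (t * h) *: v))).
    by apply/funext => k /=; rewrite addrA.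
  by apply: DeriveDef; rewrite /derivable /derive E.
pose phi : V -> R := fun y => f (y + (1 * h) *: v) - f (y + (0 * h) *: v).
have dphi s : 0 <= s <= 1 -> is_derive (x + (s * h) *: u) u phi
    ('D_u f (x + (s * h) *: u + (1 * h) *: v) - 'D_u f (x + (s * h) *: u + (0 * h) *: v)).
  move=> s01.
  exact: (is_deriveB (shift_derive _ _ (Oin s 1 s01 o01)) (shift_derive _ _ (Oin s 0 s01 z01))).
have [s s01|s s01] := @line_MVT R V phi x u h.
  by have [] := dphi s s01.
have [_ ->] := dphi s s01.
have [t t01|t t01] := @line_MVT R V ('D_u f) (x + (s * h) *: u) v h.
  by have [] := smooth_in_is_derive v (smooth_in_derive u sf) (Oin s t s01 t01).
rewrite mul1r mul0r scale0r addr0 => -> E.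
exists (x + (s * h) *: u + (t * h) *: v); first exact: near_x.
by rewrite -E /phi mul1r mul0r !scale0r !addr0.
Qed.

(** The second difference is symmetric in [u] and [v], so the two mixed derivatives take a common
    value at points arbitrarily close to [x]; continuity concludes. *)
Lemma derive_swap O f x u v : open O -> smooth_in O f -> O x ->
  'D_v ('D_u f) x = 'D_u ('D_v f) x.
Proof.
move=> oO sf Ox; apply/eqP; rewrite -subr_eq0 -normr_le0; apply/ler_addgt0Pl => e e0.
rewrite addr0; apply/ltW.
have cont w w' : exists2 d, 0 < d & forall y, `|y - x| < d ->
    O y /\ `|'D_w ('D_w' f) y - 'D_w ('D_w' f) x| < e / 2.
  have H : \forall y \near x, `|'D_w ('D_w' f) x - 'D_w ('D_w' f) y| < e / 2.
    have /cvgrPdist_lt/(_ (e / 2)) := smooth_in_cont (smooth_in_derive w (smooth_in_derive w' sf)) Ox.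
    by rewrite divr_gt0// => /(_ isT).
  apply/near_normP; near=> y; split; first by near: y; exact: open_nbhs_nbhs.
  by rewrite distrC; near: y.
have [d1 d10 H1] := cont v u; have [d2 d20 H2] := cont u v.
pose d := Num.min d1 d2; have d0 : 0 < d by rewrite lt_min d10.
(* The summand 1 keeps the denominator positive when [u] and [v] vanish. *)
pose h := d / (2 * (`|u| + `|v| + 1)).
have uv0 : 0 < `|u| + `|v| + 1 by rewrite ltr_pwDr// addr_ge0.
have h0 : 0 < h by rewrite divr_gt0// mulr_gt0.
have hd : h * (`|u| + `|v|) < d.
  rewrite /h mulrAC ltr_pdivrMr ?mulr_gt0// ltr_pM2l//.
  rewrite mulr2n mulrDl mul1r; apply: ltr_pwDl => //.
  by rewrite lerDl.
have dO y : `|y - x| < d -> O y.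
  by rewrite lt_min => /andP[/H1[]].
have [y yd E] := second_difference oO sf h0 dO hd.
have [z zd E'] := second_difference (u := v) (v := u) oO sf h0 dO (eq_ind _ (fun a => h * a < d) hd _ (addrC _ _)).
have M : f (x + h *: u + h *: v) - f (x + h *: u) - (f (x + h *: v) - f x) =
    f (x + h *: v + h *: u) - f (x + h *: v) - (f (x + h *: u) - f x).
  rewrite (addrAC x); ring.
have h0' := lt0r_neq0 h0.
have {M E E'}E := mulfI h0' (mulfI h0' (etrans (esym E) (etrans M E'))).
rewrite lt_min in yd; rewrite lt_min in zd.
have /andP[/H1[_ Hy] _] := yd; have /andP[_ /H2[_ Hz]] := zd.
rewrite E in Hy; rewrite distrC in Hy.
rewrite [ltRHS]splitr.
apply: le_lt_trans (ltrD Hy Hz).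
exact: ler_distD.
Unshelve. all: by end_near. Qed.

Lemma iter_derive_ext O (f g : V -> R^o) s x : open O -> (forall y, O y -> f y = g y) -> O x ->
  iter_derive s f x = iter_derive s g x.
Proof.
move=> oO fg; elim: s x => [|v s IH] x Ox /=; first exact: fg.
by apply: near_eq_derive; near=> y; apply: IH; near: y; exact: open_nbhs_nbhs.
Unshelve. all: by end_near. Qed.

Lemma iter_derive_swap O f x s v : open O -> smooth_in O f -> O x ->
  iter_derive s ('D_v f) x = 'D_v (iter_derive s f) x.
Proof.
move=> oO sf; elim: s x => [//|u s IH] x Ox /=.
rewrite (derive_swap _ _ oO (smooth_in_iter s sf) Ox).
by apply: near_eq_derive; near=> y; apply: IH; near: y; exact: open_nbhs_nbhs.
Unshelve. all: by end_near. Qed.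

Lemma iter_derive_perm (T : eqType) (F : T -> V) O f x (s t : seq T) :
  open O -> smooth_in O f -> O x ->
  perm_eq s t -> iter_derive (map F s) f x = iter_derive (map F t) f x.
Proof.
move=> oO sf; elim: s t x => [|u s IH] t x Ox.
  by move=> /perm_size/esym/size0nil ->.
move=> st; have ut : u \in t by rewrite -(perm_mem st) mem_head.
have /(perm_trans st) : perm_eq t (u :: rem u t) by exact: perm_to_rem.
rewrite perm_cons => /IH {}IH.
transitivity ('D_(F u) (iter_derive (map F (rem u t)) f) x).
  rewrite /=; apply: near_eq_derive; near=> y; apply: IH; near: y; exact: open_nbhs_nbhs.
elim: t ut {st IH} x Ox => //= w t IH; rewrite inE eq_sym => ut x Ox.
case: eqP ut => [-> //|_ /= ut].
rewrite (derive_swap _ _ oO (smooth_in_iter _ sf) Ox).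
by apply: near_eq_derive; near=> y; apply: IH => //; near: y; exact: open_nbhs_nbhs.
Unshelve. all: by end_near. Qed.

End Schwarz.

Section Chain.
Context {R : realType} {V : normedModType R}.

Lemma derive_dir n (O : set 'rV[R]_n) (f : 'rV[R]_n -> R^o) x v : open O -> smooth_in O f -> O x ->
  'D_v f x = \sum_i v 0 i * 'D_(basis_vec i) f x.
Proof.
move=> oO sf Ox; have [df E] := smooth_differentiable oO sf Ox.
by rewrite -E deriveE.
Qed.

Lemma is_derive_comp m (O : set 'rV[R]_m) (g : 'rV[R]_m -> R^o) (Z : V -> 'rV[R]_m) x v :
  open O -> smooth_in O g -> O (Z x) -> (forall i, derivable (fun x => Z x 0 i) x v) ->
  is_derive x v (g \o Z : V -> R^o) (\sum_i 'D_v (fun x => Z x 0 i) x * 'D_(basis_vec i) g (Z x)).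
Proof.
move=> oO sg OZ dZ.
have [dg E] := smooth_differentiable oO sg OZ.
have dZx : derivable Z x v by apply/derivable_mxP => i j; rewrite (ord1 i).
pose l (h : R) := Z (h *: v + x).
have l0 : l 0 = Z x by rewrite /l scale0r add0r.
have dl : derivable l 0 1 := (derivable1P Z x v).1 dZx.
have dl' : differentiable l 0 := (derivable1_diffP _ _).1 dl.
have Dl : 'D_1 l 0 = 'D_v Z x.
  rewrite /derive; set g1 := fun h => h^-1 *: _; set g2 := fun h => h^-1 *: _.
  suff -> : g1 = g2 by [].
  by apply/funext => h; rewrite /g1 /g2 /l /= addr0 scale0r add0r [_%:A]mulr1.
have dg' : differentiable g (l 0) by rewrite l0.
have dgl : differentiable (g \o l) 0 := differentiable_comp dl' dg'.
have D : derivable (g \o Z) x v.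
  by apply: (derivable1P (g \o Z) x v).2; exact: (derivable1_diffP (g \o l) 0).2 dgl.
apply: DeriveDef D _.
have -> : 'D_v (g \o Z) x = 'D_1 (g \o l) 0.
  rewrite /derive; set g1 := fun h => h^-1 *: _; set g2 := fun h => h^-1 *: _.
  suff -> : g1 = g2 by [].
  by apply/funext => h; rewrite /g1 /g2 /l /= addr0 scale0r add0r [_%:A]mulr1.
rewrite (deriveE _ dgl) (diff_comp dl' dg') /= -(deriveE _ dl') Dl l0 E.
by apply: eq_bigr => i _; rewrite (derive_mx dZx) mxE.
Qed.

Lemma continuous_rows m (U : set V) (Z : V -> 'rV[R]_m) x :
  (forall i, smooth_in U (fun x => Z x 0 i : R^o)) -> U x -> {for x, continuous Z}.
Proof.
move=> sZ Ux; apply/cvgrPdist_le => e e0.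
have : forall i, \forall y \near x, `|Z x 0 i - Z y 0 i| <= e.
  by move=> i; have /cvgrPdist_le/(_ _ e0) := smooth_in_cont (sZ i) Ux.
move=> /(filter_forall) => H.
have {}H : \forall y \near x, forall i, `|Z x 0 i - Z y 0 i| <= e by exact: H.
near=> y; apply: norm_row_le; first exact: ltW.
have Hy : forall i, `|Z x 0 i - Z y 0 i| <= e by near: y.
by move=> i; rewrite !mxE; exact: Hy.
Unshelve. all: by end_near. Qed.

Lemma open_near O (x : V) : open O -> O x -> \forall y \near x, O y.
Proof. by move=> oO Ox; apply: open_nbhs_nbhs. Qed.

Lemma open_preimage m (U : set V) (Z : V -> 'rV[R]_m) O : open U ->
  (forall i, smooth_in U (fun x => Z x 0 i : R^o)) -> open O -> open (U `&` Z @^-1` O).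
Proof.
move=> oU sZ oO; rewrite openE => x [Ux OZ].
have H : \forall y \near x, O (Z y).
  exact: (continuous_rows sZ Ux (open_nbhs_nbhs (conj oO OZ))).
have H2 := open_near oU Ux.
by near=> y; split; near: y.
Unshelve. all: by end_near. Qed.

Lemma smooth_in_comp m (O : set 'rV[R]_m) (g : 'rV[R]_m -> R^o) (U : set V) (Z : V -> 'rV[R]_m) :
  open O -> open U -> smooth_in O g -> (forall x, U x -> O (Z x)) ->
  (forall i, smooth_in U (fun x => Z x 0 i : R^o)) ->
  smooth_in U (g \o Z : V -> R^o).
Proof.
move=> oO oU sg OZ sZ.
apply: (@smooth_alg _ _ U (fun h => exists2 g : 'rV[R]_m -> R^o, smooth_in O g & h = g \o Z)) => //; last first.
  by apply: alg_gen; exists g.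
move=> _ [{sg}{}g sg ->].
have dZ x v i : U x -> derivable (fun x => Z x 0 i) x v.
  by move=> Ux; have [] := smooth_in_is_derive v (sZ i) Ux.
split=> [x Ux|v].
  apply: continuous_comp; last exact: (smooth_in_cont sg (OZ _ Ux)).
  exact: continuous_rows sZ Ux.
exists (fun x => \sum_i 'D_v (fun x => Z x 0 i) x * 'D_(basis_vec i) g (Z x)).
  elim: (index_enum _) => [|i r IH].
    apply: alg_smooth; apply: (smooth_in_ext oU (f := fun=> 0)) => [x _|].
      by rewrite big_nil.
    exact: smooth_in_cst.
  rewrite (_ : (fun x => _) = (fun x => 'D_v (fun x => Z x 0 i) x * 'D_(basis_vec i) g (Z x) +
       \sum_(i <- r) 'D_v (fun x => Z x 0 i) x * 'D_(basis_vec i) g (Z x))); last first.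
    by apply/funext => x; rewrite big_cons.
  apply: alg_add => //; apply: alg_mul; first exact/alg_smooth/smooth_in_derive.
  by apply: alg_gen; exists ('D_(basis_vec i) g) => //; exact: smooth_in_derive.
move=> x Ux; apply: (is_derive_comp oO) => //; first exact: OZ.
by move=> i; exact: dZ.
Unshelve. all: by end_near. Qed.

End Chain.

(** * Cutoff functions *)

Section Steps.
Context {R : realType}.

(** The factors [x^-1 ^+ k] make the family stable under differentiation: the derivative of [flat k]
    is a combination of [flat k.+2] and [flat k.+1]. *)
Definition flat (k : nat) (x : R) : R := if 0 < x then x^-1 ^+ k * expR (- x^-1) else 0.

(** With [M = m + 1], this is the power [M] of [exp (1 / (M h)) >= 1 / (M h)], inverted. *)
Lemma expR_inv_le (m : nat) (h : R) : 0 < h -> expR (- h^-1) <= (m.+1%:R * h) ^+ m.+1.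
Proof.
move=> h0; rewrite expRN -[leRHS]invrK lef_pV2 ?posrE ?expR_gt0 ?invr_gt0 ?exprn_gt0 ?mulr_gt0//.
have -> : h^-1 = m.+1%:R * (m.+1%:R * h)^-1.
  by rewrite invfM mulrA divff ?mul1r// pnatr_eq0.
rewrite expRM_natl -exprVn; apply: lerXn2r; rewrite ?nnegrE ?invr_ge0 ?mulr_ge0 ?expR_ge0 ?(ltW h0)//.
by apply: le_trans (expR_ge1Dx _); rewrite lerDr.
Qed.

(** A quadratic bound already forces a zero derivative at the origin; the exponent [k.+2] of the
    exponential estimate absorbs the pole of order [k]. *)
Lemma flat_le k x : `|flat k x| <= (k.+2%:R) ^+ k.+2 * x ^+ 2.
Proof.
rewrite /flat; case: ifP => x0; last by rewrite normr0 mulr_ge0 ?sqr_ge0// exprn_ge0.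
rewrite ger0_norm ?mulr_ge0 ?exprn_ge0 ?expR_ge0 ?invr_ge0 ?(ltW x0)//.
apply: (le_trans (ler_wpM2l _ (expR_inv_le k.+1 x0))).
  by rewrite exprn_ge0// invr_ge0 ltW.
rewrite exprMn mulrCA ler_pM2l ?exprn_gt0//.
rewrite -[k.+2]addn2 exprD mulrA -exprMn mulVf ?gt_eqF// expr1n mul1r; exact: lexx.
Qed.

Lemma is_derive_sq_bound (f : R -> R) C : (forall x, `|f x| <= C * x ^+ 2) -> is_derive (0 : R) (1 : R) f 0.
Proof.
move=> fC.
have f0 : f 0 = 0 by apply/eqP; rewrite -normr_le0 (le_trans (fC 0))// expr0n /= mulr0.
have C0 : 0 <= C.
  by have := le_trans (normr_ge0 _) (fC 1); rewrite expr1n mulr1.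
have D : h^-1 *: ((f \o shift 0) (h *: 1) - f 0) @[h --> 0^'] --> (0 : R).
  apply/cvgrPdist_le => e e0; near=> h.
  rewrite sub0r normrN /= addr0 [h *: 1]mulr1 f0 subr0 normrM normfV.
  have h0 : 0 < `|h| by rewrite normr_gt0; near: h; exact: nbhs_dnbhs_neq.
  rewrite mulrC ler_pdivrMr//; apply: le_trans (fC h) _.
  have -> : h ^+ 2 = `|h| * `|h| by rewrite -normrM -expr2 ger0_norm ?sqr_ge0.
  rewrite mulrA ler_pM2r//.
  have hC : `|h| <= e / (C + 1).
    by near: h; apply: dnbhs0_le; rewrite divr_gt0// ltr_pwDr.
  apply: (le_trans (ler_wpM2l C0 hC)).
  by rewrite mulrCA ler_piMr ?(ltW e0)// ler_pdivrMr ?ltr_pwDr// mul1r lerDl.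
by apply: DeriveDef; [apply/cvg_ex; exists 0|exact: cvg_lim D].
Unshelve. all: by end_near. Qed.

Lemma is_derive_flat k (x : R) :
  is_derive x (1 : R) (flat k) (flat k.+2 x - k%:R * flat k.+1 x).
Proof.
have [x0|x0|->] := ltgtP x 0.
- have -> : flat k.+2 x - k%:R * flat k.+1 x = 0.
    by rewrite /flat ltNge (ltW x0) /= mulr0 subr0.
  apply: (@near_eq_is_derive R R R (cst (0 : R))).
  near=> y; rewrite /flat ltNge (_ : y <= 0 = true)//=.
  by apply/ltW; near: y; exact: lt_nbhsl.
- have xn0 : x != 0 by rewrite gt_eqF.
  pose g (y : R) : R := y^-1.
  have dg : is_derive x (1 : R) g (- x^-1 ^+ 2).
    apply: is_derive_eq (@is_deriveV R id x 1 1 xn0 (is_derive_id x 1)) _.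
    by rewrite /GRing.scale /= mulr1 exprVn.
  have de : is_derive x (1 : R) (expR \o (- g)) (- (- x^-1 ^+ 2) * expR (- x^-1)).
    have dN : is_derive x (1 : R) (- g) (- (- x^-1 ^+ 2)) by exact: is_deriveN.
    by apply: is_derive_eq (is_derive1_comp (is_derive_expR ((- g) x)) dN) _; rewrite mulrC.
  apply: (@near_eq_is_derive _ _ _ (g ^+ k * (expR \o (- g)))).
    have pos : \forall y \near x, 0 < y.
      have : \forall y \near x, - y < 0 by apply: Nlt_nbhsl; rewrite oppr_lt0.
      by apply: filterS => y; rewrite oppr_lt0.
    near=> y; rewrite /flat ifT; first by rewrite !fctE.
    by near: y.
  apply: is_derive_eq (is_deriveM (is_deriveX k dg) de) _.
  rewrite /flat x0 /GRing.scale /= /g.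
  case: k => [|k]; last by rewrite !fctE /= !exprS; ring.
  by rewrite !fctE /= !exprS expr0; ring.
- have -> : flat k.+2 0 - k%:R * flat k.+1 0 = 0 by rewrite /flat ltxx mulr0 subr0.
  exact: is_derive_sq_bound (flat_le k).
Unshelve. all: by end_near. Qed.

Lemma is_derive_dir (f : R -> R) x d (v : R) :
  is_derive x (1 : R) f d -> is_derive x v f (v * d).
Proof.
move=> [df <-]; have df' := (derivable1_diffP _ _).1 df.
apply: DeriveDef; first exact: diff_derivable.
rewrite !deriveE// -[v in LHS]mulr1; exact: linearZ.
Qed.

Lemma smooth_flat : smooth_in setT (flat 0 : R^o -> R^o).
Proof.
apply: (@smooth_alg _ R^o setT (fun h => exists k, h = flat k)); [exact: openT| |by apply: alg_gen; exists 0%N].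
move=> _ [k ->]; split=> [x _|v].
  have [d _] := is_derive_flat k x.
  exact/differentiable_continuous/derivable1_diffP.
exists (fun x => v * (flat k.+2 x + (- k%:R) * flat k.+1 x)).
  apply: alg_mul; first exact/alg_smooth/smooth_in_cst.
  apply: alg_add; first by apply: alg_gen; exists k.+2.
  apply: alg_mul; first exact/alg_smooth/smooth_in_cst.
  by apply: alg_gen; exists k.+1.
move=> x _; rewrite mulNr; exact: is_derive_dir (is_derive_flat k x).
Qed.

Lemma smooth_sqrt : smooth_in [set x : R^o | 0 < x] (Num.sqrt : R^o -> R^o).
Proof.
have oA : open [set x : R^o | 0 < x] by exact: open_gt.
(* All derivatives of the square root are polynomials in its inverse, so these two generators
   suffice. *)
pose P (h : R^o -> R^o) := h = Num.sqrt \/ h = fun x => (Num.sqrt x)^-1.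
apply: (@smooth_alg _ R^o _ P oA); last by apply: alg_gen; left.
have dS (x : R) : 0 < x -> is_derive x (1 : R) (Num.sqrt : R -> R) (2^-1 * (Num.sqrt x)^-1).
  by move=> x0; apply: is_derive_eq (is_derive1_sqrt x0) _; rewrite invfM.
have dI (x : R) : 0 < x -> is_derive x (1 : R) (fun x : R => (Num.sqrt x)^-1)
    (- 2^-1 * ((Num.sqrt x)^-1 * ((Num.sqrt x)^-1 * (Num.sqrt x)^-1))).
  move=> x0; have s0 : Num.sqrt x != 0 by rewrite gt_eqF// sqrtr_gt0.
  apply: is_derive_eq (is_deriveV s0 (dS x x0)) _.
  by rewrite /GRing.scale /= -exprVn expr2; ring.
move=> _ [->|->]; split=> [x /= x0|v].
- by have [d _] := dS x x0; exact/differentiable_continuous/derivable1_diffP.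
- exists (fun x => v * (2^-1 * (Num.sqrt x)^-1)); last first.
    by move=> x /dS; exact: is_derive_dir.
  do 2 (apply: alg_mul; first exact/alg_smooth/smooth_in_cst).
  by apply: alg_gen; right.
- by have [d _] := dI x x0; exact/differentiable_continuous/derivable1_diffP.
- exists (fun x => v * (- 2^-1 * ((Num.sqrt x)^-1 * ((Num.sqrt x)^-1 * (Num.sqrt x)^-1)))); last first.
    by move=> x /dI; exact: is_derive_dir.
  do 2 (apply: alg_mul; first exact/alg_smooth/smooth_in_cst).
  by do ?apply: alg_mul; apply: alg_gen; right.
Qed.

Definition step (x : R) : R := flat 0 x / (flat 0 x + flat 0 (1 - x)).

Lemma flat_ge0 k x : 0 <= flat k x.
Proof.
rewrite /flat; case: ifP => // x0.
by rewrite mulr_ge0 ?exprn_ge0 ?invr_ge0 ?expR_ge0 ?(ltW x0).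
Qed.

Lemma flat_gt0 k x : 0 < x -> 0 < flat k x.
Proof. by move=> x0; rewrite /flat x0 mulr_gt0 ?expR_gt0// exprn_gt0// invr_gt0. Qed.

Lemma step_den_gt0 x : 0 < flat 0 x + flat 0 (1 - x).
Proof.
have [x0|x0] := ltP 0 x; first by rewrite ltr_pwDl ?flat_ge0// flat_gt0.
by rewrite ltr_wpDl ?flat_ge0// flat_gt0// subr_gt0 (le_lt_trans x0).
Qed.

Lemma step_ge0 x : 0 <= step x.
Proof. by rewrite divr_ge0 ?flat_ge0// ltW// step_den_gt0. Qed.

Lemma step_le1 x : step x <= 1.
Proof. by rewrite ler_pdivrMr ?step_den_gt0// mul1r lerDl flat_ge0. Qed.

Lemma step0 x : x <= 0 -> step x = 0.
Proof. by move=> x0; rewrite /step {1}/flat ltNge x0 /= mul0r. Qed.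

Lemma step1 x : 1 <= x -> step x = 1.
Proof.
move=> x1; rewrite /step [flat 0 (1 - x)]/flat ltNge subr_le0 x1 /= addr0 divff//.
by rewrite gt_eqF// flat_gt0// (lt_le_trans _ x1).
Qed.

Lemma smooth_step : smooth_in setT (step : R^o -> R^o).
Proof.
have s1 : smooth_in setT (fun x : R^o => flat 0 (1 - x) : R^o).
  apply: (@smooth_in_comp1 R R^o setT setT (flat 0) (fun x => 1 - x)) => //.
  - exact: openT.
  - exact: smooth_flat.
  - apply: smooth_inB; [exact: openT|exact: smooth_in_cst|].
    by apply: smooth_in_linear => // x; exact: cvg_id.
apply: smooth_inM; [exact: openT|exact: smooth_flat|].
apply: smooth_inV; [exact: openT| |by move=> x _; rewrite gt_eqF ?step_den_gt0].
by apply: smooth_inD; [exact: openT|exact: smooth_flat|].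
Qed.

End Steps.

Section Cutoff.
Context {R : realType} {n : nat}.
Implicit Types (L S U : set 'rV[R]_n).

Lemma finite_ball_cover L (r : 'rV[R]_n -> R) : compact L ->
  (forall x, L x -> 0 < r x) ->
  exists2 s : seq 'rV[R]_n, (forall x, x \in s -> L x) &
    forall y, L y -> exists2 x, x \in s & `|y - x| < r x.
Proof.
rewrite compact_cover => cL r0.
have [|y Ly|D DL Lc] := cL _ L (fun x => [set y | `|y - x| < r x]).
- move=> x Lx; rewrite openE => y /= yx; apply: (near_normP y (fun z => `|z - x| < r x)).2.
  exists (r x - `|y - x|); first by rewrite subr_gt0.
  move=> z zy /=; rewrite -(subrKA y) (le_lt_trans (ler_normD _ _))//.
  by rewrite -ltrBrDr.
- by exists y => //=; rewrite subrr normr0 r0.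
- exists (finmap.enum_fset D).
    by move=> x xD; have := DL x xD; rewrite inE.
  by move=> y /Lc[x /= xD yx]; exists x.
Qed.

Lemma cube_compact (c : 'rV[R]_n) r : compact [set x | `|x - c| <= r].
Proof.
apply: bounded_closed_compact.
  exists (`|c| + r); split; first exact: num_real.
  move=> M cM x /= xc; rewrite -(subrK c x) (le_trans (ler_normD _ _))// addrC.
  by rewrite (le_trans _ (ltW cM))// lerD2l.
rewrite (_ : [set x | _] = (fun x => `|x - c|) @^-1` [set y | y <= r])//.
apply: closed_comp; last exact: closed_le.
by move=> x _; apply: continuous_comp; [apply: continuousB; [exact: cvg_id|exact: cst_continuous]|exact: norm_continuous].
Qed.

(** The function [(4 - t ^+ 2) / 3] is at least 1 for [|t| <= 1] and at most 0 for [|t| >= 2]. So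
    the bump is 1 on the cube of radius [r] and 0 outside the cube of radius [2 * r]; the square
    avoids the kink of the absolute value. *)
Definition cube_bump (c : 'rV[R]_n) (r : R) (x : 'rV[R]_n) : R :=
  \prod_i step ((4 - ((x 0 i - c 0 i) / r) ^+ 2) / 3).

Lemma smooth_cube_bump c r : smooth_in setT (cube_bump c r : 'rV[R]_n -> R^o).
Proof.
have oT : open [set: 'rV[R]_n] by exact: openT.
apply: smooth_in_prod => // i _.
apply: (@smooth_in_comp1 R _ setT setT step (fun x : 'rV[R]_n => (4 - ((x 0 i - c 0 i) / r) ^+ 2) / 3)) => //.
  exact: smooth_step.
apply: smooth_inM => //; last exact: smooth_in_cst.
apply: smooth_inB => //; first exact: smooth_in_cst.
apply: smooth_inX => //; apply: smooth_inM => //; last exact: smooth_in_cst.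
apply: smooth_inB => //; [exact: smooth_in_coord|exact: smooth_in_cst].
Qed.

Lemma cube_bump_itv c r x : 0 <= cube_bump c r x <= 1.
Proof.
apply/andP; split; first by apply: prodr_ge0 => i _; exact: step_ge0.
by apply: Num.Theory.prodr_ile1 => i _; rewrite step_ge0 step_le1.
Qed.

Lemma cube_bump1 c r x : 0 < r -> `|x - c| <= r -> cube_bump c r x = 1.
Proof.
move=> r0 xr; rewrite /cube_bump big1// => i _; apply: step1.
rewrite ler_pdivlMr// mul1r lerBrDr -lerBrDl.
rewrite (_ : 4 - 3 = 1 ^+ 2); last by rewrite expr1n; ring.
rewrite -[leLHS](real_normK (num_real _)) ler_pXn2r ?nnegrE// normrM normfV (gtr0_norm r0) ler_pdivrMr// mul1r.
by apply: le_trans xr; have := norm_coord (x - c) i; rewrite !mxE.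
Qed.

Lemma cube_bump0 c r x : 0 < r -> 2 * r < `|x - c| -> cube_bump c r x = 0.
Proof.
move=> r0 xr.
have [i ir] : exists i, 2 * r < `|x 0 i - c 0 i|.
  apply: contrapT => /forallNP H; move: xr; rewrite ltNge; apply/negP/negPn.
  apply: norm_row_le => [|i]; first by rewrite mulr_ge0// ltW.
  by rewrite !mxE leNgt; apply/negP/H.
rewrite /cube_bump (bigD1 i)//= step0 ?mul0r//.
rewrite ler_pdivrMr// mul0r subr_le0.
rewrite (_ : 4 = 2 ^+ 2); last by ring.
rewrite -[leRHS](real_normK (num_real _)) ler_pXn2r ?nnegrE// normrM normfV (gtr0_norm r0) ler_pdivlMr//.
exact: ltW.
Qed.

Lemma open_norm_ball (c : 'rV[R]_n) r : open [set y | `|y - c| < r].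
Proof.
rewrite (_ : [set x | _] = (fun x => `|x - c|) @^-1` [set y | y < r])//.
apply: open_comp; last exact: open_lt.
by move=> x _; apply: continuous_comp; [apply: continuousB; [exact: cvg_id|exact: cst_continuous]|exact: norm_continuous].
Qed.

Lemma cutoff L U : compact L -> open U -> L `<=` U ->
  exists c S, [/\ smooth_in setT (c : 'rV[R]_n -> R^o), (forall x, 0 <= c x <= 1),
    compact S /\ S `<=` U, (forall x, ~ S x -> c x = 0) &
    exists O, [/\ open O, L `<=` O, O `<=` S & forall x, O x -> c x = 1]].
Proof.
move=> cL oU LU.
have /choice[r rP] : forall x, exists r : R, L x -> 0 < r /\ forall y, `|y - x| <= 2 * r -> U y.
  move=> x; have [Lx|nLx] := pselect (L x); last by exists 0.
  have /near_normP[d d0 dU] : \forall y \near x, U y.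
    by apply: open_nbhs_nbhs; split=> //; exact: LU.
  (* A bump of radius [d / 3] lives in the cube of radius [2 * d / 3], still inside [U]. *)
  exists (d / 3) => _; split=> [|y yd]; first by rewrite divr_gt0.
  by apply: dU; apply: le_lt_trans yd _; lra.
have [|s sL sc] := finite_ball_cover (r := r) cL; first by move=> x /rP[].
(* This is 1 as soon as one of the bumps is 1, and 0 where all of them vanish, so overlaps of the
   cubes do no harm. *)
pose c (y : 'rV[R]_n) : R := 1 - \prod_(x <- s) (1 - cube_bump x (r x) y).
pose S := \big[setU/set0]_(x <- s) [set y | `|y - x| <= 2 * r x].
have SE y : S y <-> exists2 x, x \in s & `|y - x| <= 2 * r x.
  rewrite /S -bigcup_seq; split=> [[x /= xs yx]|[x xs yx]]; by exists x.
have r0 x : x \in s -> 0 < r x by move=> /sL/rP[].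
have pr01 y x : 0 <= 1 - cube_bump x (r x) y <= 1.
  by have := cube_bump_itv x (r x) y; lra.
exists c, S; split.
- apply: smooth_inB; [exact: openT|exact: smooth_in_cst|].
  apply: smooth_in_prod => [|x _]; first exact: openT.
  by apply: smooth_inB; [exact: openT|exact: smooth_in_cst|exact: smooth_cube_bump].
- move=> y; have : 0 <= \prod_(x <- s) (1 - cube_bump x (r x) y) <= 1.
    apply/andP; split; first by apply: prodr_ge0 => x _; have /andP[] := pr01 y x.
    by apply: Num.Theory.prodr_ile1 => x _; exact: pr01.
  by rewrite /c; lra.
- split; first by apply: bigsetU_compact => x _; exact: cube_compact.
  by move=> y /SE[x /sL/rP[_ H] yx]; exact: H.
- move=> y /SE nS; rewrite /c big_seq big1 ?subrr// => x xs.
  rewrite cube_bump0 ?subr0 ?r0// ltNge; apply/negP => yx.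
  by apply: nS; exists x.
- exists (\bigcup_(x in [set` s]) [set y | `|y - x| < r x]); split.
  + by apply: bigcup_open => x _; exact: open_norm_ball.
  + by move=> y /sc[x xs yx]; exists x.
  + move=> y [x /= xs yx]; apply/SE; exists x => //.
    by apply: (le_trans (ltW yx)); have := r0 x xs; lra.
  + move=> y [x /= xs yx]; rewrite /c (big_rem x xs)/= cube_bump1 ?r0 ?ltW//.
    by rewrite subrr mul0r subr0.
Qed.

End Cutoff.

Section IterLinear.
Context {R : realType} {V : normedModType R}.
Implicit Types (f g : V -> R^o) (O : set V).

Lemma iter_deriveD O f g s x : open O -> smooth_in O f -> smooth_in O g -> O x ->
  iter_derive s (fun y => f y + g y : R^o) x = iter_derive s f x + iter_derive s g x.
Proof.
move=> oO sf sg; elim: s x => [//|v s IH] x Ox /=.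
have [df _] := smooth_in_is_derive v (smooth_in_iter s sf) Ox.
have [dg _] := smooth_in_is_derive v (smooth_in_iter s sg) Ox.
rewrite -(deriveD df dg); apply: near_eq_derive.
near=> y; apply: IH; near: y; exact: open_near.
Unshelve. all: by end_near. Qed.

Lemma iter_deriveZ O f c s x : open O -> smooth_in O f -> O x ->
  iter_derive s (fun y => c * f y : R^o) x = c * iter_derive s f x.
Proof.
move=> oO sf; elim: s x => [//|v s IH] x Ox /=.
have [df _] := smooth_in_is_derive v (smooth_in_iter s sf) Ox.
rewrite -[RHS](deriveZ c df); apply: near_eq_derive.
near=> y; apply: IH; near: y; exact: open_near.
Unshelve. all: by end_near. Qed.

Lemma iter_derive_cst0 s (x : V) : iter_derive s (fun=> 0 : R^o) x = 0.
Proof.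
elim: s x => [//|v s IH] x /=.
rewrite (_ : iter_derive s _ = cst 0); last by apply/funext => y; exact: IH.
by rewrite derive_cst.
Qed.

Lemma iter_derive_sum O (I : Type) (r : seq I) (F : I -> V -> R^o) s x : open O ->
  (forall i, smooth_in O (F i)) -> O x ->
  iter_derive s (fun y => \sum_(i <- r) F i y : R^o) x = \sum_(i <- r) iter_derive s (F i) x.
Proof.
move=> oO sF Ox; elim: r => [|i r IH].
  rewrite big_nil -[RHS](iter_derive_cst0 s x); congr (iter_derive s _ x).
  by apply/funext => y; rewrite big_nil.
rewrite big_cons -IH -(iter_deriveD _ oO) //; last exact: smooth_in_sum.
by congr (iter_derive s _ x); apply/funext => y; rewrite big_cons.
Qed.

End IterLinear.

Section Compact.
Context {R : realType} {V : normedModType R}.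

Lemma compact_bound (S : set V) (f : V -> R^o) : compact S ->
  (forall x, S x -> {for x, continuous f}) ->
  exists2 M, 0 <= M & forall x, S x -> `|f x| <= M.
Proof.
move=> cS fc.
have : compact (f @` S).
  by apply: continuous_compact => //; apply: continuous_in_subspaceT => x; rewrite inE; exact: fc.
move=> /(@compact_bounded R R^o)[M [_ MP]].
exists (`|M| + 1); first by rewrite addr_ge0.
move=> x Sx; apply: (MP (`|M| + 1)); last by exists x.
by rewrite (le_lt_trans (ler_norm _))// ltrDl.
Qed.

Lemma compact_unif (S : set V) (f : V -> R^o) (e : R) : compact S ->
  (forall x, S x -> {for x, continuous f}) -> 0 < e ->
  exists2 d, 0 < d & forall x y, S x -> `|y - x| < d -> `|f y - f x| < e.
Proof.
move=> /compact_near_coveringP cS fc e0.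
have : \forall d \near (0 : R)^'+, forall x, S x -> forall y, `|y - x| < d -> `|f y - f x| < e.
  apply: (cS R (0 : R)^'+ (fun d x => forall y, `|y - x| < d -> `|f y - f x| < e)) => x Sx.
  have /cvgrPdist_lt/(_ (e / 2)) := fc x Sx.
  rewrite divr_gt0// => /(_ isT)/near_normP[d d0 Hd].
  have Hx : \forall x' \near x, `|x' - x| < d / 2.
    by apply/near_normP; exists (d / 2) => //; rewrite divr_gt0.
  have Hr : \forall d' \near (0 : R)^'+, d' < d / 2.
    by apply: nbhs_right_lt; rewrite divr_gt0.
  exists ([set x' | `|x' - x| < d / 2], [set d' | d' < d / 2]); first by split.
  move=> [x' d'] /= [xx dd] y yx.
  have yx' : `|y - x| < d.
    rewrite -(subrKA x') (le_lt_trans (ler_normD _ _))// [ltRHS]splitr ltrD//.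
    exact: lt_trans yx dd.
  have xd : `|x' - x| < d.
    by apply: lt_trans xx _; rewrite ltr_pdivrMr// ltr_pMr// ltr1n.
  rewrite -(subrKA (f x)) (le_lt_trans (ler_normD _ _))// [ltRHS]splitr ltrD//.
    by rewrite distrC; exact: Hd.
  exact: Hd.
move=> H; have [d [d0 Hd]] : exists d, 0 < d /\ forall x, S x -> forall y, `|y - x| < d -> `|f y - f x| < e.
  near (0 : R)^'+ => d; exists d; split; first by near: d; exact: nbhs_right_gt.
  by near: d.
by exists d => // x y Sx; exact: Hd.
Unshelve. all: by end_near. Qed.

End Compact.

Section SeqBound.
Context {R : realType}.

(** There are finitely many words of length at most [N]; the sum of the chosen bounds over all of
    them serves for each. *)
Lemma seq_bound (T : finType) (P : seq T -> R -> Prop) :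
  (forall s C D, C <= D -> P s C -> P s D) ->
  (forall s, exists2 C, 0 <= C & P s C) ->
  forall N, exists2 C, 0 <= C & forall s, (size s <= N)%N -> P s C.
Proof.
move=> mono H N; have /choice[C C0P] : forall s, exists C, 0 <= C /\ P s C.
  by move=> s; have [C C0 CP] := H s; exists C.
have C0 s := (C0P s).1; have CP s := (C0P s).2.
pose D := \sum_(k < N.+1) \sum_(t : k.-tuple T) C t.
exists D; first by rewrite !sumr_ge0// => k _; rewrite sumr_ge0.
move=> s sN; apply: mono (CP s).
rewrite /D (bigD1 (Ordinal (sN : size s < N.+1)%N)) //= (bigD1 (in_tuple s)) //= -addrA.
rewrite lerDl addr_ge0 ?sumr_ge0// => k _; rewrite sumr_ge0//.
Qed.

End SeqBound.

(** * Distributions near a compact set *)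

Section LocalDistributions.
Context {R : realType}.

Definition smooth_near n (S : set 'rV[R]_n) (phi : 'rV[R]_n -> R) : Prop :=
  exists U, [/\ open U, S `<=` U & smooth_in U (phi : 'rV[R]_n -> R^o)].

(** The [C^N] seminorm on [S] is described by its upper bounds: a supremum would take a default
    value on unbounded sets, and every use would need a boundedness proof. *)
Definition derivs_le n (N : nat) (S : set 'rV[R]_n) (phi : 'rV[R]_n -> R) (e : R) : Prop :=
  forall (s : seq 'I_n) x, (size s <= N)%N -> S x -> `|partial s phi x| <= e.

Definition bounded_by n (D : set ('rV[R]_n -> R)) (S : set 'rV[R]_n) (u : distr R n) : Prop :=
  exists N C, 0 <= C /\ forall phi e, D phi -> derivs_le N S phi e -> `|u phi| <= C * e.

(* A distribution supported in the compact set [S], acting on functions which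
   are only smooth near [S]. *)
Definition germ_distr n (S : set 'rV[R]_n) (u : distr R n) : Prop :=
  linear_on (smooth_near S) u /\ bounded_by (smooth_near S) S u.

Definition smooth_supp n (S : set 'rV[R]_n) (phi : 'rV[R]_n -> R) : Prop :=
  smooth_in setT (phi : 'rV[R]_n -> R^o) /\ forall x, ~ S x -> phi x = 0.

(** The common ground of compactly supported and tempered distributions: estimates on the test
    functions of each compact set, with an order that may depend on the set. *)
Definition test_distr n (u : distr R n) : Prop :=
  forall S, compact S -> linear_on (smooth_supp S) u /\ bounded_by (smooth_supp S) S u.

Section SmoothNear.
Context {n : nat}.
Implicit Types (S : set 'rV[R]_n) (phi psi : 'rV[R]_n -> R).

Lemma smooth_nearD S phi psi : smooth_near S phi -> smooth_near S psi ->
  smooth_near S (fun x => phi x + psi x).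
Proof.
move=> [U [oU SU sU]] [W [oW SW sW]]; exists (U `&` W); split; first exact: openI.
- by move=> x Sx; split; [exact: SU|exact: SW].
- by apply: smooth_inD; [exact: openI|exact: smooth_in_sub sU|exact: smooth_in_sub sW].
Qed.

Lemma smooth_nearM S phi psi : smooth_near S phi -> smooth_near S psi ->
  smooth_near S (fun x => phi x * psi x).
Proof.
move=> [U [oU SU sU]] [W [oW SW sW]]; exists (U `&` W); split; first exact: openI.
- by move=> x Sx; split; [exact: SU|exact: SW].
- by apply: smooth_inM; [exact: openI|exact: smooth_in_sub sU|exact: smooth_in_sub sW].
Qed.

Lemma smooth_nearW S phi : smooth_in setT (phi : 'rV[R]_n -> R^o) -> smooth_near S phi.
Proof. by move=> sp; exists setT; split => //; exact: openT. Qed.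

Lemma smooth_near_cst S c : smooth_near S (fun=> c).
Proof. by apply: smooth_nearW; exact: smooth_in_cst. Qed.

Lemma smooth_near_sum S (I : Type) (r : seq I) (F : I -> 'rV[R]_n -> R) :
  (forall i, smooth_near S (F i)) -> smooth_near S (fun x => \sum_(i <- r) F i x).
Proof.
move=> sF; elim: r => [|i r IH].
  rewrite (_ : (fun x => _) = fun=> 0); first exact: smooth_near_cst.
  by apply/funext => x; rewrite big_nil.
rewrite (_ : (fun x => _) = fun x => F i x + \sum_(j <- r) F j x).
  exact: smooth_nearD.
by apply/funext => x; rewrite big_cons.
Qed.

End SmoothNear.

Section Linear.
Context {n : nat} (D : set ('rV[R]_n -> R)) (u : distr R n).
Hypothesis ul : linear_on D u.

Lemma linear_onD phi psi : D phi -> D psi -> u (fun x => phi x + psi x) = u phi + u psi.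
Proof.
move=> Dp Dq; rewrite -[u phi]mul1r -ul//; congr u.
by apply/funext => x; rewrite mul1r.
Qed.

Lemma linear_on0 : D (fun=> 0) -> u (fun=> 0) = 0.
Proof.
move=> D0; have := linear_onD D0 D0.
rewrite (_ : (fun x => 0 + 0) = fun=> 0); last by apply/funext => x; rewrite addr0.
by move=> /esym/eqP; rewrite -subr_eq0 addrK => /eqP.
Qed.

Lemma linear_onZ c phi : D (fun=> 0) -> D phi -> u (fun x => c * phi x) = c * u phi.
Proof.
move=> D0 Dp; rewrite -[RHS]addr0 -(linear_on0 D0) -ul//; congr u.
by apply/funext => x; rewrite addr0.
Qed.

Lemma linear_onB phi psi : D phi -> D psi -> u (fun x => phi x - psi x) = u phi - u psi.
Proof.
move=> Dp Dq; rewrite addrC -mulN1r -ul//; congr u.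
by apply/funext => x; rewrite mulN1r addrC.
Qed.

Lemma linear_on_sum (I : Type) (r : seq I) (F : I -> 'rV[R]_n -> R) :
  D (fun=> 0) -> (forall phi psi, D phi -> D psi -> D (fun x => phi x + psi x)) ->
  (forall i, D (F i)) -> u (fun x => \sum_(i <- r) F i x) = \sum_(i <- r) u (F i).
Proof.
move=> D0 DD DF; suff [] : D (fun x => \sum_(i <- r) F i x) /\
   u (fun x => \sum_(i <- r) F i x) = \sum_(i <- r) u (F i) by [].
elim: r => [|i r [IHD IH]].
  rewrite big_nil (_ : (fun x => _) = fun=> 0); first by rewrite linear_on0.
  by apply/funext => x; rewrite big_nil.
rewrite big_cons (_ : (fun x => _) = fun x => F i x + \sum_(j <- r) F j x); last first.
  by apply/funext => x; rewrite big_cons.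
by split; [exact: DD|rewrite linear_onD// IH].
Qed.

End Linear.

(** All derivatives of the difference vanish on [S], so the estimate holds with bound 0. *)
Lemma germ_distr_eq n (S U : set 'rV[R]_n) u phi psi : germ_distr S u -> open U -> S `<=` U ->
  smooth_near S phi -> smooth_near S psi -> (forall x, U x -> phi x = psi x) ->
  u phi = u psi.
Proof.
move=> [ul [N [C [C0 uC]]]] oU SU sp sq E; apply/eqP; rewrite -subr_eq0 -normr_le0.
have smN : smooth_near S (fun x => -1 * psi x) by apply: smooth_nearM => //; exact: smooth_near_cst.
have sB : smooth_near S (fun x => phi x - psi x).
  rewrite (_ : (fun x => _) = fun x => phi x + -1 * psi x); first exact: smooth_nearD.
  by apply/funext => x; rewrite mulN1r.
rewrite -(linear_onB ul sp sq) (le_trans (uC _ 0 sB _)) ?mulr0//.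
move=> s x _ Sx; rewrite /partial (@iter_derive_ext _ _ U _ (fun=> 0)) //.
- by rewrite iter_derive_cst0 normr0.
- by move=> y Uy; rewrite E ?subrr.
- exact: SU.
Qed.

Section Pullback.
Context {n m : nat} (S U : set 'rV[R]_n) (Z : 'rV[R]_n -> 'rV[R]_m).
Hypotheses (cS : compact S) (oU : open U) (SU : S `<=` U).
Hypothesis sZ : forall i, smooth_in U (fun x => Z x 0 i : R^o).

Lemma smooth_near_comp (w : 'rV[R]_n -> R) (g : 'rV[R]_m -> R) :
  smooth_in U (w : 'rV[R]_n -> R^o) -> smooth_near (Z @` S) g -> smooth_near S (fun x => w x * g (Z x)).
Proof.
move=> sw [Q [oO SO sg]].
exists (U `&` Z @^-1` Q); split; first exact: open_preimage.
- by move=> x Sx; split; [exact: SU|apply: SO; exists x].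
- apply: smooth_inM; [exact: open_preimage|by apply: smooth_in_sub sw|].
  apply: (smooth_in_comp (g := g) oO (open_preimage oU sZ oO) sg) => [x []//|i].
  by apply: smooth_in_sub (sZ i).
Qed.

(** Differentiating [a * (partial t g \o Z)] gives terms of the same shape with new coefficients and
    with words [t] or [j :: t]; generalizing over [a] and [t] therefore closes the induction. It
    runs from the end of [s] because the last letter of a word is the derivative taken first. *)
Lemma partial_comp_bound s : forall (a : 'rV[R]_n -> R) t, smooth_in U (a : 'rV[R]_n -> R^o) ->
  exists2 C, 0 <= C & forall (g : 'rV[R]_m -> R) e, smooth_near (Z @` S) g ->
    derivs_le (size s + size t) (Z @` S) g e ->
    forall x, S x -> `|partial s (fun x => a x * partial t g (Z x)) x| <= C * e.
Proof.
elim/last_ind: s => [|s i IH] a t sa.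
  have [C C0 aC] := @compact_bound _ _ S a cS (fun x Sx => smooth_in_cont sa (SU Sx)).
  exists C => // g e sg ge x Sx; rewrite /= normrM ler_pM//; first exact: aC.
  by apply: ge => //; exists x.
have [C0 C00 H0] := IH _ t (smooth_in_derive (basis_vec i) sa).
have sj j : smooth_in U (fun x => a x * 'D_(basis_vec i) (fun x => Z x 0 j) x : R^o).
  by apply: smooth_inM => //; apply: (smooth_in_derive (basis_vec i) (sZ j)).
have /choice[C CP] : forall j, exists C, 0 <= C /\ forall (g : 'rV[R]_m -> R) e, smooth_near (Z @` S) g ->
    derivs_le (size s + (size t).+1) (Z @` S) g e ->
    forall x, S x -> `|partial s (fun x => a x * 'D_(basis_vec i) (fun x => Z x 0 j) x * partial (j :: t) g (Z x)) x| <= C * e.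
  by move=> j; have [C C_0 CP] := IH _ (j :: t) (sj j); exists C.
exists (C0 + \sum_j C j); first by rewrite addr_ge0// sumr_ge0// => j _; have [] := CP j.
move=> g e sg; rewrite size_rcons addSnnS => ge x Sx.
have [Q [oO SO sgO]] := sg.
have oUO := open_preimage oU sZ oO.
have UOx : (U `&` Z @^-1` Q) x by split; [exact: SU|apply: SO; exists x].
have E y : (U `&` Z @^-1` Q) y -> 'D_(basis_vec i) (fun x => a x * partial t g (Z x) : R^o) y =
   'D_(basis_vec i) (a : 'rV[R]_n -> R^o) y * partial t g (Z y) +
   \sum_j a y * 'D_(basis_vec i) (fun x => Z x 0 j) y * partial (j :: t) g (Z y).
  move=> [Uy Oy].
  have [da _] := smooth_in_is_derive (basis_vec i) sa Uy.
  have dZ j : derivable (fun x => Z x 0 j) y (basis_vec i).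
    by have [] := smooth_in_is_derive (basis_vec i) (sZ j) Uy.
  have [dg Eg] := is_derive_comp oO (smooth_in_iter [seq basis_vec i | i <- t] sgO) Oy dZ.
  have -> : 'D_(basis_vec i) (fun x => a x * partial t g (Z x) : R^o) y =
     a y * 'D_(basis_vec i) (partial t g \o Z : _ -> R^o) y + partial t g (Z y) * 'D_(basis_vec i) a y.
    exact: (deriveM da dg).
  rewrite addrC mulrC; congr (_ + _).
  have -> : 'D_(basis_vec i) (partial t g \o Z : _ -> R^o) y =
    \sum_j 'D_(basis_vec i) (fun x => Z x 0 j) y * 'D_(basis_vec j) (partial t g) (Z y) by exact: Eg.
  by rewrite mulr_sumr; apply: eq_bigr => j _; rewrite mulrA.
rewrite /partial map_rcons -cats1 iter_derive_cat /=.
rewrite (iter_derive_ext _ oUO E UOx).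
have sub (f : 'rV[R]_n -> R) : smooth_in U (f : _ -> R^o) -> smooth_in (U `&` Z @^-1` Q) (f : _ -> R^o).
  by apply: smooth_in_sub.
have scomp t' : smooth_in (U `&` Z @^-1` Q) (fun x => partial t' g (Z x) : R^o).
  apply: (smooth_in_comp (g := partial t' g) oO oUO) => [|y []//|j]; first exact: smooth_in_iter.
  exact/sub/sZ.
have sterm j : smooth_in (U `&` Z @^-1` Q)
    (fun y => a y * 'D_(basis_vec i) (fun x => Z x 0 j) y * partial (j :: t) g (Z y) : R^o).
  by apply: smooth_inM => //; exact/sub/sj.
rewrite (iter_deriveD _ oUO) //; first last.
- by apply: smooth_in_sum.
- by apply: smooth_inM => //; apply/sub/smooth_in_derive.
rewrite (iter_derive_sum _ _ oUO) // mulrDl mulr_suml.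
apply: le_trans (ler_normD _ _) _; apply: lerD.
  apply: H0 => // s' y ss; apply: ge; apply: leq_trans ss _.
  by rewrite leq_add2l leqnSn.
apply: le_trans (ler_norm_sum _ _ _) _; apply: ler_sum => j _.
have [_ CPj] := CP j.
exact: CPj.
Qed.

Lemma derivs_comp_bound (a : 'rV[R]_n -> R) N : smooth_in U (a : 'rV[R]_n -> R^o) ->
  exists2 C, 0 <= C & forall (g : 'rV[R]_m -> R) e, smooth_near (Z @` S) g ->
    derivs_le N (Z @` S) g e -> derivs_le N S (fun x => a x * g (Z x)) (C * e).
Proof.
move=> sa.
pose P (s : seq 'I_n) C := forall (g : 'rV[R]_m -> R) e, 0 <= e -> smooth_near (Z @` S) g ->
    derivs_le (size s) (Z @` S) g e -> forall x, S x -> `|partial s (fun x => a x * g (Z x)) x| <= C * e.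
have [|s|C C0 CP] := @seq_bound _ _ P _ _ N.
- by move=> s C D CD H g e e0 sg ge x Sx; rewrite (le_trans (H g e e0 sg ge x Sx))// ler_wpM2r.
- have [C C0 CP] := partial_comp_bound s [::] sa; exists C => // g e e0 sg ge x Sx.
  by apply: CP => //; rewrite addn0.
- exists C => // g e sg ge s x sN Sx; apply: CP => //.
    have ZSx : (Z @` S) (Z x) by exists x.
    exact: le_trans (normr_ge0 _) (ge [::] _ (leq0n _) ZSx).
  by move=> s' y ss; apply: ge; exact: leq_trans ss sN.
Qed.

(** The push-forward of [w u] under [Z]. It carries distributions to stereographic and inverted
    coordinates, where kernels become polynomials. *)
Lemma germ_distr_pull (u : distr R n) (w : 'rV[R]_n -> R) :
  smooth_in U (w : 'rV[R]_n -> R^o) -> germ_distr S u ->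
  germ_distr (Z @` S) (fun g => u (fun x => w x * g (Z x))).
Proof.
move=> sw [ul [N [C [C0 uC]]]]; split.
  move=> c g h sg sh; rewrite -ul; [|exact: smooth_near_comp|exact: smooth_near_comp].
  by congr u; apply/funext => x; ring.
have [D D0 DP] := derivs_comp_bound N sw.
exists N, (C * D); split; first exact: mulr_ge0.
move=> g e sg ge; rewrite -mulrA; apply: uC; first exact: smooth_near_comp.
exact: DP.
Qed.

End Pullback.

Lemma derivs_mul_bound n (S U : set 'rV[R]_n) (a : 'rV[R]_n -> R) N :
  compact S -> open U -> S `<=` U -> smooth_in U (a : 'rV[R]_n -> R^o) ->
  exists2 C, 0 <= C & forall (g : 'rV[R]_n -> R) e, smooth_near S g ->
    derivs_le N S g e -> derivs_le N S (fun x => a x * g x) (C * e).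
Proof.
move=> cS oU SU sa.
have sid (i : 'I_n) : smooth_in U (fun x : 'rV[R]_n => id x 0 i : R^o) by exact: smooth_in_coord.
have [C C0 CP] := derivs_comp_bound cS oU SU sid N sa.
by exists C => // g e; have := CP g e; rewrite image_id.
Qed.

Lemma smooth_cutoff_mul n (S : set 'rV[R]_n) (c phi : 'rV[R]_n -> R) :
  closed S -> smooth_supp S c -> smooth_near S phi -> smooth_supp S (fun x => c x * phi x).
Proof.
move=> cS [sc c0] [U [oU SU sp]]; split; last by move=> x /c0 ->; rewrite mul0r.
split=> s x _; have [Sx|nSx] := pselect (S x).
  have [h] := smooth_inM oU (smooth_in_sub (@subsetT _ U) sc) sp.
  exact: (h s x (SU x Sx)).
have oC : open (~` S) by exact: closed_openC.
have [h] := @smooth_in_ext _ _ (~` S) (fun=> 0) (fun x => c x * phi x : R^o) oC (fun y ny => esym (etrans (congr1 (fun t => t * phi y) (c0 y ny)) (mul0r _))) (@smooth_in_cst _ _ _ 0).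
exact: (h s x nSx).
Qed.

(** Multiplication by the cutoff [c] lets [u] act on functions with singularities off [S], such as
    the kernels. *)
Lemma test_distr_germ n (S : set 'rV[R]_n) (c : 'rV[R]_n -> R) (u : distr R n) :
  compact S -> smooth_supp S c -> test_distr u ->
  germ_distr S (fun phi => u (fun x => c x * phi x)).
Proof.
move=> cS sc uS; have [ul [N [C [C0 uC]]]] := uS S cS.
have clS : closed S by exact: compact_closed.
split.
  move=> a g h sg sh; rewrite -ul; [|exact: smooth_cutoff_mul|exact: smooth_cutoff_mul].
  by congr u; apply/funext => x; ring.
have [D D0 DP] := derivs_mul_bound N cS openT (@subsetT _ S) sc.1.
exists N, (C * D); split; first exact: mulr_ge0.
move=> g e sg ge; rewrite -mulrA; apply: uC; first exact: smooth_cutoff_mul.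
exact: DP.
Qed.

End LocalDistributions.

(** * Density of polynomials *)

Section Bernstein.
Context {R : realType}.

(* The expectation of [g] for a binomial variable of parameters [N], [x]. *)
Fixpoint bern (N : nat) (g : nat -> R) (x : R) : R :=
  if N is M.+1 then x * bern M (fun k => g k.+1) x + (1 - x) * bern M g x else g 0%N.

Lemma bern_le N g h x : 0 <= x <= 1 -> (forall k, (k <= N)%N -> g k <= h k) ->
  bern N g x <= bern N h x.
Proof.
move=> /andP[x0 x1]; elim: N g h => [|N IH] g h gh /=; first exact: gh.
apply: lerD; apply: ler_wpM2l; rewrite ?subr_ge0//; apply: IH => k kN; apply: gh => //.
exact: leq_trans kN _.
Qed.

Lemma bernD N g h x : bern N (fun k => g k + h k) x = bern N g x + bern N h x.
Proof.
elim: N g h => [//|N IH] g h /=.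
by rewrite (IH (fun k => g k.+1) (fun k => h k.+1)) IH; ring.
Qed.

Lemma bernZ N c g x : bern N (fun k => c * g k) x = c * bern N g x.
Proof.
elim: N g => [//|N IH] g /=.
by rewrite (IH (fun k => g k.+1)) IH; ring.
Qed.

Lemma bern_cst N c x : bern N (fun=> c) x = c.
Proof. by elim: N => [//|N IH] /=; rewrite IH; ring. Qed.

(** The second moment about an arbitrary point [a] is needed for the induction: one trial moves [a]
    to [a - 1]. *)
Lemma bern_variance N a x :
  bern N (fun k => (k%:R - a) ^+ 2) x = (N%:R * x - a) ^+ 2 + N%:R * (x * (1 - x)).
Proof.
elim: N a => [|N IH] a /=; first by rewrite !mul0r addr0.
rewrite (_ : (fun k => _) = fun k : nat => (k%:R - (a - 1)) ^+ 2); last first.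
  by apply/funext => k; rewrite -natr1; ring.
by rewrite !IH -natr1; ring.
Qed.

Lemma bern_dist N g h e x : 0 <= x <= 1 -> (forall k, (k <= N)%N -> `|g k - h k| <= e) ->
  `|bern N g x - bern N h x| <= e.
Proof.
move=> x01 gh; rewrite ler_norml; apply/andP; split.
  rewrite lerBrDr -[in leLHS](bern_cst N (- e) x) -bernD; apply: bern_le => // k kN.
  by have := gh k kN; rewrite ler_norml => /andP[+ _]; rewrite lerBrDr.
rewrite lerBlDr -[in leRHS](bern_cst N e x) -bernD; apply: bern_le => // k kN.
by have := gh k kN; rewrite ler_norml => /andP[_]; rewrite lerBlDr.
Qed.

(** The degree depends only on the bound [M] and the modulus [(e, d)], not on [f]: in several
    variables it must serve all the slices of a function at once. *)
Lemma bern_approx (e d M : R) : 0 < e -> 0 < d -> 0 <= M ->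
  exists N, forall f : R -> R,
    (forall x, 0 <= x <= 1 -> `|f x| <= M) ->
    (forall x y, 0 <= x <= 1 -> 0 <= y <= 1 -> `|x - y| < d -> `|f x - f y| <= e) ->
    forall x, 0 <= x <= 1 -> `|bern N.+1 (fun k => f (k%:R / N.+1%:R)) x - f x| <= 2 * e.
Proof.
(* Chebyshev's inequality: where [|k / n - x| >= d], the trivial bound [2 * M] is at most
   [A * (k / n - x) ^+ 2]. *)
move=> e0 d0 M0; pose A := 2 * M / d ^+ 2.
have A0 : 0 <= A by rewrite divr_ge0 ?mulr_ge0// ltW// exprn_gt0.
(* The variance of [k / n] is at most [1 / n], so this choice makes its contribution [A / n] at most
   [e]. *)
exists (Num.bound (A / e)) => f fM fd x x01.
set N := Num.bound _; set n := N.+1%:R : R.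
have n0 : 0 < n by rewrite ltr0n.
have nA : A / e < n.
  have Ae : 0 <= A / e by rewrite divr_ge0// ltW.
  by apply: lt_le_trans (archi_boundP Ae) _; rewrite ler_nat.
have kn k : (k <= N.+1)%N -> 0 <= k%:R / n <= 1.
  by move=> kN; rewrite divr_ge0// ler_pdivrMr// mul1r ler_nat.
have key k : (k <= N.+1)%N -> `|f (k%:R / n) - f x| <= e + A * (k%:R / n - x) ^+ 2.
  move=> kN; have [h|h] := ltP `|k%:R / n - x| d.
    by apply: (le_trans (fd _ _ (kn k kN) x01 h)); rewrite lerDl mulr_ge0// sqr_ge0.
  apply: (@le_trans _ _ (2 * M)).
    by rewrite (le_trans (ler_normB _ _))// mulr2n mulrDl mul1r lerD// fM// kn.
  rewrite ler_wpDl ?(ltW e0)// /A mulrAC ler_pdivlMr ?exprn_gt0// ler_wpM2l ?mulr_ge0//.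
  rewrite -[leRHS](real_normK (num_real _)) ler_pXn2r ?nnegrE// ltW//.
rewrite -[f x](bern_cst N.+1 _ x) -mulN1r -bernZ -bernD.
rewrite ler_norml; apply/andP.
have bd : bern N.+1 (fun k => e + A * (k%:R / n - x) ^+ 2) x <= 2 * e.
  rewrite (_ : (fun k => _) = fun k : nat => e + (A / n ^+ 2) * (k%:R - n * x) ^+ 2); last first.
    by apply/funext => k; congr (_ + _); rewrite -mulrA; congr (_ * _); field; rewrite gt_eqF.
  have -> : 2 * e = e + e by ring.
  rewrite bernD bernZ bern_cst bern_variance subrr expr0n add0r lerD2l.
  rewrite (_ : A / n ^+ 2 * _ = A / n * (x * (1 - x))); last by field; rewrite gt_eqF.
  apply: (@le_trans _ _ (A / n)).
    have h : x * (1 - x) <= 1 by case/andP: x01 => *; nra.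
    have An : 0 <= A / n by apply: divr_ge0 => //; exact: ltW.
    exact: ler_piMr.
  by rewrite ler_pdivrMr// mulrC -ler_pdivrMr// ltW.
split.
- rewrite lerNl; apply: le_trans bd; rewrite -[leLHS]mulN1r -bernZ; apply: bern_le => // k kN.
  have := key k kN; move: (e + _) (f (k%:R / n)) (f x) => q f1 f2.
  by rewrite ler_norml => /andP[*]; lra.
- apply: le_trans bd; apply: bern_le => // k kN.
  have := key k kN; move: (e + _) (f (k%:R / n)) (f x) => q f1 f2.
  by rewrite ler_norml => /andP[*]; lra.
Qed.

End Bernstein.

Section PolynomialFunctions.
Context {R : realType} {m : nat}.
Implicit Types (F p : 'rV[R]_m -> R) (L : R).

Inductive polyfun : ('rV[R]_m -> R) -> Prop :=
| polyfun_cst c : polyfun (fun=> c)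
| polyfun_coord i : polyfun (fun z => z 0 i)
| polyfun_add p q : polyfun p -> polyfun q -> polyfun (fun z => p z + q z)
| polyfun_mul p q : polyfun p -> polyfun q -> polyfun (fun z => p z * q z).

Lemma polyfun_bern N (p : nat -> 'rV[R]_m -> R) (q : 'rV[R]_m -> R) : (forall k, polyfun (p k)) ->
  polyfun q -> polyfun (fun z => bern N (fun k => p k z) (q z)).
Proof.
move=> pp pq; elim: N p pp => [|N IH] p pp /=; first exact: pp.
apply: polyfun_add; apply: polyfun_mul => //.
- by apply: (IH (fun k => p k.+1)) => k.
- apply: polyfun_add; first exact: polyfun_cst.
  rewrite (_ : (fun z => _) = fun z => -1 * q z); last by apply/funext => z; rewrite mulN1r.
  by apply: polyfun_mul => //; exact: polyfun_cst.
- exact: IH.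
Qed.

Lemma weierstrass L F : 0 < L ->
  (forall e, 0 < e -> exists2 d, 0 < d & forall z w, `|z| <= L -> `|w| <= L ->
     `|z - w| < d -> `|F z - F w| <= e) ->
  (exists2 M, 0 <= M & forall z, `|z| <= L -> `|F z| <= M) ->
  forall e, 0 < e -> exists2 p, polyfun p & forall z, `|z| <= L -> `|F z - p z| <= e.
Proof.
move=> L0.
(* Induction on the number [k] of coordinates on which [F] depends: Bernstein approximation in the
   last one has values of [F] on slices as coefficients, and these depend on fewer coordinates. *)
suff H k : (k <= m)%N -> forall F : 'rV[R]_m -> R,
  (forall z w : 'rV[R]_m, (forall i : 'I_m, (i < k)%N -> z 0 i = w 0 i) -> F z = F w) ->
  (forall e, 0 < e -> exists2 d, 0 < d & forall z w, `|z| <= L -> `|w| <= L ->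
     `|z - w| < d -> `|F z - F w| <= e) ->
  (exists2 M, 0 <= M & forall z, `|z| <= L -> `|F z| <= M) ->
  forall e, 0 < e -> exists2 p, polyfun p & forall z, `|z| <= L -> `|F z - p z| <= e.
  move=> FC FM; apply: (H m) => // z w zw; congr F; apply/rowP => i; exact/zw.
elim: k {F} => [_ F Fk _ _ e e0|k IH km F Fk FC [M M0 FM] e e0].
  exists (fun=> F 0); first exact: polyfun_cst.
  by move=> z _; rewrite (Fk z 0)// subrr normr0 ltW.
pose i0 := Ordinal km.
pose upd c (z : 'rV[R]_m) : 'rV[R]_m := \row_i (if i == i0 then c else z 0 i).
have updL c z : `|c| <= L -> `|z| <= L -> `|upd c z| <= L.
  move=> cL zL; apply: norm_row_le => [|i]; first exact: ltW.
  by rewrite mxE; case: ifP => // _; apply: le_trans (norm_coord z i) zL.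
have e3 : 0 < e / 3 by rewrite divr_gt0.
have [d d0 Hd] := FC _ e3.
(* The interval [[0, 1]] is mapped to [[- L, L]] with slope [2 * L], whence the division of [d]. The
   error is [2 * (e / 3)] from Bernstein and [e / 3] from the coefficients. *)
have [|N HN] := @bern_approx R (e / 3) (d / (2 * L)) M e3 _ M0.
  by rewrite divr_gt0// mulr_gt0.
pose c (x : R) := - L + 2 * L * x.
have cL x : 0 <= x <= 1 -> `|c x| <= L.
  move=> /andP[x0 x1]; rewrite /c ler_norml; nra.
(* Capping at [N.+1] keeps every node in [[0, 1]], so that a polynomial can be chosen for every
   natural number; only the indices up to [N.+1] matter. *)
pose x' (k : nat) : R := (minn k N.+1)%:R / N.+1%:R.
have x'01 k' : 0 <= x' k' <= 1.
  by rewrite divr_ge0// ler_pdivrMr// mul1r ler_nat geq_minr.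
have /choice[p pP] : forall k', exists p, polyfun p /\
    forall z, `|z| <= L -> `|F (upd (c (x' k')) z) - p z| <= e / 3.
  move=> k'; have [|||p pp pe] := IH (ltnW km) (fun z => F (upd (c (x' k')) z)) _ _ _ (e / 3) e3.
  - move=> z w zw; apply: Fk => i ik; rewrite !mxE; case: eqP => // /eqP ii.
    apply: zw; move: ik; rewrite ltnS leq_eqVlt => /orP[/eqP E|//].
    by case/negP: ii; apply/eqP/val_inj.
  - move=> e' e'0; have [d' d'0 Hd'] := FC _ e'0; exists d' => // z w zL wL zw.
    apply: Hd'; [exact/updL/zL/cL|exact/updL/wL/cL|].
    apply: le_lt_trans zw; apply: norm_row_le => // i; rewrite !mxE.
    case: eqP => _; first by rewrite subrr normr0.
    by have := norm_coord (z - w) i; rewrite !mxE.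
  - by exists M => // z zL; apply: FM; exact/updL/zL/cL.
  - by exists p.
exists (fun z => bern N.+1 (fun k => p k z) ((z 0 i0 + L) / (2 * L))).
  apply: polyfun_bern => [k'|]; first by have [] := pP k'.
  apply: polyfun_mul; last exact: polyfun_cst.
  by apply: polyfun_add; [exact: polyfun_coord|exact: polyfun_cst].
move=> z zL; set x := (z 0 i0 + L) / (2 * L).
have zi : - L <= z 0 i0 <= L.
  by rewrite -ler_norml; apply: le_trans (norm_coord z i0) zL.
have LL : 0 < 2 * L by rewrite mulr_gt0.
have x01 : 0 <= x <= 1.
  by rewrite /x ler_pdivrMr// ler_pdivlMr//; case/andP: zi => *; lra.
have cx : c x = z 0 i0 by rewrite /c /x mulrC divfK ?gt_eqF//; lra.
pose f y := F (upd (c y) z).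
have fx : f x = F z.
  rewrite /f cx; congr F; apply/rowP => i; rewrite mxE.
  by case: eqP => [->|].
have B := HN f _ _ x x01.
rewrite -fx -(subrKA (bern N.+1 (fun k => f (k%:R / N.+1%:R)) x)).
rewrite (le_trans (ler_normD _ _))// [e](_ : _ = 2 * (e / 3) + e / 3); last by field.
apply: lerD.
  rewrite distrC; apply: B => [y y01|y w y01 w01 yw].
    by apply: FM; exact/updL/zL/cL.
  apply: Hd; [exact/updL/zL/cL|exact/updL/zL/cL|].
  apply: (@le_lt_trans _ _ (2 * L * `|y - w|)); last first.
    by rewrite mulrC -ltr_pdivlMr.
  apply: norm_row_le => [|i]; first by rewrite mulr_ge0// ltW.
  rewrite !mxE; case: eqP => _; last by rewrite subrr normr0 mulr_ge0// ltW.
  rewrite /c (_ : _ - _ = 2 * L * (y - w)); last by ring.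
  by rewrite normrM gtr0_norm.
apply: bern_dist => // k' k'N.
have [_ pe] := pP k'; have := pe z zL.
by rewrite /f /x' (minn_idPl k'N).
Qed.

End PolynomialFunctions.

Section ShiftedMonomials.
Context {R : realType} {m : nat} (L : R).
Implicit Types (k : 'I_m -> nat) (z : 'rV[R]_m).

(** Monomials centred at the corner of the cube [|z| <= L] where all coordinates are [- L]: their
    primitives from the lower faces are again such monomials. For [L = 0] they are the usual
    ones. *)
Definition mono k z : R := \prod_i (z 0 i + L) ^+ k i.

Lemma smooth_mono k : smooth_in setT (mono k : 'rV[R]_m -> R^o).
Proof.
apply: smooth_in_prod => [|i _]; first exact: openT.
apply: smooth_inX; first exact: openT.
apply: smooth_inD; [exact: openT|exact: smooth_in_coord|exact: smooth_in_cst].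
Qed.

Lemma derive_mono k j z :
  'D_(basis_vec j) (mono k : 'rV[R]_m -> R^o) z = (k j)%:R * mono (fun i => k i - (i == j))%N z.
Proof.
pose A (z : 'rV[R]_m) : R^o := (z 0 j + L) ^+ k j.
pose B (z : 'rV[R]_m) : R^o := \prod_(i | i != j) (z 0 i + L) ^+ k i.
have mE : mono k = A * B by apply/funext => y; rewrite /mono (bigD1 j).
have dA : is_derive z (basis_vec j) A ((k j)%:R * (z 0 j + L) ^+ (k j).-1).
  have d1 : is_derive z (basis_vec j) (fun z : 'rV[R]_m => z 0 j + L : R) 1.
    apply: is_derive_eq (is_deriveD (is_derive_coord z (basis_vec j) j) (is_derive_cst (L : R^o) z (basis_vec j))) _.
    by rewrite addr0 mxE !eqxx.
  have AE : A = (fun z : 'rV[R]_m => z 0 j + L : R) ^+ k j.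
    by apply/funext => y; rewrite exprfctE.
  by rewrite AE; apply: is_derive_eq (is_deriveX (k j) d1) _; rewrite [LHS]mulr1.
have dB : is_derive z (basis_vec j) B 0.
  have Bc (h : R) : B (h *: basis_vec j + z) = B z.
    apply: eq_bigr => i ij; rewrite !mxE eqxx /= (negbTE ij) mulr0 add0r //.
  have E : \forall h \near 0^', h^-1 *: ((B \o shift z) (h *: basis_vec j) - B z) = 0.
    by near=> h; rewrite /= Bc subrr scaler0.
  by apply: DeriveDef; [exact: is_cvg_near_cst E|exact: lim_near_cst E].
have [_ ->] : is_derive z (basis_vec j) (mono k : _ -> R^o) (A z * 0 + B z * ((k j)%:R * (z 0 j + L) ^+ (k j).-1)).
  by rewrite mE; exact: is_deriveM dA dB.
rewrite mulr0 add0r mulrCA; congr (_ * _).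
rewrite /mono (bigD1 j) //= eqxx subn1 mulrC; congr (_ * _).
by apply: eq_bigr => i ij; rewrite (negbTE ij) subn0.
Unshelve. all: by end_near. Qed.

Lemma partial_mono k t z : partial t (mono k) z =
  (\prod_i (k i ^_ count_mem i t)%:R) * mono (fun i => k i - count_mem i t)%N z.
Proof.
elim: t z => [|j t IH] z.
  rewrite /partial /= big1 ?mul1r => [|i _]; last by rewrite ffactn0.
  by apply: eq_bigr => i _; rewrite subn0.
have E : partial t (mono k) = fun z => (\prod_i (k i ^_ count_mem i t)%:R) * mono (fun i => k i - count_mem i t)%N z.
  by apply/funext => y; exact: IH.
rewrite /partial /= -/(partial t (mono k)) E.
have [dm _] := smooth_in_is_derive (basis_vec j) (smooth_mono (fun i => k i - count_mem i t)%N) (I : setT z).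
have -> : 'D_(basis_vec j) (fun z => (\prod_i (k i ^_ count_mem i t)%:R) * mono (fun i => k i - count_mem i t)%N z : R^o) z
  = (\prod_i (k i ^_ count_mem i t)%:R) * 'D_(basis_vec j) (mono (fun i => k i - count_mem i t)%N : _ -> R^o) z.
  exact: (deriveZ (\prod_i (k i ^_ count_mem i t)%:R) dm).
rewrite derive_mono mulrA; congr (_ * _); last first.
  by apply: eq_bigr => i _; rewrite (eq_sym j) addnC subnDA.
rewrite [in RHS](bigD1 j) //= eqxx add1n ffactnSr natrM.
rewrite [in LHS](bigD1 j) //= mulrAC; congr (_ * _ * _).
by apply: eq_bigr => i ij; rewrite eq_sym (negbTE ij).
Qed.

Inductive mono_span : ('rV[R]_m -> R) -> Prop :=
| mono_span1 c k : mono_span (fun z => c * mono k z)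
| mono_spanD p q : mono_span p -> mono_span q -> mono_span (fun z => p z + q z).

Lemma mono_span_polyfun p : mono_span p -> polyfun p.
Proof.
elim=> [c k|q r _ pq _ pr]; last exact: polyfun_add.
apply: polyfun_mul; first exact: polyfun_cst.
rewrite /mono; elim: (index_enum _) => [|i s IH].
  rewrite (_ : (fun z => _) = fun=> 1); first exact: polyfun_cst.
  by apply/funext => z; rewrite big_nil.
rewrite (_ : (fun z => _) = fun z => (z 0 i + L) ^+ k i * \prod_(i <- s) (z 0 i + L) ^+ k i); last first.
  by apply/funext => z; rewrite big_cons.
apply: polyfun_mul => //; elim: (k i) => [|l IHl].
  by rewrite (_ : (fun z => _) = fun=> 1); [exact: polyfun_cst|apply/funext => z].
rewrite (_ : (fun z => _) = fun z => (z 0 i + L) * (z 0 i + L) ^+ l); last first.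
  by apply/funext => z; rewrite exprS.
apply: polyfun_mul => //; apply: polyfun_add; [exact: polyfun_coord|exact: polyfun_cst].
Qed.

Lemma polyfun_mono_span p : polyfun p -> mono_span p.
Proof.
have mono0 c : mono_span (fun=> c).
  rewrite (_ : (fun=> c) = fun z => c * mono (fun=> 0%N) z); first exact: mono_span1.
  by apply/funext => z; rewrite /mono big1 ?mulr1.
have mM p1 q : mono_span p1 -> mono_span q -> mono_span (fun z => p1 z * q z).
  move=> mp mq; elim: mp => [c k|p2 r _ IHp _ IHr]; last first.
    rewrite (_ : (fun z => _) = fun z => p2 z * q z + r z * q z); first exact: mono_spanD.
    by apply/funext => z; rewrite mulrDl.
  elim: mq => [d l|p2 r _ IHp _ IHr]; last first.
    rewrite (_ : (fun z => _) = fun z => c * mono k z * p2 z + c * mono k z * r z); first exact: mono_spanD.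
    by apply/funext => z; rewrite mulrDr.
  rewrite (_ : (fun z => _) = fun z => (c * d) * mono (fun i => k i + l i)%N z); first exact: mono_span1.
  apply/funext => z; rewrite mulrACA; congr (_ * _).
  by rewrite /mono -big_split /=; apply: eq_bigr => i _; rewrite exprD.
elim=> [c|i|q r _ mq _ mr|q r _ mq _ mr]; [exact: mono0| |exact: mono_spanD|exact: mM].
rewrite (_ : (fun z => _) = fun z => 1 * mono (fun j => (j == i) : nat) z + - L).
  by apply: mono_spanD; [exact: mono_span1|exact: mono0].
apply/funext => z; rewrite /mono (bigD1 i) //= eqxx big1 => [|j ij]; last by rewrite (negbTE ij).
by rewrite mul1r mulr1 expr1 addrK.
Qed.

(** Raise all exponents by [N] and divide by the falling factorials. A coordinate differentiated
    less than [N] times keeps a positive exponent, which gives the vanishing on its lower face. *)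
Lemma mono_antiderivative N Q : mono_span Q -> exists P, [/\ mono_span P,
  forall t, (forall i, count_mem i t = N) -> partial t P = Q &
  forall t i z, (count_mem i t < N)%N -> z 0 i = - L -> partial t P z = 0].
Proof.
elim=> [c k|q r _ [P [mP PQ P0]] _ [P' [mP' PQ' P0']]].
  pose d : R := \prod_i ((k i + N) ^_ N)%:R.
  have d0 : d != 0 by apply/prodf_neq0 => i _; rewrite pnatr_eq0 -lt0n ffact_gt0 leq_addl.
  have pZ t z : partial t (fun z => c / d * mono (fun i => k i + N)%N z) z =
      c / d * partial t (mono (fun i => k i + N)%N) z.
    by apply: (iter_deriveZ _ _ openT (smooth_mono _)).
  exists (fun z => c / d * mono (fun i => k i + N)%N z); split.
  - exact: mono_span1.
  - move=> t tN; apply/funext => z; rewrite pZ partial_mono mulrA.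
    rewrite (_ : \prod_i _ = d); last by apply: eq_bigr => i _; rewrite tN.
    by rewrite divfK//; congr (_ * _); apply: eq_bigr => i _; rewrite tN addnK.
  - move=> t i z tN zi; rewrite pZ partial_mono /mono (bigD1 i (F := fun i => (_ + L) ^+ _)) //=.
    by rewrite zi addNr expr0n subn_eq0 leqNgt ltn_addl// !(mul0r, mulr0).
have sP : smooth_in setT (P : _ -> R^o).
  by elim: mP => [c k|p1 p2 _ s1 _ s2]; [apply: smooth_inM; [exact: openT|exact: smooth_in_cst|exact: smooth_mono]|apply: smooth_inD => //; exact: openT].
have sP' : smooth_in setT (P' : _ -> R^o).
  by elim: mP' => [c k|p1 p2 _ s1 _ s2]; [apply: smooth_inM; [exact: openT|exact: smooth_in_cst|exact: smooth_mono]|apply: smooth_inD => //; exact: openT].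
have pD t z : partial t (fun z => P z + P' z) z = partial t P z + partial t P' z.
  exact: (iter_deriveD _ openT sP sP').
exists (fun z => P z + P' z); split; first exact: mono_spanD.
- by move=> t tN; apply/funext => z; rewrite pD PQ// PQ'.
- by move=> t i z tN zi; rewrite pD (P0 t i)// (P0' t i)// addr0.
Qed.

End ShiftedMonomials.

Section SmoothWeierstrass.
Context {R : realType} {m : nat}.

(** A derivative in which coordinate [i] is not yet saturated vanishes on the lower face of [i]; the
    mean value theorem from this face bounds it by [2 * L] times a derivative with one more [i].
    Descend from the top derivative in this way. *)
Lemma partial_bound_from_top (L e : R) N (F : 'rV[R]_m -> R) : 0 < L ->
  smooth_in setT (F : _ -> R^o) ->
  (forall t i (z : 'rV[R]_m), `|z| <= L -> (count_mem i t < N)%N -> z 0 i = - L -> partial t F z = 0) ->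
  (forall t (z : 'rV[R]_m), `|z| <= L -> (forall i, count_mem i t = N) -> `|partial t F z| <= e) ->
  forall t, (forall i, (count_mem i t <= N)%N) -> forall z, `|z| <= L ->
    `|partial t F z| <= (2 * L) ^+ (\sum_i (N - count_mem i t)) * e.
Proof.
move=> L0 sF F0 Fe t.
have [d dE] : exists d, d = (\sum_i (N - count_mem i t))%N by exists (\sum_i (N - count_mem i t))%N.
rewrite -dE; elim: d t dE => [|d IH] t dE tN z zL.
  rewrite mul1r; apply: Fe => // i; apply/eqP; rewrite eqn_leq tN /= -subn_eq0.
  by have /eqP := esym dE; rewrite sum_nat_eq0 => /forallP/(_ i).
have [i iN] : exists i, (count_mem i t < N)%N.
  apply: contrapT => /forallNP H; move: dE; rewrite big1// => i _.
  by apply/eqP; rewrite subn_eq0 leqNgt; apply/negP/H.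
(* The projection of [z] to the face where coordinate [i] is [- L]. *)
pose z0 : 'rV[R]_m := z - (z 0 i + L) *: basis_vec i.
have zi : - L <= z 0 i <= L by rewrite -ler_norml (le_trans (norm_coord z i)).
have inL (s : R) : 0 <= s <= 1 -> `|z0 + (s * (z 0 i + L)) *: basis_vec i| <= L.
  move=> /andP[s0 s1]; apply: norm_row_le => [|j]; first exact: ltW.
  rewrite !mxE eqxx /=; case: eqP => [->|_]; last first.
    by rewrite !mulr0 subr0 addr0 (le_trans (norm_coord z j)).
  have a0 : 0 <= z 0 i + L by case/andP: zi => *; lra.
  have sa0 := mulr_ge0 s0 a0; have sa1 := ler_piMl a0 s1.
  by rewrite !mulr1 ler_norml; apply/andP; case/andP: zi => *; split; lra.
have [s s01|s s01] := @line_MVT R _ (partial t F) z0 (basis_vec i) (z 0 i + L).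
  by have [] := smooth_in_is_derive (basis_vec i) (smooth_in_iter [seq basis_vec i | i <- t] sF) (I : setT (z0 + (s * (z 0 i + L)) *: basis_vec i)).
rewrite (F0 t i z0) //; first last.
- by rewrite !mxE !eqxx mulr1 opprD addNKr.
- by have := inL 0; rewrite mul0r scale0r addr0; apply; rewrite lexx ler01.
rewrite subr0 /z0 subrK -/z0 => ->; rewrite normrM exprS -mulrA.
apply: ler_pM => //.
  by rewrite ger0_norm; case/andP: zi => *; lra.
have cE j : count_mem j (i :: t) = ((j == i) + count_mem j t)%N by rewrite /= eq_sym.
apply: (IH (i :: t)); last exact: inL.
- apply: succn_inj; rewrite dE (bigD1 i) //= [in RHS](bigD1 i) //= eqxx add1n -addSn subnSK//.
  by congr addn; apply: eq_bigr => j ji; rewrite (eq_sym i) (negbTE ji) -[nat_of_bool false]/0%N add0n.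
- by move=> j; rewrite cE; case: eqP => [->|_]; rewrite /= ?add1n ?add0n.
Qed.

(** Only the derivative of order [N] in every coordinate is approximated, uniformly; the primitive
    of this approximation and [g] have the same zero data on the lower faces, so all lower
    derivatives are close as well. *)
Lemma smooth_weierstrass (S : set 'rV[R]_m) (g : 'rV[R]_m -> R) N e : compact S ->
  smooth_supp S g -> 0 < e ->
  exists2 P, polyfun P & smooth_in setT (P : _ -> R^o) /\ derivs_le N S (fun z => g z - P z) e.
Proof.
move=> cS [sg g0] e0.
have [M MS] : exists M : R, forall z, S z -> `|z| <= M.
  by have [M [_ MP]] := compact_bounded cS; exists (M + 1) => z Sz; apply: MP => //; rewrite ltrDl.
(* Strictly larger than the norms of the points of [S], so that [g] vanishes near the faces of the
   cube. *)
pose L : R := Num.max 0 M + 1.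
have L0 : 0 < L by rewrite ltr_pwDr// le_max lexx.
have SL z : S z -> `|z| < L.
  by move=> /MS zM; rewrite (le_lt_trans zM)// /L ltr_pwDr// le_max lexx orbT.
have oSC : open (~` S) by apply: closed_openC; exact: compact_closed.
have face t i (z : 'rV[R]_m) : z 0 i = - L -> partial t g z = 0.
  move=> zi; rewrite /partial (@iter_derive_ext _ _ (~` S) _ (fun=> 0)) ?iter_derive_cst0//.
  move=> /SL; rewrite ltNge => /negP; apply.
  by have := norm_coord z i; rewrite zi normrN gtr0_norm.
pose sigma : seq 'I_m := flatten [seq nseq N i | i <- index_enum 'I_m].
have sN i : count_mem i sigma = N.
  rewrite count_flatten sumnE !big_map (bigD1 i) //= count_nseq /= eqxx mul1n.
  by rewrite big1 ?addn0// => j ji; rewrite count_nseq /= (negbTE ji).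
pose G := partial sigma g.
have cG z : {for z, continuous (G : 'rV[R]_m -> R^o)}.
  by apply: (@smooth_in_cont _ _ _ setT) => //; exact: smooth_in_iter.
have cK : compact [set z : 'rV[R]_m | `|z| <= L].
  by have := @cube_compact R m 0 L; under eq_set do rewrite subr0.
(* The sum dominates every power of [2 * L] that can occur, whether [2 * L] is above or below 1. *)
pose C := \sum_(k < (m * N).+1) (2 * L) ^+ k.
have C0 : 0 < C.
  rewrite /C big_ord_recl expr0 ltr_pwDl// sumr_ge0// => k _.
  by rewrite exprn_ge0// mulr_ge0// ltW.
have eC : 0 < e / C by rewrite divr_gt0.
have [||Q pQ QG] := @weierstrass R m L G L0 _ _ (e / C) eC.
- move=> e' e'0; have [d d0 Hd] := compact_unif cK (fun z _ => cG z) e'0.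
  by exists d => // z w zL wL zw; apply/ltW; exact: Hd.
- have [M' M'0 HM] := compact_bound cK (fun z _ => cG z).
  by exists M'.
have [P [mP PQ P0]] := mono_antiderivative N (polyfun_mono_span L pQ).
have sP : smooth_in setT (P : _ -> R^o).
  by elim: mP => [c k|p1 p2 _ s1 _ s2]; [apply: smooth_inM; [exact: openT|exact: smooth_in_cst|exact: smooth_mono]|apply: smooth_inD => //; exact: openT].
exists P; first exact: mono_span_polyfun mP.
split=> // t z tN Sz.
have pB t' y : partial t' (fun z => g z - P z) y = partial t' g y - partial t' P y.
  rewrite -mulN1r -(@iter_deriveZ _ _ setT P (-1) _ y openT sP I).
  rewrite -(iter_deriveD _ openT sg) //; last first.
    by apply: smooth_inM; [exact: openT|exact: smooth_in_cst|].
  by congr (iter_derive _ _ y); apply/funext => x; rewrite mulN1r.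
have tN' i : (count_mem i t <= N)%N := leq_trans (count_size _ _) tN.
have B := @partial_bound_from_top L (e / C) N (fun z => g z - P z) L0 _ _ _ t tN' z (ltW (SL z Sz)).
apply: le_trans (B _ _ _) _.
- by apply: smooth_inB => //; exact: openT.
- by move=> t' i y yL t'N yi; rewrite pB (face _ i)// (P0 _ i)// subrr.
- move=> t' y yL t'N; rewrite pB PQ//.
  suff -> : partial t' g y = G y by exact: QG.
  rewrite /G /partial; apply: (iter_derive_perm _ openT sg) => //.
  by apply/allP => i _; rewrite /= t'N sN.
- rewrite mulrCA -[leRHS]mulr1 ler_pM2l// ler_pdivrMr// mul1r.
  have kN : (\sum_i (N - count_mem i t) < (m * N).+1)%N.
    rewrite ltnS (leq_trans (leq_sum _ (fun i _ => leq_subr (count_mem i t) N)))//.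
    by rewrite sum_nat_const card_ord.
  rewrite /C (bigD1 (Ordinal kN)) //= lerDl sumr_ge0// => k _.
  by rewrite exprn_ge0// mulr_ge0// ltW.
Qed.

(** Replace [g] by a compactly supported function that agrees with it near [S], and approximate that
    by polynomials in the seminorm that controls [u]. *)
Lemma germ_distr_monomials (S : set 'rV[R]_m) (u : distr R m) : compact S -> germ_distr S u ->
  (forall s : seq 'I_m, u (fun z => \prod_(i <- s) z 0 i) = 0) ->
  forall g, smooth_near S g -> u g = 0.
Proof.
move=> cS us u0 g sg.
have [ul [N [C [C_0 uC]]]] := us.
have lin_add : forall phi psi, smooth_near S phi -> smooth_near S psi -> smooth_near S (fun x => phi x + psi x).
  by move=> phi psi; exact: smooth_nearD.
have up p : mono_span 0 p -> u p = 0.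
  elim=> [c k|p1 p2 m1 IH1 m2 IH2].
    rewrite (linear_onZ ul); first last.
    - by apply: smooth_nearW; exact: smooth_mono.
    - exact: smooth_near_cst.
    rewrite (_ : mono 0 k = fun z => \prod_(i <- flatten [seq nseq (k i) i | i <- index_enum 'I_m]) z 0 i).
      by rewrite u0 mulr0.
    apply/funext => z; rewrite big_flatten big_map; apply: eq_bigr => i _.
    by rewrite big_nseq addr0 -Monoid.iteropE.
  have sm q : mono_span 0 q -> smooth_near S q.
    elim=> [c k|q1 q2 _ s1 _ s2]; last exact: smooth_nearD.
    by apply: smooth_nearM; [exact: smooth_near_cst|apply: smooth_nearW; exact: smooth_mono].
  by rewrite (linear_onD ul) ?IH1 ?IH2 ?addr0//; exact: sm.
have [U [oU SU sU]] := sg.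
have [c [S' [sc c01 [cS' S'U] c0 [W [oW SW _ c1]]]]] := cutoff cS oU SU.
have clS' : closed S' by exact: compact_closed.
have sgU : smooth_near S' g by exists U.
have cg := smooth_cutoff_mul clS' (conj sc c0) sgU.
have SS' : S `<=` S'.
  move=> x Sx; apply: contrapT => /c0; rewrite c1; last exact: SW.
  by move=> /eqP; rewrite oner_eq0.
rewrite (germ_distr_eq us oW SW sg (smooth_nearW _ cg.1)); last by move=> x Wx; rewrite c1 ?mul1r.
apply/eqP; rewrite -normr_le0; apply/ler_addgt0Pl => e e0; rewrite addr0.
have eC : 0 < e / (C + 1) by rewrite divr_gt0// ltr_pwDr.
have [P pP [sP PB]] := smooth_weierstrass N cS' cg eC.
have := linear_onB ul (smooth_nearW S cg.1) (smooth_nearW S sP).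
rewrite (up P (polyfun_mono_span 0 pP)) subr0 => <-.
apply: (le_trans (uC _ (e / (C + 1)) _ _)).
- by apply: smooth_nearW; apply: smooth_inB => //; [exact: openT|exact: cg.1].
- by move=> t x tN /SS'; exact: PB.
- by rewrite mulrCA ler_piMr ?(ltW e0)// ler_pdivrMr ?ltr_pwDr// mul1r lerDl.
Qed.

End SmoothWeierstrass.

(** * Translations of distributions *)

Section Translation.
Context {R : realType}.

(** The uniform bound for words, applied to the reciprocals of the radii. *)
Lemma seq_radius (T : finType) (P : seq T -> R -> Prop) :
  (forall s d d', d' <= d -> P s d -> P s d') ->
  (forall s, exists2 d, 0 < d & P s d) ->
  forall N, exists2 d, 0 < d & forall s, (size s <= N)%N -> P s d.
Proof.
move=> mono H N.
have [s C D CD h d d0 dD|s|C C0 CP] := @seq_bound R T (fun s C => forall d, 0 < d -> d * C <= 1 -> P s d) _ _ N.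
- by apply: h => //; apply: le_trans dD; rewrite ler_wpM2l// ltW.
- have [d d0 Pd] := H s; exists d^-1; first by rewrite invr_ge0 ltW.
  move=> d' d'0; rewrite ler_pdivrMr// mul1r => dd; exact: mono Pd.
- exists (C + 1)^-1; first by rewrite invr_gt0 ltr_pwDr.
  move=> s sN; apply: CP => //; first by rewrite invr_gt0 ltr_pwDr.
  by rewrite mulrC ler_pdivrMr ?ltr_pwDr// mul1r lerDl.
Qed.

(** A cutoff which is 1 on [S] and 0 off [U] is uniformly continuous on [S], so it cannot drop from
    1 to 0 within a short distance. *)
Lemma compact_margin n (S U : set 'rV[R]_n) : compact S -> open U -> S `<=` U ->
  exists2 d, 0 < d & forall x y, S x -> `|y - x| < d -> U y.
Proof.
move=> cS oU SU.
have [c [S' [sc _ [_ S'U] c0 [W [_ SW _ c1]]]]] := cutoff cS oU SU.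
have cc x : {for x, continuous (c : 'rV[R]_n -> R^o)} by exact: smooth_in_cont sc _.
have [||d d0 Hd] := @compact_unif R _ S c 1 cS => //.
exists d => // x y Sx yx; apply: S'U; apply: contrapT => nS.
by have := Hd x y Sx yx; rewrite (c0 y nS) (c1 x (SW x Sx)) sub0r normrN normr1 ltxx.
Qed.

Section Shift.
Context {V : normedModType R}.

Lemma derive_shift_arg (f : V -> R^o) a v x :
  'D_v (fun y => f (y - a)) x = 'D_v f (x - a).
Proof.
rewrite /derive; set g1 := fun h => h^-1 *: _; set g2 := fun h => h^-1 *: _.
suff -> : g1 = g2 by [].
by apply/funext => h; rewrite /g1 /g2 /= addrA.
Qed.

Lemma derivable_shift_arg (f : V -> R^o) a v x :
  derivable f (x - a) v -> derivable (fun y => f (y - a)) x v.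
Proof.
rewrite /derivable; set g1 := fun h => h^-1 *: _; set g2 := fun h => h^-1 *: _.
suff -> : g1 = g2 by [].
by apply/funext => h; rewrite /g1 /g2 /= addrA.
Qed.

Lemma iter_derive_shift_arg (f : V -> R^o) a s :
  iter_derive s (fun y => f (y - a) : R^o) = fun x => iter_derive s f (x - a).
Proof.
elim: s => [//|v s IH] /=; apply/funext => x; rewrite IH.
exact: derive_shift_arg.
Qed.

Lemma smooth_in_shift (U U' : set V) (f : V -> R^o) a : (forall x, U' x -> U (x - a)) ->
  smooth_in U f -> smooth_in U' (fun x => f (x - a)).
Proof.
move=> UU [h]; split=> s x /UU Ux; rewrite iter_derive_shift_arg.
have [c d] := h s _ Ux; split=> [|v]; last exact: derivable_shift_arg.
apply: (@continuous_comp _ _ _ (fun x => x - a) (iter_derive s f)) => //.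
by apply: continuousB; [exact: cvg_id|exact: cst_continuous].
Qed.

End Shift.

Lemma smooth_near_shift n (S U : set 'rV[R]_n) (f : 'rV[R]_n -> R) a : open U ->
  smooth_in U (f : _ -> R^o) -> (forall x, S x -> U (x - a)) ->
  smooth_near S (fun x => f (x - a)).
Proof.
move=> oU sf SU; exists [set x | U (x - a)]; split=> //; last exact: smooth_in_shift sf.
apply: open_comp oU => x _.
by apply: continuousB; [exact: cvg_id|exact: cst_continuous].
Qed.

Section TranslationDistr.
Context {n : nat} (S U : set 'rV[R]_n) (V : distr R n) (G : 'rV[R]_n -> R).
Hypotheses (cS : compact S) (VS : germ_distr S V).
Hypotheses (oU : open U) (sG : smooth_in U (G : _ -> R^o)).

Lemma compact_shift (a : 'rV[R]_n) : compact ((fun x => x - a) @` S).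
Proof.
apply: continuous_compact => //; apply: continuous_subspaceT => x.
by apply: continuousB; [exact: cvg_id|exact: cst_continuous].
Qed.

Lemma translation_continuous : S `<=` U -> forall e, 0 < e -> exists2 d, 0 < d &
  forall a, `|a| < d -> (forall x, S x -> U (x - a)) /\ `|V (fun x => G (x - a)) - V G| <= e.
Proof.
move=> SU e e0.
have [Vl [N [C [C0 VC]]]] := VS.
have [d1 d10 Hd1] := compact_margin cS oU SU.
have eC : 0 < e / (C + 1) by rewrite divr_gt0// ltr_pwDr.
have [s d d' dd H x a Sx ad|s|d2 d20 Hd2] := @seq_radius 'I_n
   (fun s d => forall x a, S x -> `|a| < d -> `|partial s G (x - a) - partial s G x| <= e / (C + 1)) _ _ N.
- by apply: H => //; exact: lt_le_trans ad dd.
- have cG x : S x -> {for x, continuous (partial s G : _ -> R^o)}.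
    by move=> /SU; apply: smooth_in_cont; exact: smooth_in_iter.
  have [d d0 Hd] := compact_unif cS cG eC; exists d => // x a Sx ad.
  by apply/ltW/Hd => //; rewrite addrAC subrr sub0r normrN.
exists (Num.min d1 d2); first by rewrite lt_min d10.
move=> a; rewrite lt_min => /andP[ad1 ad2].
have SaU x : S x -> U (x - a).
  by move=> Sx; apply: (Hd1 x) => //; rewrite addrAC subrr sub0r normrN.
split=> //.
have sGS : smooth_near S G by exists U.
have sGa := smooth_near_shift oU sG SaU.
rewrite -(linear_onB Vl sGa sGS) (le_trans (VC _ (e / (C + 1)) _ _))//.
- rewrite (_ : (fun x => _) = fun x => G (x - a) + -1 * G x); last first.
    by apply/funext => x; rewrite mulN1r.
  by apply: smooth_nearD => //; apply: smooth_nearM => //; exact: smooth_near_cst.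
- move=> s x sN Sx.
  suff -> : partial s (fun x => G (x - a) - G x) x = partial s G (x - a) - partial s G x by exact: Hd2.
  have [W [oW SW sW]] := sGa.
  have oWU := openI oW oU.
  have sGa' := smooth_in_sub (@subIsetl _ W U) sW.
  have sG' := smooth_in_sub (@subIsetr _ W U) sG.
  have WUx : (W `&` U) x by split; [exact: SW|exact: SU].
  rewrite -mulN1r -(@iter_deriveZ _ _ _ G (-1) _ x oWU sG' WUx).
  have -> : partial s G (x - a) = partial s (fun x => G (x - a)) x by rewrite /partial iter_derive_shift_arg.
  rewrite -(iter_deriveD _ oWU sGa') //; last first.
    by apply: smooth_inM => //; exact: smooth_in_cst.
  by congr (iter_derive _ _ x); apply/funext => y; rewrite mulN1r.
- by rewrite mulrCA ler_piMr ?(ltW e0)// ler_pdivrMr ?ltr_pwDr// mul1r lerDl.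
Qed.

End TranslationDistr.

(** The difference quotients of the translates converge to [- 'D_v G] together with all derivatives
    up to the order of [V], uniformly on [S]; hence [V] commutes with the limit. *)
Lemma translation_derive0 n (S U : set 'rV[R]_n) (V : distr R n) (G : 'rV[R]_n -> R) v :
  compact S -> germ_distr S V -> open U -> smooth_in U (G : _ -> R^o) -> S `<=` U ->
  is_derive (0 : R) (1 : R) (fun t : R => V (fun x => G (x - t *: v))) (- V ('D_v (G : _ -> R^o))).
Proof.
move=> cS VS oU sG SU.
have [Vl [N [C [C0 VC]]]] := VS.
have [d1 d10 Hd1] := compact_margin cS oU SU.
have sDG := smooth_in_derive v sG.
pose v1 := `|v| + 1; have v10 : 0 < v1 by rewrite ltr_pwDr.
have vv1 (t : R) d : `|t| < d / v1 -> `|t *: v| < d.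
  rewrite ltr_pdivlMr// normrZ; apply: le_lt_trans; rewrite ler_wpM2l// lerDl//.
have key e : 0 < e -> exists2 d, 0 < d & forall t : R, `|t| < d ->
    `|V (fun x => G (x - t *: v)) - V G + t * V ('D_v (G : _ -> R^o))| <= `|t| * e.
  move=> e0; have eC : 0 < e / (C + 1) by rewrite divr_gt0// ltr_pwDr.
  have [s d d' dd H x a Sx ad|s|d2 d20 Hd2] := @seq_radius 'I_n
     (fun s d => forall x a, S x -> `|a| < d ->
       `|partial s ('D_v (G : _ -> R^o)) (x - a) - partial s ('D_v (G : _ -> R^o)) x| <= e / (C + 1)) _ _ N.
  - by apply: H => //; exact: lt_le_trans ad dd.
  - have cG x : S x -> {for x, continuous (partial s ('D_v (G : _ -> R^o)) : _ -> R^o)}.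
      by move=> /SU; apply: smooth_in_cont; exact: smooth_in_iter.
    have [d d0 Hd] := compact_unif cS cG eC; exists d => // x a Sx ad.
    by apply/ltW/Hd => //; rewrite addrAC subrr sub0r normrN.
  exists (Num.min d1 d2 / v1); first by rewrite divr_gt0// lt_min d10.
  move=> t td; have := vv1 t _ td; rewrite lt_min => /andP[tv1 tv2].
  have SaU x (s : R) : 0 <= s <= 1 -> S x -> U (x - (s * t) *: v).
    move=> /andP[s0 s1] Sx; apply: (Hd1 x) => //; rewrite addrAC subrr sub0r normrN.
    apply: le_lt_trans tv1; rewrite !normrZ ?normrM (ger0_norm s0) ler_wpM2r//.
    by rewrite ler_piMl.
  have SaU1 x : S x -> U (x - t *: v).
    by move=> Sx; rewrite -[t]mul1r; apply: SaU; rewrite ?lexx ?ler01.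
  have sGS : smooth_near S G by exists U.
  have sDS : smooth_near S ('D_v (G : _ -> R^o)) by exists U.
  have sGa := smooth_near_shift oU sG SaU1.
  have sN1 (F : 'rV[R]_n -> R) c : smooth_near S F -> smooth_near S (fun x => c * F x).
    by move=> sF; apply: smooth_nearM => //; exact: smooth_near_cst.
  have -> : V (fun x => G (x - t *: v)) - V G + t * V ('D_v (G : _ -> R^o)) =
      V (fun x => G (x - t *: v) + -1 * G x + t * 'D_v (G : _ -> R^o) x).
    have z0 := smooth_near_cst S 0.
    rewrite (linear_onD Vl (smooth_nearD sGa (sN1 _ _ sGS)) (sN1 _ _ sDS)).
    rewrite (linear_onD Vl sGa (sN1 _ _ sGS)) (linear_onZ Vl _ z0 sGS) (linear_onZ Vl _ z0 sDS).
    by rewrite mulN1r.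
  apply: (le_trans (VC _ (`|t| * (e / (C + 1))) _ _)).
  - by apply: smooth_nearD; [apply: smooth_nearD => //; exact: sN1|exact: sN1].
  - move=> s x sN Sx.
    have [W [oW SW sW]] := sGa.
    have oWU := openI oW oU.
    have sGa' := smooth_in_sub (@subIsetl _ W U) sW.
    have sG' := smooth_in_sub (@subIsetr _ W U) sG.
    have sD' := smooth_in_sub (@subIsetr _ W U) sDG.
    have WUx : (W `&` U) x by split; [exact: SW|exact: SU].
    have sc (F : 'rV[R]_n -> R) c : smooth_in (W `&` U) (F : _ -> R^o) -> smooth_in (W `&` U) (fun x => c * F x : R^o).
      by move=> sF; apply: smooth_inM => //; exact: smooth_in_cst.
    rewrite /partial (iter_deriveD _ oWU _ (sc _ t sD') WUx); last first.
      by apply: smooth_inD => //; exact: sc.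
    rewrite (iter_deriveD _ oWU sGa' (sc _ (-1) sG') WUx).
    rewrite (iter_deriveZ _ _ oWU sG' WUx) (iter_deriveZ _ _ oWU sD' WUx).
    rewrite iter_derive_shift_arg mulN1r (iter_derive_swap _ _ oU sG (SU x Sx)).
    set A := iter_derive _ G.
    have sA : smooth_in U (A : _ -> R^o) by exact: smooth_in_iter.
    (* By symmetry of derivatives, the mean value is a value of the [s]-derivative of ['D_v G] at a
       point between [x] and [x - t *: v], where uniform continuity applies. *)
    have [r r01|r r01] := @line_MVT R _ A x v (- t).
      by rewrite mulrN scaleNr; have [] := smooth_in_is_derive v sA (SaU x r r01 Sx).
    rewrite scaleNr => ->; rewrite mulrN scaleNr mulNr addrC -mulrBr normrM ler_wpM2l//.
    have := Hd2 s sN x ((r * t) *: v) Sx.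
    rewrite /partial (iter_derive_swap _ _ oU sG (SU x Sx)) (iter_derive_swap _ _ oU sG (SaU x r r01 Sx)) distrC; apply.
    case/andP: r01 => r0 r1; apply: le_lt_trans tv2.
    by rewrite !normrZ ?normrM (ger0_norm r0) ler_wpM2r// ler_piMl.
  - rewrite mulrCA ler_wpM2l// mulrCA ler_piMr ?(ltW e0)//.
    by rewrite ler_pdivrMr ?ltr_pwDr// mul1r lerDl.
pose f (t : R) := V (fun x => G (x - t *: v)).
have f0 : f 0 = V G by rewrite /f; congr V; apply/funext => x; rewrite scale0r subr0.
have D : h^-1 *: ((f \o shift 0) (h *: 1) - f 0) @[h --> 0^'] --> - V ('D_v (G : _ -> R^o)).
  apply/cvgrPdist_le => e e0; have [d d0 Hd] := key e e0; near=> h.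
  have hd : `|h| < d by near: h; exact: dnbhs0_lt.
  have h0 : h != 0 by near: h; exact: nbhs_dnbhs_neq.
  rewrite /= addr0 [h *: 1]mulr1 f0.
  have -> : - V ('D_v (G : _ -> R^o)) - h^-1 *: (f h - V G) =
      - (h^-1 * (f h - V G + h * V ('D_v (G : _ -> R^o)))).
    by rewrite [_ *: _]/(_ * _) mulrDr mulKf// opprD addrC.
  rewrite normrN normrM normfV ler_pdivrMl ?normr_gt0//.
  exact: Hd.
by apply: DeriveDef; [apply/cvg_ex; exists (- V ('D_v (G : _ -> R^o)))|exact: cvg_lim D].
Unshelve. all: by end_near. Qed.

Lemma translation_derive n (S U : set 'rV[R]_n) (V : distr R n) (G : 'rV[R]_n -> R) v s :
  compact S -> germ_distr S V -> open U -> smooth_in U (G : _ -> R^o) ->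
  (forall x, S x -> U (x - s *: v)) ->
  is_derive s (1 : R) (fun t : R => V (fun x => G (x - t *: v)))
    (- V (fun x => 'D_v (G : _ -> R^o) (x - s *: v))).
Proof.
move=> cS VS oU sG Ss.
have oU' : open [set x : 'rV[R]_n | U (x - s *: v)].
  apply: open_comp oU => x _.
  by apply: (@continuousB _ _ _ id (fun=> s *: v)); [exact: cvg_id|exact: cst_continuous].
have sG' : smooth_in [set x | U (x - s *: v)] (fun x => G (x - s *: v) : R^o).
  exact: (smooth_in_shift _ sG).
have [dg eg] := translation_derive0 v cS VS oU' sG' Ss.
pose g (h : R) : R := V (fun x => G (x - h *: v - s *: v)).
have gE : (fun t : R => V (fun x => G (x - t *: v))) = fun h => g (h - s).
  apply/funext => h; rewrite /g; congr V; apply/funext => x; congr (G _).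
  by rewrite scalerBl opprB -[RHS]addrA (addrAC (s *: v)) subrr sub0r.
apply: DeriveDef.
  by rewrite gE; apply: (@derivable_shift_arg R^o g s 1 s); rewrite subrr.
rewrite gE (@derive_shift_arg R^o g s 1 s) subrr eg; congr (- V _).
by apply/funext => x; rewrite derive_shift_arg.
Qed.

End Translation.

(** * Homogeneous kernels *)

Lemma scaleRE {R : realType} (a b : R) : a *: (b : R^o) = a * b.
Proof. by []. Qed.

Section EuclideanNorm.
Context {R : realType} {n : nat}.
Implicit Types x y v : 'rV[R]_n.

Lemma dotC x y : dot x y = dot y x.
Proof. by apply: eq_bigr => i _; rewrite mulrC. Qed.

Lemma dotDr a x y v : dot v (a *: x + y) = a * dot v x + dot v y.
Proof.
rewrite /dot mulr_sumr -big_split /=; apply: eq_bigr => i _.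
by rewrite !mxE; ring.
Qed.

Lemma dotZr a x v : dot v (a *: x) = a * dot v x.
Proof. by rewrite /dot mulr_sumr; apply: eq_bigr => i _; rewrite !mxE; ring. Qed.

Lemma dotBr x y v : dot v (x - y) = dot v x - dot v y.
Proof. by rewrite -scaleN1r addrC dotDr mulN1r addrC. Qed.

Lemma dot_ge0 x : 0 <= dot x x.
Proof. by apply: sumr_ge0 => i _; rewrite -expr2 sqr_ge0. Qed.

Lemma dot_eq0 x : (dot x x == 0) = (x == 0).
Proof.
apply/idP/eqP => [|->]; last by rewrite /dot big1// => i _; rewrite mxE mul0r.
rewrite psumr_eq0 => [/allP H|i _]; last by rewrite -expr2 sqr_ge0.
apply/rowP => i; rewrite mxE; apply/eqP.
by have := H i (mem_index_enum i); rewrite /= mulf_eq0 orbb.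
Qed.

Lemma dot_gt0 x : (0 < dot x x) = (x != 0).
Proof. by rewrite lt_def dot_ge0 andbT dot_eq0. Qed.

Lemma enorm_ge0 x : 0 <= enorm x.
Proof. exact: sqrtr_ge0. Qed.

Lemma enorm_gt0 x : (0 < enorm x) = (x != 0).
Proof. by rewrite sqrtr_gt0 dot_gt0. Qed.

Lemma enorm_sqr x : enorm x ^+ 2 = dot x x.
Proof. by rewrite sqr_sqrtr ?dot_ge0. Qed.

Lemma enormZ a x : 0 <= a -> enorm (a *: x) = a * enorm x.
Proof.
move=> a0; apply/eqP; rewrite -(@eqrXn2 _ 2) ?enorm_ge0 ?mulr_ge0 ?enorm_ge0//.
by rewrite exprMn !enorm_sqr dotZr dotC dotZr mulrA -expr2.
Qed.

Lemma smooth_dotl (U : set 'rV[R]_n) v : smooth_in U (fun x => dot v x : R^o).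
Proof.
suff : smooth_in setT (fun x => dot v x : R^o) by apply: smooth_in_sub.
apply: smooth_in_sum => [|i _]; first exact: openT.
by apply: smooth_inM; [exact: openT|exact: smooth_in_cst|exact: smooth_in_coord].
Qed.

Lemma is_derive_dotl x u v : is_derive x u (fun x => dot v x : R^o) (dot v u).
Proof.
have fl (a : R) (y z : 'rV[R]_n) : dot v (a *: y + z) = a * dot v y + dot v z by exact: dotDr.
exact: (@is_derive_linear _ _ (fun x : 'rV[R]_n => dot v x) x u fl).
Qed.

Lemma smooth_dotxx (U : set 'rV[R]_n) : smooth_in U (fun x : 'rV[R]_n => dot x x : R^o).
Proof.
suff : smooth_in setT (fun x : 'rV[R]_n => dot x x : R^o) by apply: smooth_in_sub.
apply: smooth_in_sum => [|i _]; first exact: openT.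
by apply: smooth_inM; [exact: openT|exact: smooth_in_coord|exact: smooth_in_coord].
Qed.

Lemma is_derive_dotxx x v : is_derive x v (fun x : 'rV[R]_n => dot x x : R^o) (2 * dot x v).
Proof.
have E : \forall h \near 0^', h^-1 *: (((fun x : 'rV[R]_n => dot x x : R^o) \o shift x) (h *: v) - dot x x)
   = 2 * dot x v + h * dot v v.
  near=> h; have h0 : h != 0 by near: h; exact: nbhs_dnbhs_neq.
  rewrite /=; have -> : dot (h *: v + x) (h *: v + x) = h * (h * dot v v + dot v x) + (h * dot x v + dot x x).
    by rewrite dotDr (dotC _ v) dotDr (dotC (_ + _) x) dotDr.
  by rewrite (dotC v x) scaleRE; field.
have C : 2 * dot x v + h * dot v v @[h --> 0^'] --> 2 * dot x v.
  rewrite -[X in _ --> X]addr0 -[X in _ + X](mul0r (dot v v)).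
  apply: cvgD; first exact: cvg_cst.
  by apply: cvgMr_tmp; exact: nbhs_dnbhs.
have D : h^-1 *: (((fun x : 'rV[R]_n => dot x x : R^o) \o shift x) (h *: v) - dot x x) @[h --> 0^'] --> (2 * dot x v : R^o).
  by apply: cvg_trans C; apply: near_eq_cvg; apply: filterS E => h ->.
by apply: DeriveDef; [apply/cvg_ex; exists (2 * dot x v)|exact: cvg_lim D].
Unshelve. all: by end_near. Qed.

Lemma open_neq0 : open [set x : 'rV[R]_n | x != 0].
Proof.
rewrite (_ : [set x | _] = (fun x : 'rV[R]_n => dot x x : R^o) @^-1` [set y | 0 < y]); last first.
  by apply/seteqP; split=> x /=; rewrite dot_gt0.
apply: open_comp; last exact: open_gt.
by move=> x _; exact: (smooth_in_cont (smooth_dotxx setT)).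
Qed.

Lemma smooth_enorm : smooth_in [set x : 'rV[R]_n | x != 0] (enorm : _ -> R^o).
Proof.
apply: (@smooth_in_comp1 R _ _ [set t : R^o | 0 < t] (Num.sqrt : R^o -> R^o) (fun x : 'rV[R]_n => dot x x : R^o)).
- exact: open_neq0.
- exact: smooth_sqrt.
- exact: smooth_dotxx.
- by move=> x /=; rewrite dot_gt0.
Qed.

Lemma is_derive_enorm x v : x != 0 -> is_derive x v (enorm : 'rV[R]_n -> R^o) (dot x v / enorm x).
Proof.
move=> x0; have [d1 e1] := is_derive_dotxx x v.
have d0 : 0 < dot x x by rewrite dot_gt0.
have [d2 e2] := is_derive1_sqrt d0.
apply: is_derive_eq (is_derive_comp1 d1 d2) _.
have r0 : enorm x != 0 by rewrite gt_eqF// enorm_gt0.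
by rewrite e1 e2 -/(enorm x); field.
Qed.

Lemma enorm_cont : continuous (enorm : 'rV[R]_n -> R).
Proof.
move=> x; apply: (@continuous_comp _ _ _ (fun x : 'rV[R]_n => dot x x) Num.sqrt).
  exact: (smooth_in_cont (smooth_dotxx setT)).
exact: sqrt_continuous.
Qed.

End EuclideanNorm.

Section Homogeneous.
Context {R : realType} {n : nat}.
Implicit Types (K G : 'rV[R]_n -> R).

(** The degree of homogeneity is [- d]. Only positive factors are considered, so [K] may be neither
    even nor odd. *)
Definition homog (d : nat) K : Prop :=
  smooth_in [set x | x != 0] (K : _ -> R^o) /\
  forall y t, y != 0 -> 0 < t -> K (t *: y) = t^-1 ^+ d * K y.

Lemma homog_derive d K v : homog d K -> homog d.+1 ('D_v (K : _ -> R^o)).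
Proof.
move=> [sK hK]; split; first exact: smooth_in_derive.
move=> y t y0 t0.
have ty0 : t *: y != 0 by rewrite scaler_eq0 negb_or gt_eqF.
have [dK eK] := smooth_in_is_derive v sK y0.
have L : 'D_v (K \o (fun z => t *: z) : _ -> R^o) y = t * 'D_v (K : _ -> R^o) (t *: y).
  have dZ i : derivable (fun z : 'rV[R]_n => (t *: z) 0 i) y v.
    have [+ _] : is_derive y v (fun z : 'rV[R]_n => t * z 0 i : R^o) (t * v 0 i).
      exact: (is_deriveZ t (is_derive_coord y v i)).
    by congr (derivable _ y v); apply/funext => z; rewrite mxE.
  have [_ ->] := is_derive_comp open_neq0 sK ty0 dZ.
  rewrite (derive_dir v open_neq0 sK ty0) mulr_sumr; apply: eq_bigr => i _.
  rewrite mulrA; congr (_ * _).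
  have [_ <-] : is_derive y v (fun z : 'rV[R]_n => t * z 0 i : R^o) (t * v 0 i).
    exact: (is_deriveZ t (is_derive_coord y v i)).
  by congr ('D_v _ y); apply/funext => z; rewrite mxE.
have E : 'D_v (K \o (fun z => t *: z) : _ -> R^o) y = t^-1 ^+ d * 'D_v (K : _ -> R^o) y.
  rewrite -[RHS](deriveZ (t^-1 ^+ d) dK); apply: near_eq_derive.
  by near=> z; apply: hK => //; near: z; exact: (open_near open_neq0 y0).
apply: (mulfI (lt0r_neq0 t0)); rewrite -L E exprS !mulrA divff ?mul1r// gt_eqF//.
Unshelve. all: by end_near. Qed.

Lemma homog_iter d K v j : homog d K -> homog (d + j) (iter_derive (nseq j v) (K : _ -> R^o)).
Proof.
move=> hK; elim: j => [|j IH]; first by rewrite addn0.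
by rewrite addnS; exact: homog_derive.
Qed.

End Homogeneous.

(** * Stereographic coordinates and derivatives along their pole *)

Section Stereographic.
Context {R : realType} {n : nat} (e : 'rV[R]_n).
Hypothesis e1 : dot e e = 1.
Implicit Types (y z : 'rV[R]_n) (K : 'rV[R]_n -> R).

Definition perp y : 'rV[R]_n := y - dot e y *: e.

(** Vanishes exactly on the ray of [e]. The vector [perp y / rho y] is the stereographic projection
    from [e] of the direction of [y]. *)
Definition rho y : R := enorm y - dot e y.

Lemma perp_coordE y i : perp y 0 i = dot (basis_vec i - e 0 i *: e) y.
Proof.
rewrite dotC dotBr dotZr (dotC y e) !mxE mulrC; congr (_ - _).
rewrite /dot (bigD1 i) //= big1 => [|j ji]; last by rewrite mxE eqxx (negbTE ji) mulr0.
by rewrite mxE !eqxx mulr1 addr0.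
Qed.

Lemma perp_e : perp e = 0.
Proof. by rewrite /perp e1 scale1r subrr. Qed.

Lemma dot_perp_e y : dot e (perp y) = 0.
Proof. by rewrite dotBr dotZr e1 mulr1 subrr. Qed.

Lemma perpK y : perp (perp y) = perp y.
Proof. by rewrite {1}/perp dot_perp_e scale0r subr0. Qed.

Lemma perpZ a y : perp (a *: y) = a *: perp y.
Proof. by rewrite /perp dotZr scalerBr scalerA. Qed.

Lemma perpD y z : perp (y + z) = perp y + perp z.
Proof. by rewrite /perp -[y]scale1r dotDr !mul1r scale1r scalerDl opprD addrACA. Qed.

Lemma perp_dec y : y = perp y + dot e y *: e.
Proof. by rewrite subrK. Qed.

Lemma perp_sqr y : dot (perp y) (perp y) = dot y y - dot e y ^+ 2.
Proof.
rewrite {2}/perp dotBr dotZr (dotC _ e) dot_perp_e mulr0 subr0.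
by rewrite dotC dotBr dotZr (dotC y e) expr2.
Qed.

Lemma smooth_perp U i : smooth_in U (fun y => perp y 0 i : R^o).
Proof.
rewrite (_ : (fun y => _) = fun y => dot (basis_vec i - e 0 i *: e) y); first exact: smooth_dotl.
by apply/funext => y; exact: perp_coordE.
Qed.

Lemma derive_perp y i : is_derive y e (fun y => perp y 0 i : R^o) 0.
Proof.
rewrite (_ : (fun y => _) = fun y => dot (basis_vec i - e 0 i *: e) y); last first.
  by apply/funext => z; exact: perp_coordE.
by apply: is_derive_eq (is_derive_dotl _ _ _) _; rewrite -perp_coordE perp_e mxE.
Qed.

Lemma rhoZ t y : 0 <= t -> rho (t *: y) = t * rho y.
Proof. by move=> t0; rewrite /rho enormZ// dotZr mulrBr. Qed.

(** The factorization of [|y| ^ 2 - (e . y) ^ 2]. It expresses [enorm y] through [rho] and [perp],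
    which are the quantities easy to differentiate along [e]. *)
Lemma rho_perp y : rho y * (2 * enorm y - rho y) = dot (perp y) (perp y).
Proof. by rewrite perp_sqr -enorm_sqr /rho; ring. Qed.

(** The equality case of the Cauchy-Schwarz inequality. *)
Lemma rho_le0 y : rho y <= 0 -> exists2 t, 0 <= t & y = t *: e.
Proof.
rewrite subr_le0 => h.
have a0 : 0 <= dot e y := le_trans (enorm_ge0 y) h.
exists (dot e y) => //; apply/eqP; rewrite -subr_eq0 -/(perp y) -dot_eq0.
rewrite eq_le dot_ge0 andbT perp_sqr subr_le0 -enorm_sqr.
by rewrite ler_pXn2r ?nnegrE// enorm_ge0.
Qed.

Definition off_ray : set 'rV[R]_n := [set y | 0 < rho y].

Lemma off_ray_neq0 y : off_ray y -> y != 0.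
Proof.
have r0 : rho 0 = 0 by rewrite -(scale0r (0 : 'rV[R]_n)) rhoZ// mul0r.
by rewrite /off_ray /= => h; apply/eqP => y0; move: h; rewrite y0 r0 ltxx.
Qed.

Lemma open_off_ray : open off_ray.
Proof.
apply: (@open_comp _ _ rho [set t | 0 < t]); last exact: open_gt.
move=> x _; apply: continuousB; first exact: enorm_cont.
exact: (smooth_in_cont (smooth_dotl setT e)).
Qed.

Lemma smooth_rho : smooth_in [set x | x != 0] (rho : _ -> R^o).
Proof. by apply: smooth_inB; [exact: open_neq0|exact: smooth_enorm|exact: smooth_dotl]. Qed.

Lemma smooth_rho_ray : smooth_in off_ray (rho : _ -> R^o).
Proof. by apply: smooth_in_sub smooth_rho => y /off_ray_neq0. Qed.

Lemma smooth_rhoV k : smooth_in off_ray (fun y => (rho y)^-1 ^+ k : R^o).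
Proof.
apply: smooth_inX; first exact: open_off_ray.
apply: smooth_inV; [exact: open_off_ray|exact: smooth_rho_ray|].
by move=> y /lt0r_neq0.
Qed.

Lemma derive_rhoV k y : off_ray y ->
  is_derive y e (fun y => (rho y)^-1 ^+ k : R^o) (k%:R * (rho y)^-1 ^+ k / enorm y).
Proof.
move=> hy; have y0 := off_ray_neq0 hy; have r0 : rho y != 0 by exact: lt0r_neq0.
have n0 : enorm y != 0 by rewrite gt_eqF// enorm_gt0.
have dr : is_derive y e (rho : _ -> R) (- (rho y / enorm y)).
  apply: is_derive_eq (is_deriveB (is_derive_enorm e y0) (is_derive_dotl y e e)) _.
  by rewrite e1 (dotC y e) /rho; field.
have [d e2] := dr.
have dv : is_derive y e (fun y => (rho y)^-1 : R) ((rho y)^-1 / enorm y).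
  apply: DeriveDef; first exact: derivableV.
  by rewrite (deriveV r0 d) e2 scaleRE; field; rewrite r0 n0.
have -> : (fun y => (rho y)^-1 ^+ k : R^o) = (fun y => (rho y)^-1 : R) ^+ k.
  by apply/funext => z; rewrite exprfctE.
apply: is_derive_eq (is_deriveX k dv) _; rewrite scaleRE.
case: k => [|k]; first by rewrite !mul0r.
by rewrite /= exprSr; field; rewrite r0 n0.
Qed.

(* The monomials in the stereographic coordinates [perp y / rho y] (projected
   from [e]) times powers of [rho]. *)
Definition stereo (s : seq 'I_n) (l : nat) y : R :=
  (\prod_(i <- s) perp y 0 i) * (rho y)^-1 ^+ l.

Lemma smooth_perp_prod U s : smooth_in U (fun y => \prod_(i <- s) perp y 0 i : R^o).
Proof.
suff : smooth_in setT (fun y => \prod_(i <- s) perp y 0 i : R^o) by apply: smooth_in_sub.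
by apply: smooth_in_prod => [|i _]; [exact: openT|exact: smooth_perp].
Qed.

Lemma smooth_stereo s l : smooth_in off_ray (stereo s l : _ -> R^o).
Proof.
apply: smooth_inM; [exact: open_off_ray|exact: smooth_perp_prod|exact: smooth_rhoV].
Qed.

Lemma derive_stereo s l y : off_ray y ->
  is_derive y e (stereo s l : _ -> R^o) (l%:R * stereo s l y / enorm y).
Proof.
move=> hy.
have d1 : is_derive y e (fun y => \prod_(i <- s) perp y 0 i : R) 0.
  elim: s => [|i s IH].
    rewrite (_ : (fun y => _) = cst 1); first exact: is_derive_cst.
    by apply/funext => z; rewrite big_nil.
  rewrite (_ : (fun y => _) = (fun y => perp y 0 i) * (fun y => \prod_(i <- s) perp y 0 i)).
    by apply: is_derive_eq (is_deriveM (derive_perp y i) IH) _; rewrite !scaler0 addr0.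
  by apply/funext => z; rewrite big_cons.
apply: is_derive_eq (is_deriveM d1 (derive_rhoV l hy)) _.
by rewrite scaler0 addr0 scaleRE /stereo; ring.
Qed.

(* [e . grad] is onto: since [2 enorm = rho + |perp|^2 / rho] and
   [e . grad (rho ^- a) = a rho ^- a / enorm], a preimage is explicit. *)
Lemma stereo_derive s l y : off_ray y ->
  is_derive y e (fun y => 2^-1 / l.+1%:R * stereo s l.+1 y +
     2^-1 / l.+3%:R * \sum_i stereo [:: i, i & s] l.+3 y : R^o) (stereo s l.+2 y).
Proof.
move=> hy; have n0 : enorm y != 0 by rewrite gt_eqF// enorm_gt0 off_ray_neq0.
have r0 : rho y != 0 by exact: lt0r_neq0.
have dS : is_derive y e (fun y => \sum_i stereo [:: i, i & s] l.+3 y : R^o)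
    (\sum_i l.+3%:R * stereo [:: i, i & s] l.+3 y / enorm y).
  rewrite (_ : (fun y => _) = \sum_i (stereo [:: i, i & s] l.+3 : _ -> R^o)); last first.
    by rewrite fct_sumE.
  by apply: is_derive_sum => i; exact: derive_stereo.
apply: is_derive_eq (is_deriveD (is_deriveZ (2^-1 / l.+1%:R) (derive_stereo s l.+1 hy)) (is_deriveZ (2^-1 / l.+3%:R) dS)) _.
rewrite !scaleRE -mulr_suml -mulr_sumr.
have -> : \sum_i stereo [:: i, i & s] l.+3 y = dot (perp y) (perp y) * stereo s l.+3 y.
  by rewrite /dot mulr_suml; apply: eq_bigr => i _; rewrite /stereo !big_cons; ring.
rewrite -rho_perp /stereo !exprS.
have a0 : l.+1%:R != 0 :> R by rewrite pnatr_eq0.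
have b0 : l.+3%:R != 0 :> R by rewrite pnatr_eq0.
move: (\prod_(i <- s) _) (_^-1 ^+ l) (l.+1%:R) (l.+3%:R) a0 b0 => p q A B a0 b0.
by field; rewrite a0 b0 n0 r0.
Qed.

Lemma stereo_homog s l d y t : l = (d + size s)%N -> off_ray y -> 0 < t ->
  stereo s l (t *: y) = t^-1 ^+ d * stereo s l y.
Proof.
move=> -> hy t0; rewrite /stereo rhoZ ?(ltW t0)//.
rewrite (_ : \prod_(i <- s) _ = t ^+ size s * \prod_(i <- s) perp y 0 i).
  have E : t ^+ size s * t^-1 ^+ (d + size s) = t^-1 ^+ d.
    by rewrite exprD mulrCA -exprMn divff ?gt_eqF// expr1n mulr1.
  by rewrite invfM exprMn -E; ring.
elim: s => [|i s IH]; first by rewrite !big_nil mulr1.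
by rewrite !big_cons IH perpZ mxE exprS; ring.
Qed.

(** The explicit preimage of [stereo s l.+2] consists of [stereo] functions of degree one higher, to
    which the induction hypothesis applies. Positivity of [d] keeps the exponent of [rho] at least 2
    at each stage, as the preimage requires. *)
Lemma stereo_primitive d j : (0 < d)%N -> forall s l, l = (d + j + size s)%N ->
  exists K, [/\ smooth_in off_ray (K : _ -> R^o),
    forall y t, off_ray y -> 0 < t -> K (t *: y) = t^-1 ^+ d * K y &
    forall y, off_ray y -> iter_derive (nseq j e) (K : _ -> R^o) y = stereo s l y].
Proof.
move=> d0; elim: j => [|j IH] s l lE.
  exists (stereo s l); split=> //; first exact: smooth_stereo.
  by move=> y t; apply: stereo_homog; rewrite lE addn0.
case: l lE => [|[|l]] lE; [by lia|by lia|].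
have [|K1 [sK1 hK1 dK1]] := IH s l.+1; first by lia.
have /choice[K2 K2P] : forall i, exists K, [/\ smooth_in off_ray (K : _ -> R^o),
    forall y t, off_ray y -> 0 < t -> K (t *: y) = t^-1 ^+ d * K y &
    forall y, off_ray y -> iter_derive (nseq j e) (K : _ -> R^o) y = stereo [:: i, i & s] l.+3 y].
  by move=> i; apply: IH => /=; lia.
have oU := open_off_ray.
have sS : smooth_in off_ray (fun y => \sum_i K2 i y : R^o).
  by apply: smooth_in_sum => // i _; have [] := K2P i.
have sc (F : 'rV[R]_n -> R) c : smooth_in off_ray (F : _ -> R^o) -> smooth_in off_ray (fun x => c * F x : R^o).
  by move=> sF; apply: smooth_inM => //; exact: smooth_in_cst.
exists (fun y => 2^-1 / l.+1%:R * K1 y + 2^-1 / l.+3%:R * \sum_i K2 i y); split.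
- by apply: smooth_inD => //; exact: sc.
- move=> y t hy t0; rewrite hK1// mulrDr; congr (_ + _); first by ring.
  rewrite mulrCA; congr (_ * _); rewrite mulr_sumr; apply: eq_bigr => i _.
  by have [_ + _] := K2P i; apply.
- move=> y hy; have [_ <-] := stereo_derive s l hy.
  rewrite /=; apply: near_eq_derive; near=> z.
  have hz : off_ray z by near: z; exact: (open_near oU hy).
  rewrite (iter_deriveD _ oU (sc _ _ sK1) (sc _ _ sS) hz).
  rewrite (iter_deriveZ _ _ oU sK1 hz) (iter_deriveZ _ _ oU sS hz) dK1//; congr (_ + _ * _).
  rewrite (iter_derive_sum _ _ oU) => [|i|//]; last by have [] := K2P i.
  by apply: eq_bigr => i _; have [_ _ ->] := K2P i.
Unshelve. all: by end_near. Qed.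

End Stereographic.

(** * From secants to derivatives in the limit direction *)

Section DirectionalVanishing.
Context {R : realType} {n : nat} (S : set 'rV[R]_n) (V : distr R n).
Hypotheses (cS : compact S) (VS : germ_distr S V) (S0 : forall x, S x -> x != 0).

Let oN0 : open [set x : 'rV[R]_n | x != 0] := open_neq0.

Lemma open_shift_neq0 (a : 'rV[R]_n) : open [set x | x - a != 0].
Proof.
apply: open_comp oN0 => x _.
by apply: continuousB; [exact: cvg_id|exact: cst_continuous].
Qed.

Lemma iter_derive_nseqS (v : 'rV[R]_n) j (G : 'rV[R]_n -> R^o) :
  iter_derive (nseq j.+1 v) G = iter_derive (nseq j v) ('D_v G).
Proof. by rewrite -[j.+1]addn1 nseqD iter_derive_cat. Qed.

Lemma nseq_derive_sum j (G : 'rV[R]_n -> R) u x : smooth_in [set x | x != 0] (G : _ -> R^o) -> x != 0 ->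
  iter_derive (nseq j.+1 u) (G : _ -> R^o) x =
  \sum_i u 0 i * iter_derive (nseq j u) ('D_(basis_vec i) (G : _ -> R^o)) x.
Proof.
move=> sG x0; rewrite iter_derive_nseqS.
have sD i : smooth_in [set x | x != 0] ('D_(basis_vec i) (G : _ -> R^o)) by exact: smooth_in_derive.
have sZ i : smooth_in [set x | x != 0] (fun y => u 0 i * 'D_(basis_vec i) (G : _ -> R^o) y : R^o).
  by apply: smooth_inM => //; exact: smooth_in_cst.
rewrite (@iter_derive_ext _ _ [set x | x != 0] _ (fun y => \sum_i u 0 i * 'D_(basis_vec i) (G : _ -> R^o) y)) //.
  rewrite (iter_derive_sum _ _ oN0) //; apply: eq_bigr => i _.
  exact: iter_deriveZ oN0 (sD i) x0.
by move=> y y0; exact: derive_dir oN0 sG y0.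
Qed.

(** The direction varies together with the shift. Expanding each ['D_u] into partial derivatives
    turns the dependence on [u] into polynomial coefficients and leaves pure translations. *)
Lemma nseq_translation_continuous e j : forall G : 'rV[R]_n -> R,
  smooth_in [set x | x != 0] (G : _ -> R^o) ->
  V (fun x => iter_derive (nseq j z.1) (G : _ -> R^o) (x - z.2)) @[z --> (e, 0 : 'rV[R]_n)] -->
  V (iter_derive (nseq j e) (G : _ -> R^o)).
Proof.
elim: j => [|j IH] G sG.
  apply/cvgrPdist_le => eps eps0.
  have [d d0 Hd] := translation_continuous cS VS oN0 sG S0 eps0.
  exists (setT, [set a | `|a| < d]) => /=; last first.
    by move=> [u a] [_ /= /Hd[_]]; rewrite distrC.
  split; first exact: filterT.
  by apply: (near_normP (0 : 'rV[R]_n) (fun a => `|a| < d)).2; exists d => // a; rewrite subr0.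
have sD i : smooth_in [set x | x != 0] ('D_(basis_vec i) (G : _ -> R^o)) by exact: smooth_in_derive.
have [m m0 Hm] := compact_margin cS oN0 S0.
have VE u a : `|a| < m -> V (fun x => iter_derive (nseq j.+1 u) (G : _ -> R^o) (x - a)) =
   \sum_i u 0 i * V (fun x => iter_derive (nseq j u) ('D_(basis_vec i) (G : _ -> R^o)) (x - a)).
  move=> am; have Sa x : S x -> x - a != 0.
    by move=> Sx; apply: (Hm x) => //; rewrite addrAC subrr sub0r normrN.
  have sF i : smooth_near S (fun x => iter_derive (nseq j u) ('D_(basis_vec i) (G : _ -> R^o)) (x - a)).
    apply: (smooth_near_shift (f := iter_derive (nseq j u) ('D_(basis_vec i) (G : _ -> R^o))) oN0 _ Sa).
    exact: smooth_in_iter.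
  have sZ i : smooth_near S (fun x => u 0 i * iter_derive (nseq j u) ('D_(basis_vec i) (G : _ -> R^o)) (x - a)).
    by apply: smooth_nearM => //; exact: smooth_near_cst.
  have := linear_on_sum VS.1 (index_enum 'I_n) (smooth_near_cst S 0) (@smooth_nearD _ _ S) sZ.
  under [X in _ = X -> _]eq_bigr => i _ do rewrite (linear_onZ VS.1 _ (smooth_near_cst S 0) (sF i)).
  move=> <-.
  apply: (germ_distr_eq (U := [set x | x - a != 0]) VS) => //.
  - exact: open_shift_neq0.
  - apply: (smooth_near_shift (f := iter_derive (nseq j.+1 u) (G : _ -> R^o)) oN0 _ Sa).
    exact: smooth_in_iter.
  - exact: smooth_near_sum.
  - by move=> x /= xa; exact: nseq_derive_sum.
have -> : V (iter_derive (nseq j.+1 e) (G : _ -> R^o)) =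
   \sum_i e 0 i * V (iter_derive (nseq j e) ('D_(basis_vec i) (G : _ -> R^o))).
  have := VE e 0; rewrite normr0 => /(_ m0).
  under eq_fun do rewrite subr0.
  move=> ->; apply: eq_bigr => i _; congr (_ * V _).
  by apply/funext => x; rewrite subr0.
have E : \forall z \near (e, 0 : 'rV[R]_n),
    \sum_i (z.1 : 'rV[R]_n) 0 i * V (fun x => iter_derive (nseq j z.1) ('D_(basis_vec i) (G : _ -> R^o)) (x - z.2)) =
    V (fun x => iter_derive (nseq j.+1 z.1) (G : _ -> R^o) (x - z.2)).
  exists (setT, [set a | `|a| < m]) => /=; last first.
    by move=> [u a] [_ /= am]; rewrite VE.
  split; first exact: filterT.
  by apply: (near_normP (0 : 'rV[R]_n) (fun a => `|a| < m)).2; exists m => // a; rewrite subr0.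
apply: cvg_trans; first exact: near_eq_cvg E.
elim: (index_enum _) => [|i r IHr].
  rewrite big_nil (_ : (fun z => _) = cst 0); first exact: cvg_cst.
  by apply/funext => z; rewrite big_nil.
rewrite big_cons (_ : (fun z => _) = (fun z : 'rV[R]_n * 'rV[R]_n =>
   z.1 0 i * V (fun x => iter_derive (nseq j z.1) ('D_(basis_vec i) (G : _ -> R^o)) (x - z.2)) +
   \sum_(i <- r) z.1 0 i * V (fun x => iter_derive (nseq j z.1) ('D_(basis_vec i) (G : _ -> R^o)) (x - z.2)))); last first.
  by apply/funext => z; rewrite big_cons.
apply: cvgD => //; apply: cvgM; last exact: IH.
apply: (@cvg_comp _ _ _ (fun z : 'rV[R]_n * 'rV[R]_n => z.1) (fun u : 'rV[R]_n => u 0 i)); first exact: cvg_fst.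
exact: coord_continuous.
Qed.

(** The pairing with the [i]-th derivative translated by [s *: u] is, up to sign, the derivative in
    [s] of the previous one. At [s = 0] it vanishes for [i < j] by hypothesis, so each further zero
    yields, by Rolle's theorem, a zero of the next pairing. *)
Lemma rolle_chain d j u t K :
  (forall i, (i < j)%N -> forall G, homog (d + i) G -> V G = 0) ->
  homog d K -> t != 0 ->
  (forall x s, S x -> `|s| <= `|t| -> x - s *: u != 0) ->
  V (fun x => K (x - t *: u)) = 0 ->
  exists2 s, `|s| <= `|t| & V (fun x => iter_derive (nseq j u) (K : _ -> R^o) (x - s *: u)) = 0.
Proof.
move=> P hK t0 Su Kt.
pose G i := iter_derive (nseq i u) (K : _ -> R^o).
have sG i : smooth_in [set x | x != 0] (G i : _ -> R^o) by apply: smooth_in_iter; exact: hK.1.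
pose F i (s : R) := V (fun x => G i (x - s *: u)).
have dF i s : `|s| <= `|t| -> is_derive s (1 : R) (F i) (- F i.+1 s).
  move=> st.
  by apply: (translation_derive cS VS oN0 (sG i)) => x Sx; exact: Su.
(* The zero is kept nonzero, as the next application of Rolle's theorem is between 0 and [s]. *)
suff [s [s0 st Fs]] : exists s, [/\ s != 0, `|s| <= `|t| & F j s = 0] by exists s.
elim: j P => [|j IH] P; first by exists t; rewrite lexx.
have [i ij G' hG'|s [s0 st Fs]] := IH.
  by apply: (P i) => //; exact: ltnW.
have F0 : F j 0 = 0.
  rewrite /F (_ : (fun x => _) = G j); last by apply/funext => x; rewrite scale0r subr0.
  by apply: (P j) => //; exact: homog_iter.
have sc r : 0 <= r <= 1 -> `|r * s| <= `|t|.
  move=> /andP[r0 r1]; apply: le_trans st; rewrite normrM (ger0_norm r0).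
  by rewrite ler_piMl.
have [r r01|r /andP[r0 r1]] := @line_MVT_oo R R^o (F j) 0 1 s.
  by rewrite add0r [_ *: _]mulr1; have [] := dF j _ (sc r r01).
have r01 : 0 <= r <= 1 by rewrite !ltW.
rewrite !add0r [s *: _]mulr1 [(r * s) *: _]mulr1 Fs F0 subrr.
have [_ ->] := dF j _ (sc r r01).
move=> /esym/eqP; rewrite mulf_eq0 (negbTE s0) oppr_eq0 /= => /eqP FS.
by exists (r * s); rewrite mulf_neq0// ?gt_eqF//; split => //; exact: sc.
Qed.

(** The zeros from Rolle's theorem tend to the origin and the secant directions to [e], so joint
    continuity gives the value at the limit. *)
Lemma directional_zero d e j K :
  (forall i, (i < j)%N -> forall G, homog (d + i) G -> V G = 0) ->
  (forall m, 0 < m -> exists u t, [/\ `|u - e| < m, t != 0, `|t| < m &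
     forall K, homog d K -> V (fun x => K (x - t *: u)) = 0]) ->
  homog d K -> V (iter_derive (nseq j e) (K : _ -> R^o)) = 0.
Proof.
move=> P H hK; apply/eqP; rewrite -normr_le0; apply/ler_addgt0Pl => eps eps0; rewrite addr0.
have /cvgrPdist_le/(_ _ eps0)[[A B] /= [Ae B0] AB] := @nseq_translation_continuous e j K hK.1.
have [m1 m10 Hm1] := compact_margin cS oN0 S0.
have /near_normP[a a0 Ha] := Ae; have /near_normP[b b0 Hb] := B0.
(* [L] bounds [|u|] when [|u - e| < 1]; the quotients by [L] then keep the shifts [s *: u] both in
   the margin of [S] and in the neighbourhood given by continuity. *)
pose L := `|e| + 2; have L0 : 0 < L by rewrite ltr_wpDl.
pose m := Num.min (Num.min a 1) (Num.min (m1 / L) (b / L)).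
have m0 : 0 < m by rewrite !lt_min a0 ltr01 !divr_gt0.
have [u [t [ue t0 tm tK]]] := H m m0.
move: ue tm; rewrite !lt_min => /andP[/andP[ua u1] _] /andP[_ /andP[tm1 tb]].
have uL : `|u| < L.
  rewrite -(subrK e u) (le_lt_trans (ler_normD _ _))// addrC /L ltrD2l.
  by apply: lt_trans u1 _; rewrite ltr1n.
have small c (s : R) : `|t| < c / L -> `|s| <= `|t| -> `|s *: u| < c.
  move=> tc st; rewrite normrZ; apply: (@le_lt_trans _ _ (`|t| * L)); last by rewrite -ltr_pdivlMr.
  by apply: ler_pM => //; exact: ltW.
have [|s st Fs] := rolle_chain (u := u) (t := t) P hK t0 _ (tK K hK).
  move=> x s Sx st; apply: (Hm1 x) => //.
  by rewrite addrAC subrr sub0r normrN; exact: small.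
have := AB (u, s *: u); rewrite /= Fs subr0; apply; split; first exact: Ha.
by apply: Hb; rewrite subr0; exact: small.
Qed.

End DirectionalVanishing.

Lemma continuous_lin2 {R : realType} {T : topologicalType} (f g : T -> R) (c : R) :
  continuous f -> continuous g -> continuous (fun y => c * f y - g y).
Proof.
move=> fc gc y; apply: (@cvgB R R^o); last exact: gc.
by apply: cvgM; [exact: cvg_cst|exact: fc].
Qed.

(** * A distribution orthogonal to the kernels of a secant family vanishes *)

Section ManySources.
Context {R : realType} {n : nat} (S : set 'rV[R]_n) (V : distr R n) (e : 'rV[R]_n) (d : nat).
Hypotheses (cS : compact S) (VS : germ_distr S V) (e1 : dot e e = 1).
Hypotheses (d0 : (0 < d)%N) (Se : S `<=` off_ray e).

Let oE : open (off_ray e) := @open_off_ray _ _ e.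

(** Multiply by a smooth function of [rho / enorm]. It is homogeneous of degree 0, so the degree of
    [K] is kept, and it can vanish near the ray of [e] without changing [K] near [S], because
    [rho / enorm] is bounded below on the compact set [S]. *)
Lemma angular_extension (K : 'rV[R]_n -> R) : smooth_in (off_ray e) (K : _ -> R^o) ->
  (forall y t, off_ray e y -> 0 < t -> K (t *: y) = t^-1 ^+ d * K y) ->
  exists K' W, [/\ homog d K', open W, S `<=` W, W `<=` off_ray e & forall y, W y -> K' y = K y].
Proof.
move=> sK hK.
have eneq : off_ray e `<=` [set y | y != 0] := @off_ray_neq0 _ _ e.
have srV : smooth_in (off_ray e) (fun y => (rho e y)^-1 : R^o).
  by apply: smooth_inV => //; [exact: smooth_rho_ray|move=> y /lt0r_neq0].
have sq : smooth_in (off_ray e) (fun y => enorm y * (rho e y)^-1 : R^o).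
  by apply: smooth_inM => //; exact: smooth_in_sub smooth_enorm.
have [M M0 HM] := compact_bound cS (fun y Sy => smooth_in_cont sq (Se Sy)).
have M1 : 0 < M + 1 by rewrite ltr_pwDr.
(* On [S] one has [rho / enorm >= 1 / M] when [M > 0]. The argument reaches 1 at
   [rho / enorm = 1 / (M + 1)] and drops to 0 at half of this ratio. *)
pose arg y := 2 * (M + 1) * rho e y * (enorm y)^-1 - 1.
pose K' y := step (arg y) * K y.
have rc : continuous (rho e).
  move=> y; apply: continuousB; first exact: enorm_cont.
  exact: (smooth_in_cont (smooth_dotl setT e)).
have rcont (c : R) : continuous (fun y => c * rho e y - enorm y : R).
  exact: continuous_lin2 rc (@enorm_cont R n).
pose W := off_ray e `&` [set y | 0 < (M + 1) * rho e y - enorm y].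
have oW : open W.
  apply: openI => //; apply: (@open_comp _ _ (fun y => (M + 1) * rho e y - enorm y) [set t | 0 < t]); last exact: open_gt.
  by move=> y _; exact: rcont.
exists K', W; split=> //; last 1 first.
- move=> y [hy /= Wy]; rewrite /K' step1 ?mul1r// /arg lerBrDr.
  have y0 : 0 < enorm y by rewrite enorm_gt0 eneq.
  by rewrite ler_pdivlMr//; rewrite subr_gt0 in Wy; lra.
- split.
  + split=> s y /= y0.
    have [hy|hy] := pselect (off_ray e y).
      have [h] : smooth_in (off_ray e) (K' : _ -> R^o).
        apply: smooth_inM => //.
        apply: (smooth_in_comp1 (phi := step) (f := arg) oE smooth_step) => //.
        apply: smooth_inB => //; last exact: smooth_in_cst.
        apply: smooth_inM => //.
          by apply: smooth_inM => //; [exact: smooth_in_cst|exact: smooth_rho_ray].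
        apply: smooth_inV => //; first exact: smooth_in_sub smooth_enorm.
        by move=> z /eneq; rewrite /= -enorm_gt0 => /lt0r_neq0.
      exact: (h s y hy).
    (* An open cone around the ray of [e], on which the cut off kernel is zero. *)
    pose Z := [set y | 2 * (M + 1) * rho e y - enorm y < 0] `&` [set y : 'rV[R]_n | y != 0].
    have oZ : open Z.
      apply: openI; last exact: open_neq0.
      apply: (@open_comp _ _ (fun y => 2 * (M + 1) * rho e y - enorm y) [set t | t < 0]); last exact: open_lt.
      by move=> z _; exact: rcont.
    have Zy : Z y.
      split=> //=; rewrite subr_lt0 (@le_lt_trans _ _ 0) ?enorm_gt0//.
      by rewrite mulr_ge0_le0 ?mulr_ge0 ?(ltW M1)// leNgt; apply/negP.
    have [h] : smooth_in Z (K' : _ -> R^o).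
      apply: (smooth_in_ext oZ (f := fun=> 0)); last exact: smooth_in_cst.
      move=> z [/= zr z0]; rewrite /K' step0 ?mul0r// /arg lerBlDr add0r.
      by rewrite ler_pdivrMr ?enorm_gt0// mul1r -subr_le0 ltW.
    exact: (h s y Zy).
  + move=> y t y0 t0.
    have argE : arg (t *: y) = arg y.
      have n0 : enorm y != 0 by rewrite gt_eqF// enorm_gt0.
      by rewrite /arg rhoZ ?enormZ ?(ltW t0)//; congr (_ - 1); field; rewrite n0 gt_eqF.
    rewrite /K' argE; have [hy|hy] := pselect (off_ray e y).
      by rewrite hK// mulrCA.
    rewrite step0 ?mul0r ?mulr0// /arg lerBlDr add0r.
    apply: (@le_trans _ _ 0) => //; rewrite mulr_le0_ge0 ?invr_ge0 ?enorm_ge0//.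
    by rewrite mulr_ge0_le0 ?mulr_ge0 ?(ltW M1)// leNgt; apply/negP.
- move=> y Sy; split; first exact: Se.
  rewrite /= subr_gt0; have := HM y Sy; rewrite ger0_norm; last first.
    by rewrite mulr_ge0 ?enorm_ge0// invr_ge0 ltW//; exact: Se.
  rewrite ler_pdivrMr; last exact: Se.
  by have r0 : 0 < rho e y := Se Sy; move=> ?; lra.
- by move=> y [].
Qed.

Hypothesis Vt : forall m, 0 < m -> exists u t, [/\ `|u - e| < m, t != 0, `|t| < m &
  forall K, homog d K -> V (fun x => K (x - t *: u)) = 0].

Let S0 x : S x -> x != 0.
Proof. by move=> /Se; exact: off_ray_neq0. Qed.

(** Such a function is a [j]-fold [e]-derivative of a kernel of degree [- d]; its extension across
    the ray of [e] is one to which the vanishing of directional derivatives applies. *)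
Lemma stereo_zero j : (forall i, (i < j)%N -> forall G, homog (d + i) G -> V G = 0) ->
  forall s, V (stereo e s (d + j + size s)) = 0.
Proof.
move=> P s.
have [K [sK hK dK]] := @stereo_primitive _ _ e e1 d j d0 s _ (erefl (d + j + size s)%N).
have [K' [W [hK' oW SW We KE]]] := angular_extension sK hK.
rewrite -(directional_zero cS VS S0 P Vt hK').
apply: (germ_distr_eq VS oW SW).
- by exists (off_ray e); split=> //; exact: smooth_stereo.
- exists [set x | x != 0]; split=> //; first exact: open_neq0.
  exact: smooth_in_iter hK'.1.
- move=> y Wy; rewrite -dK; last exact: We.
  by apply: (@iter_derive_ext _ _ W) => // z Wz; rewrite KE.
Qed.

Definition stereo_proj (y : 'rV[R]_n) := (rho e y)^-1 *: perp e y.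

(** The vector with [rho = 1] on the ray with coordinates [perp e z]; its length is
    [(|perp e z| ^ 2 + 1) / 2]. Projecting [z] first defines it on the whole space. *)
Definition stereo_inv (z : 'rV[R]_n) := perp e z + ((dot (perp e z) (perp e z) - 1) / 2) *: e.

Lemma stereo_projK y : off_ray e y -> stereo_inv (stereo_proj y) = (rho e y)^-1 *: y.
Proof.
move=> hy; have r0 : rho e y != 0 by exact: lt0r_neq0.
have -> : (rho e y)^-1 *: y = (rho e y)^-1 *: perp e y + ((rho e y)^-1 * dot e y) *: e.
  by rewrite -scalerA -scalerDr -perp_dec.
rewrite /stereo_inv /stereo_proj perpZ (perpK e1) dotZr dotC dotZr -(rho_perp e1).
have -> : enorm y = rho e y + dot e y by rewrite subrK.
congr (_ + _ *: _); move: (rho e y) (dot e y) r0 => a b a0.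
by field.
Qed.

Lemma stereo_inv_neq0 z : stereo_inv z != 0.
Proof.
apply/eqP => h; have : perp e (stereo_inv z) = perp e z.
  by rewrite /stereo_inv perpD (perpK e1) perpZ (perp_e e1) scaler0 addr0.
rewrite h -(scale0r (0 : 'rV[R]_n)) perpZ scale0r => pz.
have := congr1 (dot e) h; rewrite /stereo_inv -pz addrC dotDr e1 -[X in X - 1](_ : 0 = _).
  rewrite sub0r mulr1 -(scale0r (0 : 'rV[R]_n)) !dotZr !mul0r addr0 => /eqP.
  by rewrite mulf_eq0 invr_eq0 oppr_eq0 oner_eq0 pnatr_eq0.
by rewrite -(scale0r (0 : 'rV[R]_n)) dotZr mul0r.
Qed.

Lemma smooth_stereo_proj i : smooth_in (off_ray e) (fun y => stereo_proj y 0 i : R^o).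
Proof.
rewrite (_ : (fun y => _) = fun y => (rho e y)^-1 * perp e y 0 i); last first.
  by apply/funext => y; rewrite mxE.
apply: smooth_inM => //; last exact: smooth_perp.
by apply: smooth_inV => //; [exact: smooth_rho_ray|move=> y /lt0r_neq0].
Qed.

Lemma smooth_stereo_inv i : smooth_in setT (fun y => stereo_inv y 0 i : R^o).
Proof.
have oT : open [set: 'rV[R]_n] by exact: openT.
rewrite (_ : (fun y => _) = fun y => perp e y 0 i + (\sum_j perp e y 0 j * perp e y 0 j - 1) * (2^-1 * e 0 i)); last first.
  by apply/funext => y; rewrite !mxE /dot; congr (_ + _); rewrite mulrA.
apply: smooth_inD => //; first exact: smooth_perp.
apply: smooth_inM => //; last exact: smooth_in_cst.
apply: smooth_inB => //; last exact: smooth_in_cst.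
by apply: smooth_in_sum => // j _; apply: smooth_inM => //; exact: smooth_perp.
Qed.

Lemma compact_rows_image m (U : set 'rV[R]_n) (Z : 'rV[R]_n -> 'rV[R]_m) : S `<=` U ->
  (forall i, smooth_in U (fun x => Z x 0 i : R^o)) -> compact (Z @` S).
Proof.
move=> SU sZ; apply: continuous_compact => //; apply: continuous_in_subspaceT => x.
by rewrite inE => /SU; exact: continuous_rows.
Qed.

(** By homogeneity, [G] is [rho ^- (d + j)] times a smooth function of the stereographic
    coordinates. The push-forward of [V] with this weight kills the monomials, hence all smooth
    functions. *)
Lemma homog_zero j G : homog (d + j) G -> V G = 0.
Proof.
elim/ltn_ind: j G => j P G hG.
have st := stereo_zero P.
have cw := compact_rows_image Se smooth_stereo_proj.
have uS := germ_distr_pull cS oE Se smooth_stereo_proj (smooth_rhoV e (d + j)) VS.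
have Gz : smooth_in setT (G \o stereo_inv : _ -> R^o).
  apply: (smooth_in_comp (g := G) open_neq0 openT hG.1) => [z _|i]; first exact: stereo_inv_neq0.
  exact: smooth_stereo_inv.
have mono0 s : V (fun x => (rho e x)^-1 ^+ (d + j) * \prod_(i <- s) stereo_proj x 0 i) = 0.
  rewrite -[RHS](st s); congr V; apply/funext => y.
  rewrite /stereo [in RHS]exprD [in RHS]mulrCA; congr (_ * _).
  rewrite /stereo_proj; elim: s => [|i s IH]; first by rewrite !big_nil mulr1.
  by rewrite !big_cons exprS mxE IH; ring.
rewrite -(germ_distr_monomials cw uS mono0 (smooth_nearW _ Gz)).
apply: (germ_distr_eq VS oE Se).
- by exists [set x | x != 0]; split; [exact: open_neq0|exact: S0|exact: hG.1].
- apply: (smooth_near_comp oE Se smooth_stereo_proj (smooth_rhoV e (d + j))).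
  exact: smooth_nearW.
- move=> y hy; have y0 := off_ray_neq0 hy; have r0 : 0 < rho e y by exact: hy.
  rewrite /= stereo_projK// (hG.2 y _ y0) ?invr_gt0// invrK mulrA -exprMn mulVf ?gt_eqF//.
  by rewrite expr1n mul1r.
Qed.

Definition inversion (y : 'rV[R]_n) : 'rV[R]_n := (dot y y)^-1 *: y.

Lemma inversion_neq0 y : y != 0 -> inversion y != 0.
Proof. by move=> y0; rewrite scaler_eq0 negb_or y0 andbT invr_eq0 dot_eq0. Qed.

Lemma enorm_inversion y : y != 0 -> enorm (inversion y) = (enorm y)^-1.
Proof.
move=> y0; rewrite /inversion enormZ ?invr_ge0 ?dot_ge0// -enorm_sqr.
have n0 : enorm y != 0 by rewrite gt_eqF// enorm_gt0.
by field.
Qed.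

Lemma inversionK y : y != 0 -> inversion (inversion y) = y.
Proof.
move=> y0; rewrite {1}/inversion -enorm_sqr enorm_inversion// exprVn invrK enorm_sqr scalerA.
by rewrite mulfV ?scale1r// dot_eq0.
Qed.

Lemma smooth_inversion i : smooth_in [set x | x != 0] (fun y => inversion y 0 i : R^o).
Proof.
have oN := @open_neq0 R n.
rewrite (_ : (fun y => _) = fun y => (dot y y)^-1 * y 0 i); last by apply/funext => y; rewrite mxE.
apply: smooth_inM => //; last exact: smooth_in_coord.
apply: smooth_inV => //; first exact: smooth_dotxx.
by move=> y /=; rewrite dot_eq0.
Qed.

Lemma smooth_enormV k : smooth_in [set x : 'rV[R]_n | x != 0] (fun y => (enorm y)^-1 ^+ k : R^o).
Proof.
apply: smooth_inX; first exact: open_neq0.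
apply: smooth_inV; [exact: open_neq0|exact: smooth_enorm|].
by move=> y /=; rewrite -enorm_gt0 => /lt0r_neq0.
Qed.

(* The moments [enorm y ^- (d + j)] along the rays from the source exhaust the
   polynomials in the inverted variable. *)
Lemma germ_distr_zero phi : smooth_near S phi -> V phi = 0.
Proof.
move=> sphi.
have ci := compact_rows_image S0 smooth_inversion.
have oN := @open_neq0 R n.
have uS := germ_distr_pull cS oN S0 smooth_inversion (smooth_enormV d) VS.
pose g z := (enorm z)^-1 ^+ d * phi (inversion z).
have iS : inversion @` (inversion @` S) = S.
  apply/seteqP; split=> [_ [_ [x Sx <-] <-]|x Sx]; first by rewrite inversionK// S0.
  by exists (inversion x); [exists x|rewrite inversionK// S0].
have iN : inversion @` S `<=` [set x | x != 0].
  by move=> _ [x Sx <-]; exact/inversion_neq0/S0.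
have sg : smooth_near (inversion @` S) g.
  apply: (smooth_near_comp oN iN smooth_inversion (smooth_enormV d)).
  by rewrite iS.
have mono0 s : V (fun x => (enorm x)^-1 ^+ d * \prod_(i <- s) inversion x 0 i) = 0.
  apply: (@homog_zero (size s)); split.
    apply: smooth_inM => //; first exact: smooth_enormV.
    by apply: smooth_in_prod => // i _; exact: smooth_inversion.
  move=> y t y0 t0; rewrite enormZ ?(ltW t0)// invfM exprMn exprD -!mulrA; congr (_ * _).
  rewrite mulrCA; congr (_ * _).
  have iZ : inversion (t *: y) = t^-1 *: inversion y.
    rewrite /inversion dotZr dotC dotZr !scalerA; congr (_ *: _).
    have tn : t != 0 by rewrite gt_eqF.
    have dn : dot y y != 0 by rewrite dot_eq0.
    by field; rewrite tn dn.
  rewrite iZ; elim: s => [|i s IH]; first by rewrite !big_nil mulr1.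
  by rewrite !big_cons IH mxE exprS; ring.
rewrite -(germ_distr_monomials ci uS mono0 sg).
apply: (germ_distr_eq VS oN S0) => //.
- exact: (smooth_near_comp oN S0 smooth_inversion (smooth_enormV d) sg).
- move=> y /= y0; rewrite /g inversionK// enorm_inversion// invrK mulrA -exprMn.
  by rewrite mulVf ?expr1n ?mul1r// gt_eqF// enorm_gt0.
Qed.

End ManySources.

(** * Supports and decay *)

Section Supports.
Context {R : realType} {n : nat}.
Implicit Types (u : distr R n) (S K U : set 'rV[R]_n) (phi psi : 'rV[R]_n -> R).

Lemma partial_off_supp S phi s x : closed S -> smooth_supp S phi -> ~ S x -> partial s phi x = 0.
Proof.
move=> cS [_ p0] nSx; rewrite /partial (@iter_derive_ext _ _ (~` S) _ (fun=> 0)) ?iter_derive_cst0//.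
exact: closed_openC.
Qed.

Lemma smooth_suppW S S' phi : S `<=` S' -> smooth_supp S phi -> smooth_supp S' phi.
Proof. by move=> SS [sp p0]; split=> // x nS; apply: p0 => /SS. Qed.

Lemma smooth_supp_lin S c phi psi : smooth_supp S phi -> smooth_supp S psi ->
  smooth_supp S (fun x => c * phi x + psi x).
Proof.
move=> [s1 z1] [s2 z2]; split; last by move=> x nS; rewrite z1// z2// mulr0 addr0.
apply: smooth_inD => //; first exact: openT.
by apply: smooth_inM => //; [exact: openT|exact: smooth_in_cst].
Qed.

Lemma smooth_suppM S phi psi : smooth_in setT (phi : _ -> R^o) -> smooth_supp S psi ->
  smooth_supp S (fun x => phi x * psi x).
Proof.
move=> s1 [s2 z2]; split; last by move=> x nS; rewrite z2// mulr0.
by apply: smooth_inM => //; exact: openT.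
Qed.

Lemma smooth_supp_test U S phi : compact S -> S `<=` U -> smooth_supp S phi -> test_on U phi.
Proof.
move=> cS SU [[sp] p0]; split; first exact: sp.
have clS : closed S by exact: compact_closed.
have sub : closure [set x | phi x != 0] `<=` S.
  rewrite [X in _ `<=` X](proj1 (closure_id S) clS); apply: closure_subset.
  by move=> x /= px; apply: contrapT => /p0 E; rewrite E eqxx in px.
split; last exact: subset_trans sub SU.
by apply: (subclosed_compact _ cS sub); exact: closed_closure.
Qed.

Lemma test_smooth_supp U phi : test_on U phi ->
  exists S, [/\ compact S, S `<=` U & smooth_supp S phi].
Proof.
move=> [sp [cS SU]]; exists (closure [set x | phi x != 0]); split=> //; split; first by split.
move=> x nx; apply: contrapT => /eqP px; apply: nx; exact: subset_closure.
Qed.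

Lemma closed_supp u : closed (supp u).
Proof.
rewrite -openC openE => x /= nx.
have [U [oU Ux HU]] : exists U, [/\ open U, U x & forall phi, test_on U phi -> u phi = 0].
  apply: contrapT => H; apply: nx => U oU Ux.
  apply: contrapT => H2; apply: H; exists U; split=> // phi tp.
  apply/eqP/negPn/negP => up; apply: H2; by exists phi.
have := open_near oU Ux; apply: filterS => y Uy sy.
by have [phi tp] := sy U oU Uy; rewrite HU// eqxx.
Qed.

(** Cover [S] by finitely many cubes on whose test functions [u] vanishes. Multiplying successively
    by [1 - cube_bump] never changes the value of [u], and the full product is 0 on [S]. *)
Lemma supp_vanish u S phi : test_distr u -> compact S -> (forall x, S x -> ~ supp u x) ->
  smooth_supp S phi -> u phi = 0.
Proof.
move=> tu cS Su sp.
have /choice[r rP] : forall x, exists r : R, S x -> 0 < r /\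
    forall psi, smooth_supp [set y | `|y - x| <= 2 * r] psi -> u psi = 0.
  move=> x; have [Sx|nSx] := pselect (S x); last by exists 0.
  have nx := Su x Sx.
  have [U [oU Ux HU]] : exists U, [/\ open U, U x & forall phi, test_on U phi -> u phi = 0].
    apply: contrapT => H; apply: nx => U oU Ux.
    apply: contrapT => H2; apply: H; exists U; split=> // p tp.
    apply/eqP/negPn/negP => up; apply: H2; by exists p.
  have /near_normP[d d0 dU] := open_near oU Ux.
  exists (d / 3) => _; split=> [|psi sps]; first by rewrite divr_gt0.
  apply: HU; apply: smooth_supp_test sps; first exact: cube_compact.
  by move=> y /= yd; apply: dU; apply: le_lt_trans yd _; lra.
have [|s sS sc] := finite_ball_cover (r := r) cS; first by move=> x /rP[].
have sb x : smooth_in setT (cube_bump x (r x) : _ -> R^o) by exact: smooth_cube_bump.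
have s1b x : smooth_in setT (fun y => 1 - cube_bump x (r x) y : R^o).
  by apply: smooth_inB => //; [exact: openT|exact: smooth_in_cst].
have [ul _] := tu S cS.
have z0 : smooth_supp S (fun=> 0) by split=> //; exact: smooth_in_cst.
suff H t : (forall x, x \in t -> S x) -> forall psi, smooth_supp S psi ->
    u psi = u (fun y => (\prod_(x <- t) (1 - cube_bump x (r x) y)) * psi y).
  rewrite (H s sS phi sp) -[RHS](linear_on0 ul z0); congr u; apply/funext => y.
  have [Sy|nSy] := pselect (S y); last by rewrite sp.2 ?mulr0.
  have [x xs yx] := sc y Sy; rewrite (big_rem x xs) /= cube_bump1 ?ltW//.
    by rewrite subrr !mul0r.
  by have [] := rP x (sS x xs).
elim: t => [|x t IH] tS psi sps.
  by congr u; apply/funext => y; rewrite big_nil mul1r.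
have Sx : S x by apply: tS; rewrite mem_head.
have [r0 ux] := rP x Sx.
have sp1 : smooth_supp S (fun y => cube_bump x (r x) y * psi y) by exact: smooth_suppM.
have sp2 : smooth_supp S (fun y => (1 - cube_bump x (r x) y) * psi y) by exact: smooth_suppM.
have -> : u psi = u (fun y => cube_bump x (r x) y * psi y) + u (fun y => (1 - cube_bump x (r x) y) * psi y).
  by rewrite -(linear_onD ul)//; congr u; apply/funext => y; ring.
rewrite ux ?add0r; last first.
  split; first by have [] := sp1.
  by move=> y /= /negP; rewrite -ltNge => yx; rewrite cube_bump0// mul0r.
rewrite (IH _ _ sp2) => [|z zt]; last by apply: tS; rewrite inE zt orbT.
by congr u; apply/funext => y; rewrite big_cons; ring.
Qed.

Lemma sup_le_of (A : set R) e : 0 <= e -> (forall y, A y -> y <= e) -> sup A <= e.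
Proof.
move=> e0 Ae; have [->|/set0P A0] := eqVneq A set0; first by rewrite sup0.
exact: ge_sup.
Qed.

Lemma compact_distrE u : compact_distr u ->
  linear_on (fun phi => smooth_in setT (phi : _ -> R^o)) u /\
  exists K N C, [/\ compact K, 0 <= C & forall phi e, smooth_in setT (phi : _ -> R^o) -> 0 <= e ->
    derivs_le N K phi e -> `|u phi| <= C * e].
Proof.
move=> [ul [K [N [C [cK uC]]]]]; split.
  by move=> c phi psi [sp] [sq]; exact: (ul c phi psi sp sq).
exists K, N, `|C|; split=> // phi e [sp] e0 pe.
have H : smooth_seminorm K N phi <= e.
  by apply: sup_le_of => // _ [s [x [sN Kx ->]]]; exact: pe.
have H0 : 0 <= smooth_seminorm K N phi.
  rewrite /smooth_seminorm; set A := [set y | _].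
  have [->|/set0P[y Ay]] := eqVneq A set0; first by rewrite sup0.
  apply: (@le_trans _ _ y); first by case: Ay => s [x [_ _ ->]].
  apply: ub_le_sup => //; exists e => _ [s [x [sN Kx ->]]]; exact: pe.
apply: le_trans (uC _ sp) _.
apply: (@le_trans _ _ (`|C| * smooth_seminorm K N phi)); last by rewrite ler_wpM2l.
by rewrite ler_wpM2r// ler_norm.
Qed.

Lemma tempered_distrE u : tempered_distr u ->
  linear_on schwartz u /\
  exists N C, 0 <= C /\ forall phi e, schwartz phi -> 0 <= e ->
    (forall (s : seq 'I_n) x, (size s <= N)%N -> (1 + `|x|) ^+ N * `|partial s phi x| <= e) ->
    `|u phi| <= C * e.
Proof.
move=> [ul [N [C uC]]]; split=> //; exists N, `|C|; split=> // phi e sp e0 pe.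
have H : schwartz_seminorm N phi <= e.
  by apply: sup_le_of => // _ [s [x [sN ->]]]; exact: pe.
have H0 : 0 <= schwartz_seminorm N phi.
  rewrite /schwartz_seminorm; set A := [set y | _].
  have [->|/set0P[y Ay]] := eqVneq A set0; first by rewrite sup0.
  apply: (@le_trans _ _ y); first by case: Ay => s [x [_ ->]]; rewrite mulr_ge0 ?exprn_ge0 ?addr_ge0.
  apply: ub_le_sup => //; exists e => _ [s [x [sN ->]]]; exact: pe.
apply: le_trans (uC _ sp) _.
apply: (@le_trans _ _ (`|C| * schwartz_seminorm N phi)); last by rewrite ler_wpM2l.
by rewrite ler_wpM2r// ler_norm.
Qed.

Lemma bounded_norm S : bounded_set S -> exists2 M : R, 0 <= M & forall x, S x -> `|x| <= M.
Proof.
move=> [M [_ MP]]; exists (`|M| + 1); first by rewrite addr_ge0.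
by move=> x; apply: MP; rewrite (le_lt_trans (ler_norm _))// ltrDl.
Qed.

Lemma compact_norm_bound S : compact S -> exists2 M : R, 0 <= M & forall x, S x -> `|x| <= M.
Proof. by move=> /compact_bounded; exact: bounded_norm. Qed.

Lemma smooth_supp_schwartz S phi : compact S -> smooth_supp S phi -> schwartz phi.
Proof.
move=> cS sp; split; first by have [[]] := sp.
have clS : closed S by exact: compact_closed.
move=> N s.
have [M M0 SM] := compact_norm_bound cS.
have [D D0 SD] := compact_bound cS (fun x _ => smooth_in_cont (smooth_in_iter [seq basis_vec i | i <- s] sp.1) (I : setT x)).
exists ((1 + M) ^+ N * D) => x.
have [Sx|nSx] := pselect (S x); last first.
  by rewrite (partial_off_supp _ clS sp nSx) normr0 mulr0 mulr_ge0 ?exprn_ge0 ?addr_ge0.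
apply: ler_pM => //.
  by apply: lerXn2r; rewrite ?nnegrE ?addr_ge0// lerD2l SM.
exact: SD.
Qed.

Lemma bounded_by_set0 u : linear_on (smooth_supp set0) u -> bounded_by (smooth_supp set0) set0 u.
Proof.
move=> ul; exists 0%N, 0; split=> // phi e [sp p0] _.
have z0 : smooth_supp (set0 : set 'rV[R]_n) (fun=> 0) by split=> //; exact: smooth_in_cst.
rewrite (_ : phi = fun=> 0); last by apply/funext => x; exact: p0.
by rewrite (linear_on0 ul z0) normr0 mul0r.
Qed.

Lemma derivs_le_ge0 N S phi e x : S x -> derivs_le N S phi e -> 0 <= e.
Proof. by move=> Sx /(_ [::] x (leq0n _) Sx); apply: le_trans. Qed.

Lemma compact_test_distr u : compact_distr u -> test_distr u.
Proof.
move=> /compact_distrE[ul [K [N [C [cK C0 uC]]]]] S cS.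
have ulS : linear_on (smooth_supp S) u by move=> c phi psi [sp _] [sq _]; exact: ul.
split=> //; have [S0|/set0P[x0 Sx0]] := eqVneq S set0.
  by rewrite S0 in ulS *; exact: bounded_by_set0.
exists N, C; split=> // phi e sp pe; have e0 := derivs_le_ge0 Sx0 pe.
apply: uC => //; first exact: sp.1.
move=> s x sN Kx; have [Sx|nSx] := pselect (S x); first exact: pe.
by rewrite (partial_off_supp _ _ sp nSx) ?normr0//; exact: compact_closed.
Qed.

Lemma tempered_test_distr u : tempered_distr u -> test_distr u.
Proof.
move=> /tempered_distrE[ul [N [C [C0 uC]]]] S cS.
have clS : closed S by exact: compact_closed.
have ulS : linear_on (smooth_supp S) u.
  by move=> c phi psi sp sq; apply: ul; exact: smooth_supp_schwartz cS _.
split=> //; have [S0|/set0P[x0 Sx0]] := eqVneq S set0.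
  by rewrite S0 in ulS *; exact: bounded_by_set0.
have [M M0 SM] := compact_norm_bound cS.
exists N, (C * (1 + M) ^+ N); split; first by rewrite mulr_ge0 ?exprn_ge0 ?addr_ge0.
move=> phi e sp pe; have e0 := derivs_le_ge0 Sx0 pe.
rewrite -mulrA; apply: uC; first exact: smooth_supp_schwartz cS sp.
  by rewrite mulr_ge0 ?exprn_ge0 ?addr_ge0.
move=> s x sN; have [Sx|nSx] := pselect (S x); last first.
  by rewrite (partial_off_supp _ clS sp nSx) normr0 mulr0 mulr_ge0 ?exprn_ge0 ?addr_ge0.
apply: ler_pM => //.
  by apply: lerXn2r; rewrite ?nnegrE ?addr_ge0// lerD2l SM.
exact: pe.
Qed.

(** Cut the difference at a neighbourhood of the compact set [K] of the seminorm estimate. The outer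
    part has zero seminorm; the inner part has compact support, which avoids [supp u]. *)
Lemma compact_distr_local u U phi psi : compact_distr u -> open U -> supp u `<=` U ->
  smooth_in setT (phi : _ -> R^o) -> smooth_in setT (psi : _ -> R^o) ->
  (forall x, U x -> phi x = psi x) -> u phi = u psi.
Proof.
move=> cu oU uU sp sq E; have tu := compact_test_distr cu.
have [ul [K [N [C [cK C0 uC]]]]] := compact_distrE cu.
have oT : open [set: 'rV[R]_n] by exact: openT.
have [c [S [sc c01 [cS _] c0 [W [oW KW _ c1]]]]] := cutoff cK oT (@subsetT _ K).
have sD : smooth_in setT (fun x => phi x - psi x : R^o) by exact: smooth_inB.
have s1 : smooth_in setT (fun x => c x * (phi x - psi x) : R^o) by exact: smooth_inM.
have s2 : smooth_in setT (fun x => (1 - c x) * (phi x - psi x) : R^o).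
  by apply: smooth_inM => //; apply: smooth_inB => //; exact: smooth_in_cst.
apply/eqP; rewrite -subr_eq0 -(linear_onB ul sp sq).
rewrite (_ : (fun x => _) = fun x => c x * (phi x - psi x) + (1 - c x) * (phi x - psi x)); last first.
  by apply/funext => x; ring.
rewrite (linear_onD ul s1 s2) (supp_vanish (S := S `\` U) tu).
- rewrite add0r -normr_le0 (le_trans (uC _ 0 s2 _ _)) ?mulr0// => s x _ Kx.
  rewrite /partial (@iter_derive_ext _ _ W _ (fun=> 0)) ?iter_derive_cst0 ?normr0//; last exact: KW.
  by move=> y Wy; rewrite c1// subrr mul0r.
- by apply: compact_closedI => //; exact: open_closedC.
- by move=> x [_ nU] /uU.
- split=> // x nS; have [Ux|nUx] := pselect (U x); first by rewrite E// subrr mulr0.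
  by rewrite c0 ?mul0r// => Sx; apply: nS.
Qed.

End Supports.

(** * Bounds for iterated integrals *)

Section IntegralBound.
Context {R : realType}.

(** The integral of a nonnegative function is a supremum over simple functions below it, which is
    monotone for arbitrary functions. This covers the inner integrals of [int_Rn], whose
    measurability in the outer variable is not at hand. *)
Lemma ge0_le_integral_any d (T : measurableType d) (mu : {measure set T -> \bar R})
    (f g : T -> \bar R) : (forall x, 0 <= f x)%E -> (forall x, f x <= g x)%E ->
  (\int[mu]_x f x <= \int[mu]_x g x)%E.
Proof.
move=> f0 fg; have g0 x : (0 <= g x)%E := le_trans (f0 x) (fg x).
rewrite !ge0_integralTE//; apply: le_ereal_sup => _ [h hf <-].
by exists h => // x; exact: le_trans (hf x) (fg x).
Qed.

Lemma Rintegral_bound (G : R -> R) (c r M : R) : 0 <= M -> 0 <= r ->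
  (forall t, `|G t| <= M) -> (forall t, r < `|t - c| -> G t = 0) ->
  `|\int[lebesgue_measure]_(t in [set: R]) G t| <= M * (2 * r).
Proof.
move=> M0 r0 GM G0.
pose A := `[c - r, c + r]%classic : set R.
have mA : measurable A by exact: measurable_itv.
have muA : lebesgue_measure A = (2 * r)%:E.
  rewrite /A lebesgue_measure_itv /= lte_fin.
  case: ltgtP => h.
  - by rewrite -EFinB; congr (_%:E); ring.
  - by exfalso; lra.
  - by congr (_%:E); lra.
have AE : (\int[lebesgue_measure]_x (((fun=> M%:E) \_ A) x) = (M * (2 * r))%:E)%E.
  rewrite -integral_mkcond; have -> := @integral_cst _ _ R lebesgue_measure A mA M%:E.
  by rewrite EFinM -muA.
have bd (s : R -> \bar R) : (forall t, 0 <= s t)%E -> (forall t, s t <= `|G t|%:E)%E ->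
    (0 <= \int[lebesgue_measure]_x s x <= (M * (2 * r))%:E)%E.
  move=> s0 sG; rewrite integral_ge0//= -AE; apply: ge0_le_integral_any => // t.
  rewrite /patch; case: ifPn => tA.
    by apply: le_trans (sG t) _; rewrite lee_fin.
  apply: le_trans (sG t) _; rewrite lee_fin G0 ?normr0//.
  rewrite ltNge; apply: contra tA => tc; rewrite inE /A /= in_itv /=.
  by move: tc; rewrite ler_norml => /andP[? ?]; apply/andP; split; lra.
rewrite /Rintegral integralE.
set s1 := (fun x => ((fun x => (G x)%:E) ^\+)%E x); set s2 := (fun x => ((fun x => (G x)%:E) ^\-)%E x).
have /andP[a0 a1] : (0 <= \int[lebesgue_measure]_x s1 x <= (M * (2 * r))%:E)%E.
  apply: bd => t; first exact: funepos_ge0.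
  by rewrite /s1 funeposE -EFin_max lee_fin ge_max ler_norm normr_ge0.
have /andP[b0 b1] : (0 <= \int[lebesgue_measure]_x s2 x <= (M * (2 * r))%:E)%E.
  apply: bd => t; first exact: funeneg_ge0.
  by rewrite /s2 funenegE -EFinN -EFin_max lee_fin ge_max -normrN ler_norm normr_ge0.
move: a0 a1 b0 b1.
case: (\int[lebesgue_measure]_x s1 x)%E => [a| |] //; case: (\int[lebesgue_measure]_x s2 x)%E => [b| |] //.
rewrite !lee_fin /= => a0 a1 b0 b1; rewrite ler_norml; apply/andP; split; lra.
Qed.

Lemma int_Rn_bound n : forall (g : 'rV[R]_n -> R) (c : 'rV[R]_n) r M, 0 <= M -> 0 <= r ->
  (forall y, `|g y| <= M) -> (forall y, r < `|y - c| -> g y = 0) ->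
  `|int_Rn g| <= M * (2 * r) ^+ n.
Proof.
elim: n => [|n IH] g c r M M0 r0 gM g0 /=; first by rewrite mulr1.
rewrite exprS mulrCA mulrC; have D0 : 0 <= M * (2 * r) ^+ n by rewrite mulr_ge0// exprn_ge0// mulr_ge0.
apply: (@Rintegral_bound _ (c 0 0)) => // t.
- pose c' : 'rV[R]_n := \row_i c 0 (lift 0 i).
  apply: (IH _ c') => // y yr; apply: g0; apply: lt_le_trans yr _.
  apply: norm_row_le => // i; apply: le_trans (norm_coord _ (lift 0 i)); rewrite !mxE.
  case: splitP => j; rewrite lift0 => E; first by have := ltn_ord j; rewrite -E.
  by rewrite (_ : j = i)//; apply/val_inj; case: E.
- move=> tr; rewrite (_ : (fun y => _) = fun=> 0).
    elim: (n) => [//|m] /= ->; rewrite /Rintegral.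
    by rewrite integral0.
  apply/funext => y; apply: g0; apply: lt_le_trans tr _.
  apply: le_trans (norm_coord _ 0); rewrite !mxE.
  by case: splitP => j E; rewrite ?mxE.
Qed.

End IntegralBound.

Section RaySupport.
Context {R : realType} {n : nat}.
Implicit Types (K S : set 'rV[R]_n) (u v : distr R n) (phi : 'rV[R]_n -> R).

Lemma test_distrB u v : test_distr u -> test_distr v -> test_distr (fun phi => u phi - v phi).
Proof.
move=> tu tv S cS; have [ul [N [C [C0 uC]]]] := tu S cS; have [vl [N' [C' [C'0 vC]]]] := tv S cS.
split; first by move=> c phi psi sp sq; rewrite ul// vl//; ring.
exists (maxn N N'), (C + C'); split; first exact: addr_ge0.
move=> phi e sp pe; rewrite mulrDl (le_trans (ler_normB _ _))//; apply: lerD.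
  by apply: uC => // s x sN; apply: pe; rewrite (leq_trans sN)// leq_maxl.
by apply: vC => // s x sN; apply: pe; rewrite (leq_trans sN)// leq_maxr.
Qed.

(** The value is at most the product of the suprema of [h] and [phi] on the cube and of the volume
    of the cube; the latter two do not change under translation. *)
Lemma smooth_decaying_bound K v : smooth_decaying_off K v -> forall e, 0 < e ->
  exists M : R, forall phi c r A, 0 <= r -> 0 <= A ->
    smooth_supp [set y | `|y - c| <= r] phi -> (forall y, `|phi y| <= A) ->
    (forall y, `|y - c| <= r -> M < `|y| /\ ~ K y) -> `|v phi| <= e * A * (2 * r) ^+ n.
Proof.
move=> [h [_ vh hdec]] e e0; have [M HM] := hdec e e0; exists M => phi c r A r0 A0 sp pA HK.
rewrite vh; last first.
  apply: smooth_supp_test sp; first exact: cube_compact.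
  by move=> y /= /HK[].
apply: (@int_Rn_bound _ _ _ c) => //; first by rewrite mulr_ge0// ltW.
- move=> y; rewrite normrM; have [yr|yr] := lerP `|y - c| r.
    by apply: ler_pM => //; apply/ltW/HM; have [] := HK y yr.
  by rewrite sp.2 ?normr0 ?mulr0 ?mulr_ge0 ?(ltW e0)//= => h0; rewrite ltNge h0 in yr.
- by move=> y yr; rewrite sp.2 ?mulr0//= => h0; rewrite ltNge h0 in yr.
Qed.

(** Up to the time [T] the ray is a compact segment at positive distance from [K]; later it has left
    every cube that contains [K], even if started at distance 1 from [x]. *)
Lemma ray_margin K x xi : compact K -> xi != 0 -> (forall t : R, 0 <= t -> ~ K (x + t *: xi)) ->
  exists2 r, 0 < r & forall (t : R) y, 0 <= t -> `|y - x| <= r -> ~ K (y + t *: xi).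
Proof.
move=> cK xi0 H; have [M M0 KM] := compact_norm_bound cK.
have nxi : 0 < `|xi| by rewrite normr_gt0.
pose T := (M + 1 + `|x|) / `|xi|.
have T0 : 0 <= T by rewrite divr_ge0// addr_ge0// addr_ge0.
pose I := (fun t : R => x + t *: xi) @` `[0, T]%classic.
have cI : compact I.
  apply: continuous_compact; last exact: segment_compact.
  apply: continuous_subspaceT => t; apply: cvgD; first exact: cvg_cst.
  exact: scalel_continuous.
have oK : open (~` K) by apply: closed_openC; exact: compact_closed.
have [|d d0 Hd] := compact_margin cI oK.
  by move=> _ [t /= + <-]; rewrite in_itv /= => /andP[t0 _]; exact: H.
exists (Num.min (d / 2) 1); first by rewrite lt_min ltr01 andbT divr_gt0.
move=> t y t0; rewrite le_min => /andP[yd y1]; have [tT|Tt] := lerP t T.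
  apply: (Hd (x + t *: xi)); first by exists t => //=; rewrite in_itv /= t0.
  by rewrite opprD addrACA subrr addr0 (le_lt_trans yd)// ltr_pdivrMr// ltr_pMr// ltr1n.
move=> /KM h; have : `|t *: xi| <= M + 1 + `|x|.
  rewrite (_ : t *: xi = (y + t *: xi) - (y - x) - x); last by apply/rowP => i; rewrite !mxE; ring.
  by rewrite (le_trans (ler_normB _ _))// lerD2r (le_trans (ler_normB _ _))// lerD.
rewrite normrZ (ger0_norm t0); apply/negP; rewrite -ltNge.
by move: Tt; rewrite ltr_pdivrMr.
Qed.

(* A test function near [x] can be translated along the ray without changing the
   value of [u - v] on it, and far away this value tends to zero. *)
Lemma ray_not_supp K u v x xi : compact K -> test_distr u -> test_distr v ->
  smooth_decaying_off K u -> smooth_decaying_off K v ->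
  (forall i S phi, compact S -> smooth_supp S phi -> (forall y, S y -> ~ K y) ->
     u (partial [:: i] phi) - v (partial [:: i] phi) = 0) ->
  xi != 0 -> (forall t : R, 0 <= t -> ~ K (x + t *: xi)) ->
  ~ supp (fun phi => u phi - v phi) x.
Proof.
move=> cK tu tv du dv grad0 xi0 ray sx.
have [r r0 Hr] := ray_margin cK xi0 ray.
have oB := @open_norm_ball R n x r.
have xB : [set y | `|y - x| < r] x by rewrite /= subrr normr0.
have [phi /test_smooth_supp[S0 [cS0 S0B sp0]]] := sx _ oB xB.
have {S0 cS0 S0B sp0}sp : smooth_supp [set y | `|y - x| <= r] phi.
  by apply: smooth_suppW sp0 => y /S0B /= /ltW.
apply/negP; rewrite negbK -normr_le0; apply/ler_addgt0Pl => e e0; rewrite addr0.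
have cB := @cube_compact R n x r.
have [A0 A0_ge0 HA0] := compact_bound cB (fun y _ => smooth_in_cont sp.1 (I : setT y)).
have HA y : `|phi y| <= A0.
  have [yr|yr] := pselect (`|y - x| <= r); first exact: HA0.
  by rewrite sp.2// normr0.
pose D := (A0 + 1) * (2 * r) ^+ n.
have D0 : 0 < D by rewrite mulr_gt0 ?ltr_pwDr// exprn_gt0// mulr_gt0.
have e2 : 0 < e / (2 * D) by rewrite divr_gt0// mulr_gt0.
have [M1 HM1] := smooth_decaying_bound du e2; have [M2 HM2] := smooth_decaying_bound dv e2.
pose M := Num.max 0 (Num.max M1 M2).
have M0 : 0 <= M by rewrite le_max lexx.
have nxi : 0 < `|xi| by rewrite normr_gt0.
(* At time [T] the translated support of [phi] lies outside the cube of radius [M], where both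
   decaying functions are small. *)
pose T := (M + 1 + r + `|x|) / `|xi|.
have T0 : 0 < T by rewrite divr_gt0//; have := normr_ge0 x; lra.
(* The cube of radius [L] contains all translates up to time [T]; on it the cutoff [c] is 1, so that
   one compact set serves for all of them. *)
pose L := `|x| + r + T * `|xi|.
have L0 : 0 < L.
  by have := normr_ge0 x; have := mulr_ge0 (ltW T0) (ltW nxi); rewrite /L; lra.
pose w := fun psi => u psi - v psi.
have tw : test_distr w by exact: test_distrB.
pose S := [set y : 'rV[R]_n | `|y - 0| <= 2 * L].
have cS : compact S := @cube_compact R n 0 (2 * L).
pose c := cube_bump (0 : 'rV[R]_n) L.
have sc : smooth_supp S c.
  split; first exact: smooth_cube_bump.
  by move=> y /= /negP; rewrite -ltNge => yL; exact: cube_bump0.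
have WS := test_distr_germ cS sc tw.
have shiftE psi s : 0 <= s <= T -> (forall y, ~ `|y - x| <= r -> psi y = 0) ->
    (fun y => c y * psi (y - s *: xi)) = (fun y => psi (y - s *: xi)).
  move=> /andP[s0 sT] psi0; apply/funext => y.
  have [yr|yr] := pselect (`|y - s *: xi - x| <= r); last by rewrite psi0// mulr0.
  rewrite /c cube_bump1 ?mul1r// subr0 (_ : y = y - s *: xi - x + x + s *: xi); last by rewrite !subrK.
  rewrite (le_trans (ler_normD _ _))// lerD// ?normrZ ?(ger0_norm s0) ?ler_wpM2r//.
  by rewrite (le_trans (ler_normD _ _))// addrC lerD2l.
have dphi0 i y : ~ `|y - x| <= r -> partial [:: i] phi y = 0.
  by move=> yr; apply: (partial_off_supp _ _ sp) => //; exact: compact_closed.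
pose F (s : R) := w (fun y => c y * phi (y - s *: xi)).
have sphi s : smooth_in setT (fun y => phi (y - s *: xi) : R^o).
  by apply: smooth_in_shift sp.1.
(* The derivative is a combination of the [w]-values of partial derivatives of a test function
   supported off [K], all zero by hypothesis. *)
have dF s : 0 <= s <= T -> is_derive s (1 : R) F 0.
  move=> sT; apply: is_derive_eq (translation_derive (v := xi) (s := s) cS WS openT sp.1 (fun _ _ => I)) _.
  apply/eqP; rewrite oppr_eq0; apply/eqP.
  pose B' := [set y | `|y - (x + s *: xi)| <= r].
  have cB' : compact B' := @cube_compact R n (x + s *: xi) r.
  have spi : smooth_supp B' (fun y => phi (y - s *: xi)).
    by split=> // y /= yr; rewrite sp.2 //= -addrA -opprD (addrC (s *: xi)).
  have sd i : smooth_supp B' (partial [:: i] (fun y => phi (y - s *: xi))).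
    split; first exact: smooth_in_derive.
    by move=> y; apply: partial_off_supp spi; exact: compact_closed.
  have z0 : smooth_supp B' (fun=> 0) by split=> //; exact: smooth_in_cst.
  have [wl _] := tw B' cB'.
  have -> : (fun y => c y * 'D_xi (phi : _ -> R^o) (y - s *: xi)) =
      fun y => \sum_i xi 0 i * partial [:: i] (fun y => phi (y - s *: xi)) y.
    rewrite (@shiftE ('D_xi (phi : _ -> R^o))) //; last first.
      move=> y yr; rewrite (derive_dir _ openT sp.1)// big1// => i _.
      by rewrite [X in _ * X]dphi0 ?mulr0.
    apply/funext => y; rewrite (derive_dir _ openT sp.1)//; apply: eq_bigr => i _.
    by congr (_ * _); rewrite /partial /= derive_shift_arg.
  rewrite (linear_on_sum wl) //; first last.
  - move=> i; have := smooth_supp_lin (xi 0 i) (sd i) z0.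
    by under eq_fun do rewrite addr0.
  - by move=> p q spp spq; have := smooth_supp_lin 1 spp spq; under eq_fun do rewrite mul1r.
  rewrite big1// => i _; rewrite (linear_onZ wl _ z0 (sd i)).
  rewrite /w (grad0 i B' _ cB' spi) ?mulr0// => y /= yB.
  have := Hr s (y - s *: xi); rewrite subrK; apply; first by case/andP: sT.
  by rewrite -addrA -opprD (addrC (s *: xi)).
have F0 : F 0 = w phi.
  rewrite /F shiftE ?lexx ?(ltW T0)//; last by move=> y; exact: sp.2.
  by congr w; apply/funext => y; rewrite scale0r subr0.
have qT q : 0 <= q <= 1 -> 0 <= q * T <= T.
  by case/andP=> q0 q1; rewrite mulr_ge0 ?(ltW T0)//= ler_piMl// ltW.
have [q q01|q q01] := @line_MVT R R^o F 0 1 T.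
  by rewrite add0r [_ *: _]mulr1; have [] := dF (q * T) (qT q q01).
rewrite !add0r [T *: _]mulr1 [(q * T) *: _]mulr1.
have [_ ->] := dF (q * T) (qT q q01).
rewrite mulr0 => /eqP; rewrite subr_eq0 F0 => /eqP FT.
have FTE : F T = w (fun y => phi (y - T *: xi)).
  by rewrite /F shiftE ?lexx ?(ltW T0)//; move=> y; exact: sp.2.
rewrite -/(w phi) -FT FTE /w (le_trans (ler_normB _ _))//.
have spT : smooth_supp [set y | `|y - (x + T *: xi)| <= r] (fun y => phi (y - T *: xi)).
  by split=> // y /= yr; rewrite sp.2 //= -addrA -opprD (addrC (T *: xi)).
have far y : `|y - (x + T *: xi)| <= r -> M < `|y| /\ ~ K y.
  move=> yr; split; last first.
    have := Hr T (y - T *: xi) (ltW T0); rewrite subrK; apply.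
    by rewrite -addrA -opprD (addrC (T *: xi)).
  have : `|T *: xi| <= `|y| + r + `|x|.
    rewrite (_ : T *: xi = y - (y - (x + T *: xi)) - x); last by apply/rowP => i; rewrite !mxE; ring.
    by rewrite (le_trans (ler_normB _ _))// lerD2r (le_trans (ler_normB _ _))// lerD2l.
  rewrite normrZ gtr0_norm// divfK ?gt_eqF// => h; lra.
have A1 : A0 <= A0 + 1 by rewrite lerDl.
have A1_0 : 0 <= A0 + 1 by rewrite addr_ge0.
have b1 := HM1 _ _ _ (A0 + 1) (ltW r0) A1_0 spT (fun y => le_trans (HA _) A1).
have b2 := HM2 _ _ _ (A0 + 1) (ltW r0) A1_0 spT (fun y => le_trans (HA _) A1).
rewrite [e](_ : _ = e / (2 * D) * (A0 + 1) * (2 * r) ^+ n + e / (2 * D) * (A0 + 1) * (2 * r) ^+ n); last first.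
  by rewrite -!mulrA -/D; field; rewrite gt_eqF.
apply: lerD; [apply: b1|apply: b2] => y /far[My nK]; split=> //; apply: le_lt_trans My.
  by rewrite !le_max lexx orbT.
by rewrite !le_max lexx !orbT.
Qed.

End RaySupport.

(** * Integrals along the curve *)

Section CurveIntegral.
Context {R : realType} {n : nat} (a b : R).
Hypothesis ab : a < b.
Implicit Types (F H w : R -> R) (G : R -> 'rV[R]_n).

Let I F : R := \int[lebesgue_measure]_(s in `[a, b]) F s.

Definition itv_cont F : Prop := forall s, s \in `[a, b] -> {for s, continuous (F : R^o -> R^o)}.

Lemma itv_cont_integrable c d F : a <= c -> d <= b -> itv_cont F ->
  lebesgue_measure.-integrable `[c, d] (EFin \o F).
Proof.
move=> ac db cF; apply: continuous_compact_integrable; first exact: segment_compact.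
apply: continuous_in_subspaceT => s; rewrite inE /= in_itv /= => /andP[cs sd].
by apply: cF; rewrite in_itv /= (le_trans ac cs) (le_trans sd db).
Qed.

Let mI : measurable (`[a, b]%classic : set (measurableTypeR R)). Proof. exact: measurable_itv. Qed.

Let iF F : itv_cont F -> lebesgue_measure.-integrable `[a, b] (EFin \o F).
Proof. by move=> cF; exact: itv_cont_integrable. Qed.

Lemma itv_contZ k F : itv_cont F -> itv_cont (fun s => k * F s).
Proof. by move=> cF s /cF cs; apply: continuousM => //; exact: cst_continuous. Qed.

Lemma itv_intD F H : itv_cont F -> itv_cont H -> I (fun s => F s + H s) = I F + I H.
Proof. by move=> cF cH; apply: RintegralD => //; exact: iF. Qed.

Lemma itv_intZ k F : itv_cont F -> I (fun s => k * F s) = k * I F.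
Proof. by move=> cF; apply: RintegralZl => //; exact: iF. Qed.

Lemma itv_int_le F H : itv_cont F -> itv_cont H -> (forall s, s \in `[a, b] -> `|F s| <= H s) ->
  `|I F| <= I H.
Proof.
move=> cF cH FH; have h : `|I F| <= I (fun s => `|F s|) by exact: (le_normr_Rintegral mI (iF cF)).
apply: (le_trans h); apply: le_Rintegral => //; [|exact: iF]; apply: iF => s sab.
by apply: (@continuous_comp _ _ _ F Num.norm); [exact: cF|exact: norm_continuous].
Qed.

Lemma itv_int_eq F H : (forall s, s \in `[a, b] -> F s = H s) -> I F = I H.
Proof. by move=> FH; apply: eq_Rintegral => s; rewrite inE; exact: FH. Qed.

Lemma itv_int_gt0 F s0 : itv_cont F -> (forall s, s \in `[a, b] -> 0 <= F s) ->
  s0 \in `[a, b] -> 0 < F s0 -> 0 < I F.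
Proof.
move=> cF F0 s0ab Fs0.
have F2 : 0 < F s0 / 2 by rewrite divr_gt0.
have /near_normP[d d0 Hd] : \forall s \near (s0 : R^o), `|F s0 - F s| < F s0 / 2.
  by have /cvgrPdist_lt := cF s0 s0ab; exact.
move: s0ab; rewrite in_itv /= => /andP[as0 sb0].
pose l := Num.max a (s0 - d / 2); pose r := Num.min b (s0 + d / 2).
have d2 : 0 < d / 2 by rewrite divr_gt0.
have lr : l < r.
  rewrite lt_min !gt_max ab /=; apply/andP; split; last (apply/andP; split); lra.
have al : a <= l by rewrite le_max lexx.
have rb : r <= b by rewrite ge_min lexx.
have sub : (`[l, r] `<=` `[a, b])%classic.
  move=> s /=; rewrite !in_itv /= => /andP[ls sr].
  by rewrite (le_trans al ls) (le_trans sr rb).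
have mJ : measurable (`[l, r]%classic : set (measurableTypeR R)) by exact: measurable_itv.
have H1 : F s0 / 2 * (r - l) <= \int[lebesgue_measure]_(s in `[l, r]) F s.
  have -> : F s0 / 2 * (r - l) = \int[lebesgue_measure]_(s in `[l, r]) (F s0 / 2).
    have -> := @Rintegral_cst _ _ R lebesgue_measure `[l, r]%classic mJ (F s0 / 2).
    have mu := @lebesgue_measure_itv R `[l, r].
    rewrite /= lte_fin lr in mu; congr (_ * _); apply: esym; exact: (congr1 fine mu).
  apply: le_Rintegral => //.
  - by apply: itv_cont_integrable => // s _; exact: cst_continuous.
  - exact: itv_cont_integrable.
  - move=> s /=; rewrite in_itv /= => /andP[]; rewrite ge_max le_min => /andP[_ h1] /andP[_ h2].
    have : `|s - s0| < d by rewrite ltr_norml; apply/andP; split; lra.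
    by move=> /Hd; rewrite ltr_norml => /andP[_]; lra.
have H2 : \int[lebesgue_measure]_(s in `[l, r]) F s <= I F.
  have iFi : lebesgue_measure.-integrable `[l, r] (EFin \o F) by exact: itv_cont_integrable.
  rewrite /I /Rintegral fine_le ?integrable_fin_num//; first exact: iF.
  apply: ge0_subset_integral => //; first by case/integrableP: (iF cF).
apply: lt_le_trans (le_trans H1 H2); rewrite mulr_gt0// subr_gt0//.
Qed.

End CurveIntegral.

Lemma is_derive_of_line {R : realType} {V W : normedModType R} (f : V -> W) x v D :
  is_derive (0 : R) (1 : R) (fun t : R => f (x + t *: v)) D -> is_derive x v f D.
Proof.
have E : (fun h : R => h^-1 *: (((fun t : R => f (x + t *: v)) \o shift 0) (h *: 1) - f (x + 0 *: v)))
    = fun h : R => h^-1 *: ((f \o shift x) (h *: v) - f x).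
  by apply/funext => h; rewrite /= addr0 [h *: 1]mulr1 scale0r addr0 (addrC x).
move=> [d1 e1]; apply: DeriveDef; first by move: d1; rewrite /derivable E.
by rewrite -e1 /derive E.
Qed.

Lemma smooth_in_local {R : realType} {V W : normedModType R} (U : set V) (f : V -> W) :
  (forall x, U x -> exists2 U', U' x & smooth_in U' f) -> smooth_in U f.
Proof.
move=> H; split => s x Ux; have [U' U'x [sf]] := H x Ux.
exact: (sf s x U'x).
Qed.

Lemma continuous_norm_le {R : realType} {V : normedModType R} (f : V -> R^o) x :
  (forall e, 0 < e -> exists2 d, 0 < d & forall y, `|y - x| < d -> `|f x - f y| <= e) ->
  {for x, continuous f}.
Proof.
by move=> H; apply/cvgrPdist_le => e /H; move/near_normP.
Qed.

Section CurveConvolution.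
Context {R : realType} {n : nat} (a b : R) (G : R -> 'rV[R]_n) (w : R -> R).
Hypothesis ab : a < b.
Hypothesis cG : forall s, {for s, continuous (G : R^o -> 'rV[R]_n)}.
Hypothesis cw : forall s, {for s, continuous (w : R^o -> R^o)}.

Let I F : R := \int[lebesgue_measure]_(s in `[a, b]) F s.

(** The weighted measure on the reflected curve, as a distribution. Convolution with the curve is
    its value on translates, so differentiation under the integral is an instance of the derivative
    of translations. *)
Definition curve_avg (F : 'rV[R]_n -> R) : R := I (fun s => w s * F (- G s)).

Definition neg_curve : set 'rV[R]_n := (fun s => - G s) @` [set s | s \in `[a, b]].

Let cNG s : {for s, continuous ((fun s => - G s) : R^o -> 'rV[R]_n)}.
Proof. by apply: continuousN; exact: cG. Qed.

Lemma compact_neg_curve : compact neg_curve.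
Proof.
apply: continuous_compact; last exact: segment_compact.
by apply: continuous_subspaceT => s; exact: cNG.
Qed.

Let cF F : smooth_near neg_curve F -> itv_cont a b (fun s => w s * F (- G s)).
Proof.
move=> [U [oU SU sF]] s sab; apply: continuousM; first exact: cw.
apply: (@continuous_comp _ _ _ (fun s : R^o => - G s) (F : 'rV[R]_n -> R^o)); first exact: cNG.
by apply: (smooth_in_cont sF); apply: SU; exists s.
Qed.

Lemma curve_avg_germ : germ_distr neg_curve curve_avg.
Proof.
split.
  move=> c phi psi sp sq; rewrite /curve_avg -itv_intZ; last exact: cF.
  rewrite -itv_intD; [|by apply: itv_contZ; exact: cF|exact: cF].
  by apply: itv_int_eq => s _; ring.
have caw : itv_cont a b (fun s => `|w s|).
  by move=> s _; apply: (@continuous_comp _ _ _ w Num.norm); [exact: cw|exact: norm_continuous].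
exists 0%N, (I (fun s => `|w s|)); split.
  by apply: Rintegral_ge0.
move=> phi e sp pe; rewrite mulrC -itv_intZ //; apply: itv_int_le; [exact: cF|exact: itv_contZ|].
move=> s sab; rewrite normrM mulrC ler_wpM2r//.
by apply: (pe [::]) => //; exists s.
Qed.

Definition curve_conv (A : 'rV[R]_n -> R) (x : 'rV[R]_n) : R := I (fun s => w s * A (x - G s)).

Lemma curve_convE A x t v :
  curve_conv A (x + t *: v) = curve_avg (fun y => A (y - t *: (- v) - (- x))).
Proof.
apply: itv_int_eq => s _; congr (_ * A _).
by apply/rowP => i; rewrite !mxE; ring.
Qed.

Lemma is_derive_curve_conv A x v : smooth_in setT (A : _ -> R^o) ->
  is_derive x v (curve_conv A : _ -> R^o) (curve_conv ('D_v (A : _ -> R^o)) x).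
Proof.
move=> sA; apply: is_derive_of_line.
have sA' : smooth_in setT (fun y => A (y - (- x)) : R^o) by exact: smooth_in_shift sA.
have [d1 e1] := translation_derive0 (- v) compact_neg_curve curve_avg_germ openT sA' (fun _ _ => Logic.I).
rewrite (_ : (fun t => _) = fun t => curve_avg (fun y => A (y - t *: (- v) - (- x)))); last first.
  by apply/funext => t; exact: curve_convE.
apply: DeriveDef => //.
rewrite e1 -mulN1r -itv_intZ; last first.
  by apply: (@cF ('D_(- v) ((fun y => A (y - (- x))) : _ -> R^o))); apply: smooth_nearW; exact: smooth_in_derive.
apply: itv_int_eq => s _; rewrite derive_shift_arg opprK addrC mulrCA; congr (_ * _).
rewrite !(derive_dir _ openT sA) // mulN1r -sumrN; apply: eq_bigr => i _.
by rewrite mxE mulNr opprK.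
Qed.

Lemma smooth_curve_conv A : smooth_in setT (A : _ -> R^o) -> smooth_in setT (curve_conv A : _ -> R^o).
Proof.
move=> sA; apply: (@smooth_coind _ _ setT (fun f => exists2 A, smooth_in setT (A : _ -> R^o) & f = curve_conv A)).
- exact: openT.
- move=> _ [{sA}A sA ->]; split=> [x _|v]; last first.
    exists (curve_conv ('D_v (A : _ -> R^o))); last by move=> x _; exact: is_derive_curve_conv.
    by exists ('D_v (A : _ -> R^o)) => //; exact: smooth_in_derive.
  have sA' : smooth_in setT (fun y => A (y - (- x)) : R^o) by exact: smooth_in_shift sA.
  apply: continuous_norm_le => e e0.
  have [d d0 Hd] := translation_continuous compact_neg_curve curve_avg_germ openT sA' (fun _ _ => Logic.I) e0.
  exists d => // y yd.
  have E z : curve_conv A z = curve_avg (fun y => A (y - (x - z) - (- x))).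
    apply: itv_int_eq => s _; congr (_ * A _).
    by apply/rowP => i; rewrite !mxE; ring.
  have -> : curve_conv A x = curve_avg (fun y => A (y - (- x))).
    by rewrite E; congr curve_avg; apply/funext => z; rewrite subrr subr0.
  by rewrite E distrC; apply: (Hd (x - y) _).2; rewrite distrC.
- by exists A.
Qed.

Lemma iter_derive_curve_conv A s x : smooth_in setT (A : _ -> R^o) ->
  iter_derive s (curve_conv A : _ -> R^o) x = curve_conv (iter_derive s (A : _ -> R^o)) x.
Proof.
move=> sA; elim: s x => [//|v s IH] x /=.
rewrite (_ : iter_derive s (curve_conv A : _ -> R^o) = curve_conv (iter_derive s (A : _ -> R^o))); last exact/funext.
by have [_ ->] := is_derive_curve_conv x v (smooth_in_iter s sA).
Qed.

End CurveConvolution.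

(** * Concentration of the curve integral at one source *)

Section Concentration.
Context {R : realType} {n : nat} (a b : R) (G : R -> 'rV[R]_n).
Hypothesis ab : a < b.
Hypothesis cG : forall s, {for s, continuous (G : R^o -> 'rV[R]_n)}.

Let I F : R := \int[lebesgue_measure]_(s in `[a, b]) F s.

Lemma continuous_bump_curve q r s : {for s, continuous ((fun s => cube_bump q r (G s)) : R^o -> R^o)}.
Proof.
apply: (@continuous_comp _ _ _ (G : R^o -> _) (cube_bump q r : 'rV[R]_n -> R^o)); first exact: cG.
exact: (smooth_in_cont (smooth_cube_bump q r)).
Qed.

Definition bump_mass q r : R := I (fun s => cube_bump q r (G s)).

Lemma bump_mass_gt0 s0 r : s0 \in `[a, b] -> 0 < r -> 0 < bump_mass (G s0) r.
Proof.
move=> s0ab r0; apply: (itv_int_gt0 ab _ _ s0ab) => [s _|s _|].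
- exact: continuous_bump_curve.
- by case/andP: (cube_bump_itv (G s0) r (G s)).
- by rewrite cube_bump1 ?subrr ?normr0// ltW.
Qed.

(** On the support of the bump, [A] and its derivatives at [x - G s] are uniformly close to their
    values at [x - G s0]. The error is measured relative to the mass of the bump, of which only
    positivity is known. *)
Lemma curve_conv_concentrates (u : distr R n) (A : 'rV[R]_n -> R) s0 e : compact_distr u ->
  smooth_in setT (A : _ -> R^o) -> s0 \in `[a, b] -> 0 < e ->
  exists2 d, 0 < d & forall r, 0 < r -> r < d ->
    `|u (curve_conv a b G (fun s => cube_bump (G s0) r (G s)) A) -
      bump_mass (G s0) r * u (fun x => A (x - G s0))| <= e * bump_mass (G s0) r.
Proof.
move=> cu sA s0ab e0.
have [ul [K [N [C [cK C0 uC]]]]] := compact_distrE cu.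
have eC : 0 < e / (C + 1) by rewrite divr_gt0// ltr_pwDr.
set q := G s0.
have cKq : compact ((fun x => x - q) @` K).
  by apply: compact_shift.
have [s d d' dd H x y Kx xy|s|d d0 Hd] := @seq_radius R 'I_n
   (fun s d => forall x y, K x -> `|y| < d -> `|partial s A (x - q - y) - partial s A (x - q)| <= e / (C + 1)) _ _ N.
- by apply: H => //; exact: lt_le_trans xy dd.
- have cA x : ((fun x => x - q) @` K) x -> {for x, continuous (partial s A : _ -> R^o)}.
    by move=> _; apply: smooth_in_cont (Logic.I : setT x); exact: smooth_in_iter.
  have [d d0 Hd] := compact_unif cKq cA eC; exists d => // x y Kx yd.
  by apply/ltW/Hd; [exists x|rewrite addrAC subrr sub0r normrN].
(* The bump of radius [r] extends to distance [2 * r]. *)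
exists (d / 2); first by rewrite divr_gt0.
move=> r r0 rd; set m := bump_mass q r; set w := fun s => cube_bump q r (G s).
have cw : forall s, {for s, continuous (w : R^o -> R^o)} by move=> s; exact: continuous_bump_curve.
have m0 : 0 < m by exact: bump_mass_gt0.
have sJ := smooth_curve_conv a b cG cw sA.
have sAq : smooth_in setT (fun x => A (x - q) : R^o) by exact: smooth_in_shift sA.
have sZ c (phi : 'rV[R]_n -> R) : smooth_in setT (phi : _ -> R^o) -> smooth_in setT (fun x => c * phi x : R^o).
  by move=> sp; apply: smooth_inM => //; [exact: openT|exact: smooth_in_cst].
have z0 : smooth_in setT (fun _ : 'rV[R]_n => 0 : R^o) by exact: smooth_in_cst.
rewrite -(linear_onZ ul m z0 sAq) -(linear_onB ul sJ (sZ m _ sAq)).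
have bd : 0 <= e / (C + 1) * m by rewrite mulr_ge0// ltW.
apply: (le_trans (uC _ (e / (C + 1) * m) _ bd _)).
- by apply: smooth_inB => //; [exact: openT|exact: sZ].
- move=> s x sN Kx.
  have -> : partial s (fun x => curve_conv a b G w A x - m * A (x - q)) x =
      curve_conv a b G w (partial s A) x - m * partial s A (x - q).
    have -> : (fun x => curve_conv a b G w A x - m * A (x - q)) =
        (fun x => curve_conv a b G w A x + (- m) * A (x - q)).
      by apply/funext => y; rewrite mulNr.
    rewrite /partial (iter_deriveD _ openT sJ (sZ (- m) _ sAq) Logic.I).
    rewrite (iter_deriveZ _ _ openT sAq Logic.I) (iter_derive_curve_conv a b cG cw)//.
    by rewrite mulNr iter_derive_shift_arg.
  set B := partial s A; have sB : smooth_in setT (B : _ -> R^o) by exact: smooth_in_iter.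
  have cB : itv_cont a b (fun s => w s * B (x - G s)).
    move=> t _; apply: continuousM; first exact: cw.
    apply: (@continuous_comp _ _ _ (fun s : R^o => x - G s) (B : 'rV[R]_n -> R^o)).
      by apply: continuousB; [exact: cst_continuous|exact: cG].
    exact: (smooth_in_cont sB).
  have cm : itv_cont a b (fun s => w s) by move=> t _; exact: cw.
  rewrite (mulrC m) -mulNr /m /bump_mass /curve_conv -itv_intZ// -itv_intD //; last exact: itv_contZ.
  have cP k : itv_cont a b (fun s => k * cube_bump q r (G s)) by exact: itv_contZ.
  rewrite -itv_intZ //; apply: itv_int_le => //.
    by move=> t tab; apply: continuousD; [exact: cB|exact: cP].
  move=> t tab; rewrite -/(w t) mulNr [B _ * w t]mulrC -mulrBr.
  have /andP[w0 w1] := cube_bump_itv q r (G t); rewrite -/(w t) in w0.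
  rewrite normrM (ger0_norm w0) mulrC.
  have [tq|tq] := lerP `|G t - q| (2 * r); last by rewrite /w cube_bump0// !mulr0.
  rewrite ler_wpM2r// (_ : x - G t = x - q - (G t - q)); last by apply/rowP => i; rewrite !mxE; ring.
  by apply: Hd => //; apply: le_lt_trans tq _; rewrite mulrC -ltr_pdivlMr.
- rewrite mulrA ler_wpM2r ?(ltW m0)// mulrCA ler_piMr ?(ltW e0)//.
  by rewrite ler_pdivrMr ?ltr_pwDr// mul1r lerDl.
Qed.

End Concentration.

(** * Kernels obtained from the moment transform *)

Section MomentKernel.
Context {R : realType} {n : nat}.
Implicit Types (u : distr R n) (f g : field R n) (K : 'rV[R]_n -> R).

(** Test functions must be smooth everywhere, so the singularity of [K] is removed near the origin,
    where nothing is tested. *)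
Definition punctured (r : R) K (y : 'rV[R]_n) : R := (1 - cube_bump 0 r y) * K y.

Lemma smooth_punctured r K : 0 < r -> smooth_in [set x | x != 0] (K : _ -> R^o) ->
  smooth_in setT (punctured r K : _ -> R^o).
Proof.
move=> r0 sK; apply: smooth_in_local => x _; have [->|x0] := eqVneq x 0.
  exists [set y | `|y - 0| < r]; first by rewrite /= subrr normr0.
  have oB := @open_norm_ball R n 0 r.
  apply: (@smooth_in_ext _ _ _ (fun=> 0)) => //; last exact: smooth_in_cst.
  by move=> y /= /ltW yr; rewrite /punctured cube_bump1// subrr mul0r.
exists [set y | y != 0] => //; apply: smooth_inM => //; first exact: open_neq0.
apply: smooth_inB; [exact: open_neq0|exact: smooth_in_cst|].
by apply: smooth_in_sub (smooth_cube_bump 0 r).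
Qed.

Lemma puncturedE r K y : 0 < r -> 2 * r < `|y| -> punctured r K y = K y.
Proof. by move=> r0 yr; rewrite /punctured cube_bump0 ?subr0// mul1r. Qed.

(** Any extension gives the same value: the chosen one and [J] agree on the intersection of their
    neighbourhoods of [supp u]. *)
Lemma pair_near_suppE u psi J U : compact_distr u -> open U -> supp u `<=` U ->
  smooth_in setT (J : _ -> R^o) -> (forall x, U x -> J x = psi x) -> pair_near_supp u psi = u J.
Proof.
move=> cu oU uU sJ E; rewrite /pair_near_supp.
set P := [set phi | _].
have PJ : P J by split; [case: sJ|exists U].
have [sX [W [oW uW EW]]] : P (xget (cst 0) P) by apply: xgetPex; exists J.
have UW : supp u `<=` U `&` W by move=> x ux; split; [exact: uU|exact: uW].
have sX' : smooth_in setT (xget (cst 0) P : _ -> R^o) by split.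
apply: (compact_distr_local cu (openI oU oW) UW sX' sJ) => x [Ux Wx].
by rewrite (EW x Wx) (E x Ux).
Qed.

(** A Euclidean unit vector has sup norm at least [1 / sqrt n]. Hence puncturing with this radius
    leaves a kernel unchanged on the unit sphere. *)
Lemma norm_of_enorm1 (x : 'rV[R]_n) : enorm x = 1 -> 2 * (4 * n.+1%:R)^-1 < `|x|.
Proof.
move=> x1; have d1 : dot x x = 1 by rewrite -enorm_sqr x1 expr1n.
have N0 : (0 : R) < n.+1%:R by rewrite ltr0Sn.
set N : R := n.+1%:R in N0 *.
rewrite ltNge; apply/negP => xr.
have : dot x x <= \sum_(i < n) (2 * (4 * N)^-1) ^+ 2.
  apply: ler_sum => i _; rewrite -expr2 -[leLHS]real_normK ?num_real//.
  by apply: lerXn2r; rewrite ?nnegrE ?(le_trans (norm_coord x i))// mulr_ge0// invr_ge0 mulr_ge0// ltW.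
have E : 2 * (4 * N)^-1 = (2 * N)^-1 by field; rewrite gt_eqF.
rewrite d1 sumr_const card_ord E -[_ *+ n]mulr_natl; apply/negP; rewrite -ltNge.
have nN : n%:R < N by rewrite ltr_nat.
rewrite exprVn ltr_pdivrMr ?exprn_gt0 ?mulr_gt0// mul1r.
have N1 : 1 <= N by rewrite ler1n.
apply: lt_le_trans nN _; rewrite expr2; nra.
Qed.

Lemma smooth_prod_fst (h : 'rV[R]_n -> R) : smooth_in setT (h : _ -> R^o) ->
  smooth_in setT (fun z : ('rV[R]_n * 'rV[R]_n)%type => h z.1 : R^o).
Proof.
move=> sh; apply: (@smooth_in_comp _ _ _ setT h setT fst) => //; [exact: openT|exact: openT|].
move=> i; apply: smooth_in_linear => [c x y|x]; first by rewrite /= !mxE.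
apply: (@continuous_comp _ _ _ fst (fun x : 'rV[R]_n => x 0 i : R^o)); first exact: cvg_fst.
exact: coord_continuous.
Qed.

Lemma smooth_prod_snd (h : 'rV[R]_n -> R) : smooth_in setT (h : _ -> R^o) ->
  smooth_in setT (fun z : ('rV[R]_n * 'rV[R]_n)%type => h z.2 : R^o).
Proof.
move=> sh; apply: (@smooth_in_comp _ _ _ setT h setT snd) => //; [exact: openT|exact: openT|].
move=> i; apply: smooth_in_linear => [c x y|x]; first by rewrite /= !mxE.
apply: (@continuous_comp _ _ _ snd (fun x : 'rV[R]_n => x 0 i : R^o)); first exact: cvg_snd.
exact: coord_continuous.
Qed.

Section Kernel.
Variables (a b : R) (gamma G : R -> 'rV[R]_n) (K : 'rV[R]_n -> R) (r0 : R) (U : set 'rV[R]_n).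
Hypotheses (ab : a < b) (cG : forall s, {for s, continuous (G : R^o -> 'rV[R]_n)}).
Hypothesis gammaG : forall s, s \in `[a, b] -> gamma s = G s.
Hypotheses (hK : homog n.-1 K) (r0_gt0 : 0 < r0) (oU : open U).
Hypothesis UG : forall x s, U x -> s \in `[a, b] -> 2 * r0 < `|x - G s|.

Let A i (y : 'rV[R]_n) : R := y 0 i * punctured r0 K y.

Let sA i : smooth_in setT (A i : _ -> R^o).
Proof.
apply: smooth_inM; [exact: openT|exact: smooth_in_coord|].
by apply: smooth_punctured => //; case: hK.
Qed.

Let rho : R := (4 * n.+1%:R)^-1.

Let phi q r (z : 'rV[R]_n * 'rV[R]_n) : R := cube_bump q r z.1 * punctured rho K z.2.

Let sphi q r : smooth (phi q r : ('rV[R]_n * 'rV[R]_n)%type -> R^o).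
Proof.
have [] : smooth_in setT (phi q r : ('rV[R]_n * 'rV[R]_n)%type -> R^o) => //.
apply: smooth_inM; [exact: openT| |].
  by apply: smooth_prod_fst; exact: smooth_cube_bump.
apply: smooth_prod_snd; apply: smooth_punctured; last by case: hK.
by rewrite invr_gt0 mulr_gt0// ltr0Sn.
Qed.

(** Since [K] has degree [1 - n], the weight [enorm y ^- (n - 1)] of the adjoint turns
    [K (y / enorm y)] into [K y]. *)
Lemma moment_adjoint_bump q r i x : U x ->
  curve_conv a b G (fun s => cube_bump q r (G s)) (A i) x = moment_adjoint a b gamma (phi q r) i x.
Proof.
move=> Ux; apply: itv_int_eq => s sab; rewrite (gammaG sab) /A.
set y := x - G s; have yr : 2 * r0 < `|y| by exact: UG.
have y0 : y != 0 by rewrite -normr_gt0; apply: le_lt_trans yr; rewrite mulr_ge0// ltW.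
have ey : 0 < enorm y by rewrite enorm_gt0.
have e1 : enorm ((enorm y)^-1 *: y) = 1.
  by rewrite enormZ ?invr_ge0 ?(ltW ey)// mulVf// gt_eqF.
rewrite /phi /= puncturedE// puncturedE; last exact: norm_of_enorm1.
  by rewrite (proj2 hK) ?invr_gt0// invrK; field; rewrite expf_neq0// gt_eqF.
by rewrite invr_gt0 mulr_gt0// ltr0Sn.
Qed.

Lemma moment_bump f g q r : compact_field f -> compact_field g ->
  (forall i, supp (f i) `<=` U) -> (forall i, supp (g i) `<=` U) ->
  moment_transform_eq a b gamma f g ->
  \sum_i f i (curve_conv a b G (fun s => cube_bump q r (G s)) (A i)) =
  \sum_i g i (curve_conv a b G (fun s => cube_bump q r (G s)) (A i)).
Proof.
move=> cf cg fU gU /(_ _ (sphi q r)); rewrite /moment_transform.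
have cw s : {for s, continuous ((fun s => cube_bump q r (G s)) : R^o -> R^o)}.
  exact: continuous_bump_curve.
have E u i : compact_distr u -> supp u `<=` U -> pair_near_supp u (moment_adjoint a b gamma (phi q r) i) =
    u (curve_conv a b G (fun s => cube_bump q r (G s)) (A i)).
  move=> cu uU; apply: pair_near_suppE uU _ _ => //; last by move=> x; exact: moment_adjoint_bump.
  exact: smooth_curve_conv.
under eq_bigr do rewrite E//; move=> ->.
by apply: eq_bigr => i _; rewrite E.
Qed.

(** The equality of the transforms holds for every bump at [G s0]; dividing by its mass and
    shrinking it leaves the kernel with source [G s0]. *)
Lemma moment_kernel f g s0 : compact_field f -> compact_field g ->
  (forall i, supp (f i) `<=` U) -> (forall i, supp (g i) `<=` U) ->
  moment_transform_eq a b gamma f g -> s0 \in `[a, b] ->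
  \sum_i f i (fun x => A i (x - G s0)) = \sum_i g i (fun x => A i (x - G s0)).
Proof.
move=> cf cg fU gU fg s0ab; apply/eqP; rewrite -subr_eq0 -normr_le0.
apply/ler_addgt0Pl => e e0; rewrite addr0.
(* Half of the error for each of the two fields, shared among [n] components. *)
pose e' := e / (2 * n.+1%:R).
have e'0 : 0 < e' by rewrite divr_gt0// mulr_gt0// ltr0Sn.
have C u i := fun cu : compact_distr u => curve_conv_concentrates ab cG cu (@sA i) s0ab e'0.
have near_all (h : field R n) : compact_field h -> \forall r \near (0 : R)^'+, forall i,
    `|h i (curve_conv a b G (fun s => cube_bump (G s0) r (G s)) (A i)) -
      bump_mass a b G (G s0) r * h i (fun x => A i (x - G s0))| <= e' * bump_mass a b G (G s0) r.
  move=> ch; apply: filter_forall => i; have [d d0 Hd] := C (h i) i (ch i).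
  by near=> r; apply: Hd; near: r; [exact: nbhs_right_gt|exact: nbhs_right_lt].
have [r [r00 [Hf Hg]]] := filter_ex (filterI (nbhs_right_gt (0 : R)) (filterI (near_all f cf) (near_all g cg))).
have m0 := bump_mass_gt0 ab cG s0ab r00.
set m := bump_mass _ _ _ _ _ in m0 Hf Hg.
rewrite -(ler_pM2l m0) -{1}(gtr0_norm m0) -normrM.
have -> : m * (\sum_i f i (fun x => A i (x - G s0)) - \sum_i g i (fun x => A i (x - G s0))) =
   \sum_i (g i (curve_conv a b G (fun s => cube_bump (G s0) r (G s)) (A i)) - m * g i (fun x => A i (x - G s0))) -
   \sum_i (f i (curve_conv a b G (fun s => cube_bump (G s0) r (G s)) (A i)) - m * f i (fun x => A i (x - G s0))).
  by rewrite !sumrB (moment_bump (G s0) r cf cg fU gU fg) -!mulr_sumr; ring.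
have bd (F : 'I_n -> R) : (forall i, `|F i| <= e' * m) -> `|\sum_i F i| <= m * (e / 2).
  move=> HF; apply: le_trans (ler_norm_sum _ _ _) _.
  apply: le_trans (ler_sum _ (fun i _ => HF i)) _.
  rewrite sumr_const card_ord -[_ *+ n]mulr_natr mulrAC mulrC ler_wpM2l// ?(ltW m0)//.
  rewrite /e' mulrAC ler_pdivrMr ?mulr_gt0 ?ltr0Sn// mulrA divfK// ler_wpM2l ?(ltW e0)//.
  by rewrite ler_nat.
rewrite [e]splitr mulrDr (le_trans (ler_normB _ _))// lerD//; exact: bd.
Unshelve. all: by end_near. Qed.

End Kernel.
End MomentKernel.

(** * The Kirillov-Tuy condition forces a nonconstant curve *)

(** Reduction modulo [m] is injective on numbers that differ by less than [m]. *)
Lemma card_window N m (A : {set 'I_N}) : {in A &, forall i j : 'I_N, (j < i + m)%N} -> (#|A| <= m)%N.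
Proof.
case: m => [|m] H.
  rewrite leqn0 cards_eq0; apply/eqP/setP => i; rewrite inE.
  by apply/negP => iA; have := H i i iA iA; rewrite addn0 ltnn.
have L := @leq_card_in _ _ (fun i : 'I_N => inord (i %% m.+1) : 'I_m.+1) (mem A); rewrite card_ord in L.
apply: L => i j iA jA /(congr1 val); rewrite /= !inordK ?ltn_pmod// => E; apply: val_inj => /=.
have := H i j iA jA; have := H j i jA iA.
have Ei := divn_eq i m.+1; have Ej := divn_eq j m.+1; rewrite E in Ei => h1 h2.
have rj := ltn_pmod j (ltn0Sn m).
have [q|q|q] := ltngtP (i %/ m.+1)%N (j %/ m.+1)%N.
- have := leq_mul q (leqnn m.+1); lia.
- have := leq_mul q (leqnn m.+1); lia.
- by rewrite -[LHS]/(nat_of_ord i) Ei q -Ej.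
Qed.

Lemma card_grid_le (n N M : nat) (A : 'I_M -> 'I_n -> {set 'I_N}) (m : 'I_M -> nat) :
  (forall phi : {ffun 'I_n -> 'I_N}, exists k, forall i, phi i \in A k i) ->
  (forall k i, #|A k i| <= m k)%N -> (N ^ n <= \sum_(k < M) m k ^ n)%N.
Proof.
move=> cov Am.
have -> : (N ^ n)%N = #|{ffun 'I_n -> 'I_N}| by rewrite card_ffun !card_ord.
apply: (@leq_trans (\sum_(k < M) #|family (A k)|)); last first.
  apply: leq_sum => k _; rewrite card_family.
  rewrite -[n in leqRHS]card_ord cardE /image_mem; elim: (enum 'I_n) => //= i s IH.
  by rewrite expnS leq_mul.
rewrite -sum1_card.
have -> : (\sum_(k < M) #|family (A k)| = \sum_(phi : {ffun 'I_n -> 'I_N}) \sum_(k < M) (phi \in family (A k)))%N.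
  rewrite exchange_big /=; apply: eq_bigr => k _.
  by rewrite -sum1_card big_mkcond /=; apply: eq_bigr => phi _; case: (_ \in _).
apply: leq_sum => phi _; have [k kA] := cov phi.
by rewrite (bigD1 k)//= (_ : phi \in family (A k)) //; apply/familyP.
Qed.

(* Count the points of a fine grid in the cube covered by each small cube. *)
Lemma cube_not_null {R : realType} n (c : 'rV[R]_n) (r : R) : (0 < n)%N -> 0 < r ->
  ~ null_dim n [set x | `|x - c| <= r].
Proof.
(* Volumes would already contradict a sum below [r ^+ n]; the factor 2 leaves room for rounding the
   grid counts. *)
move=> n0 r0 /(_ ((r / 2) ^+ n)) []; first by rewrite exprn_gt0// divr_gt0.
move=> p [rk [rk0 cov small]].
have /choice[k kP] : forall x, exists k, `|x - c| <= r -> `|x - p k| < rk k.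
  move=> x; have [xr|xr] := pselect (`|x - c| <= r); last by exists 0%N.
  by have [k _ xk] := cov x xr; exists k => _; move: xk; rewrite -ball_normE /= distrC.
have [x xr|s sQ sc] := finite_ball_cover (r := fun x => rk (k x) - `|x - p (k x)|) (@cube_compact R n c r).
  by rewrite subr_gt0; exact: kP.
pose M := (\max_(x <- s) k x).+1.
have covM x : `|x - c| <= r -> exists j : 'I_M, `|x - p j| < rk j.
  move=> xr; have [y ys xy] := sc x xr.
  have kM : (k y < M)%N by rewrite ltnS; exact: leq_bigmax_seq.
  exists (Ordinal kM) => /=; rewrite -(subrKA y) (le_lt_trans (ler_normD _ _))//.
  by rewrite -ltrBrDr.
have sumM : \sum_(j < M) rk j ^+ n < (r / 2) ^+ n.
  rewrite -lte_fin; apply: le_lt_trans small; rewrite -sumEFin.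
  rewrite -(big_mkord xpredT (fun j => (rk j ^+ n)%:E)); apply: nneseries_lim_ge => j _ _.
  by rewrite lee_fin exprn_ge0// ltW.
(* A grid so fine that [rk j * N / r >= 1] for each cube; adding 1 to such a number then at most
   doubles it. *)
have [N [N0 HN]] : exists N : nat, (0 < N)%N /\ forall j : 'I_M, r <= rk j * N%:R.
  have : \forall N \near \oo, forall j : 'I_M, r / rk j <= N%:R.
    by apply: filter_forall => j; exact: nbhs_infty_ger.
  move=> h; have [N [N0 HN]] := filter_ex (filterI (nbhs_infty_gt 0%N) h).
  exists N; split => // j; by rewrite mulrC -ler_pdivrMr.
pose x (phi : 'I_n -> 'I_N) : 'rV[R]_n := \row_i (c 0 i - r + 2 * r * (phi i)%:R / N%:R).
have NR : 0 < N%:R :> R by rewrite ltr0n.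
have xc phi : `|x phi - c| <= r.
  apply: norm_row_le => [|i]; first exact: ltW.
  rewrite !mxE (_ : _ - _ = r * (2 * ((phi i)%:R / N%:R) - 1)); last by ring.
  rewrite normrM gtr0_norm// ler_piMr ?(ltW r0)//.
  have q0 : 0 <= (phi i)%:R / N%:R :> R by rewrite divr_ge0.
  have q1 : (phi i)%:R / N%:R <= 1 :> R by rewrite ler_pdivrMr// mul1r ler_nat ltnW.
  by rewrite ler_norml; apply/andP; split; lra.
pose A (j : 'I_M) (i : 'I_n) : {set 'I_N} :=
  finset (fun t : 'I_N => `|c 0 i - r + 2 * r * t%:R / N%:R - p j 0 i| < rk j).
(* The grid has spacing [2 * r / N], so the indices that fall into an interval of length [2 * rk j]
   differ by less than [rk j * N / r]. *)
pose m (j : 'I_M) := (Num.trunc (rk j * N%:R / r)).+1.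
have Q0 (j : 'I_M) : 1 <= rk j * N%:R / r by rewrite ler_pdivlMr// mul1r.
suff : (\sum_(j < M) m j ^ n < N ^ n)%N.
  rewrite ltnNge => /negP; apply; apply: (@card_grid_le n N M A m) => [phi|j i].
  - have [j xj] := covM _ (xc phi); exists j => i; rewrite inE.
    by apply: le_lt_trans xj; have := norm_coord (x phi - p j) i; rewrite !mxE.
  - apply: card_window => t t'; rewrite !inE => ht ht'.
    rewrite -(ltr_nat R) natrD.
    have /andP[_ h] := truncn_itv (le_trans ler01 (Q0 j)).
    rewrite -ltrBlDl; apply: lt_trans h; rewrite ltr_pdivlMr// mulrC.
    have : 2 * r * t'%:R / N%:R - 2 * r * t%:R / N%:R < 2 * rk j.
      move: ht ht'; rewrite !ltr_norml => /andP[? ?] /andP[? ?]; lra.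
    have -> : 2 * r * t'%:R / N%:R - 2 * r * t%:R / N%:R = 2 * (r * (t'%:R - t%:R)) / N%:R by ring.
    by rewrite ltr_pdivrMr// -mulrA ltr_pM2l.
rewrite -(ltr_nat R) natr_sum natrX.
  have -> : N%:R ^+ n = (2 * (N%:R / r)) ^+ n * (r / 2) ^+ n :> R.
    by rewrite -exprMn; congr (_ ^+ _); field; rewrite gt_eqF.
  apply: (@le_lt_trans _ _ (\sum_(j < M) (2 * (N%:R / r)) ^+ n * rk j ^+ n)); last first.
    by rewrite -mulr_sumr ltr_pM2l// exprn_gt0// mulr_gt0// divr_gt0.
  apply: ler_sum => j _; rewrite natrX -exprMn lerXn2r ?nnegrE//.
    by rewrite mulr_ge0 ?(ltW (rk0 j))// mulr_ge0// divr_ge0// ltW.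
  have /andP[h _] := truncn_itv (le_trans ler01 (Q0 j)).
  rewrite /m -natr1; have := Q0 j.
  have -> : 2 * (N%:R / r) * rk j = 2 * (rk j * N%:R / r) by ring.
  lra.
Qed.

Lemma null_dim_lipschitz {R : realType} {V W : normedModType R} d (f : V -> W) (A : set V) (Q : set W) :
  (forall x y, `|f x - f y| <= `|x - y|) -> Q `<=` f @` A -> null_dim d A -> null_dim d Q.
Proof.
move=> fL QA nA e /nA[c [r [r0 cov small]]]; exists (fun k => f (c k)), r; split=> // y /QA[x Ax <-].
have [k _ xk] := cov x Ax; exists k => //; move: xk; rewrite -!ball_normE /=.
exact: le_lt_trans.
Qed.

Section Tuy.
Context {R : realType} {n : nat}.
Implicit Types (B : set 'rV[R]_n) (gamma : R -> 'rV[R]_n).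

Lemma norm_le_enorm (x : 'rV[R]_n) : `|x| <= enorm x.
Proof.
apply: norm_row_le => [|i]; first exact: enorm_ge0.
rewrite -(@ler_pXn2r _ 2)// ?nnegrE ?enorm_ge0// enorm_sqr real_normK ?num_real//.
rewrite /dot (bigD1 i)//= expr2 lerDl; apply: sumr_ge0 => j _; exact: sqr_ge0.
Qed.

(* The points of the curve used for the nearby parallel hyperplanes are distinct. *)
Lemma tuy_at_const a b gamma B q omega p : (1 < n)%N -> enorm omega = 1 ->
  (forall s, s \in `[a, b] -> gamma s = q) -> ~ tuy_at a b gamma B omega p.
Proof.
move=> n2 o1 gq [U [pt [[oU Uop] _ Upt _]]].
have i0 : 'I_n.-1 by apply: (@Ordinal _ 0); rewrite -ltnS prednK// ltnW.
have /near_normP[d d0 Ud] := open_near oU Uop.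
have H (p' : R) : U (omega, p') -> dot omega q = p'.
  by move=> Up; have [hp [s sab E]] := Upt i0 _ _ Up o1; rewrite -(gq s sab) E.
have d2 : 0 < d / 2 by rewrite divr_gt0.
have : dot omega q = p + d / 2.
  apply: H; apply: Ud; rewrite (_ : _ - _ = (0, d / 2)).
    rewrite prod_normE /= normr0 gt_max d0 /= gtr0_norm//; lra.
  by rewrite /= /GRing.add /GRing.opp /=; congr pair; rewrite ?subrr // addrAC subrr add0r.
rewrite (H p Uop); lra.
Qed.

(** For a constant curve every hyperplane that meets [B] is exceptional. These hyperplanes project
    onto a set which contains a cube of dimension [n], and a cube is not null. *)
Lemma kirillov_tuy_nonconst a b gamma B q : (1 < n)%N -> open B -> B !=set0 ->
  kirillov_tuy a b gamma B -> ~ forall s, s \in `[a, b] -> gamma s = q.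
Proof.
move=> n2 oB [x0 Bx0] kt gq.
have n0 : (0 < n)%N by exact: ltnW.
pose i0 : 'I_n := Ordinal n0.
(* Local coordinates on the cylinder: near the direction [i0], the entry [i0] of the normal is
   determined by the others, and its slot is given to [p]. *)
pose f (z : ('rV[R]_n * R^o)%type) : 'rV[R]_n := \row_i (if i == i0 then z.2 else z.1 0 i).
have /near_normP[d d0 Bd] := open_near oB Bx0.
have nR : 0 < n%:R :> R by rewrite ltr0n.
pose D := 1 + 2 * n%:R * `|x0|.
have D0 : 0 < D by rewrite ltr_pwDl// mulr_ge0// mulr_ge0.
(* The first bound keeps the sum of the squares of the free entries at most 1; the second makes the
   hyperplane pass within [d] of [x0]. *)
pose k := Num.min (n%:R)^-1 (d / (2 * D)).
have k0 : 0 < k by rewrite lt_min invr_gt0 nR divr_gt0// mulr_gt0.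
have kn : n%:R * k <= 1.
  by rewrite mulrC -ler_pdivlMr// mul1r ge_min lexx.
have kD : k * D < d.
  have : k <= d / (2 * D) by rewrite ge_min lexx orbT.
  rewrite ler_pdivlMr ?mulr_gt0// => h.
  have := mulr_gt0 k0 D0; nra.
(* The coordinates of the hyperplane through [x0] orthogonal to the axis [i0]. *)
pose c0 : 'rV[R]_n := \row_i (if i == i0 then x0 0 i0 else 0).
apply: (@cube_not_null R n c0 k n0 k0).
apply: (@null_dim_lipschitz _ _ _ n f _ _ _ _ kt).
  move=> x y; apply: norm_row_le => // i; rewrite !mxE prod_normE le_max.
  case: ifPn => _; first by rewrite lexx orbT.
  by have := norm_coord (x.1 - y.1) i; rewrite !mxE => ->.
move=> t /= tk.
pose S := \sum_(i < n | i != i0) t 0 i ^+ 2.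
have ti i : i != i0 -> `|t 0 i| <= k.
  move=> ii; apply: le_trans tk; have := norm_coord (t - c0) i.
  by rewrite !mxE (negbTE ii) subr0.
have k1 : k <= 1.
  apply: le_trans kn; rewrite ler_peMl ?(ltW k0)//; by rewrite ler1n.
have sum_bd (F : 'I_n -> R) M : 0 <= M -> (forall i, i != i0 -> `|F i| <= M) ->
    `|\sum_(i < n | i != i0) F i| <= n%:R * M.
  move=> M0 FM; apply: le_trans (ler_norm_sum _ _ _) _.
  apply: (@le_trans _ _ (\sum_(i < n) M)); last by rewrite sumr_const card_ord mulr_natl.
  rewrite [leRHS](bigID (fun i => i != i0)) /= -[leLHS]addr0 lerD//.
    exact: ler_sum.
  by apply: sumr_ge0.
have Sk : S <= n%:R * k.
  apply: le_trans (ler_norm _) _; apply: sum_bd; first exact: ltW.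
  move=> i /ti h; rewrite normrX expr2; apply: (le_trans (ler_pM _ _ h h)) => //.
  by rewrite ler_piMr// ltW.
have S0 : 0 <= S by apply: sumr_ge0 => j _; exact: sqr_ge0.
have S1 : S <= 1 by exact: le_trans Sk kn.
pose w := Num.sqrt (1 - S).
have w0 : 0 <= w by exact: sqrtr_ge0.
have ww : w ^+ 2 = 1 - S by rewrite sqr_sqrtr// subr_ge0.
pose o : 'rV[R]_n := \row_i (if i == i0 then w else t 0 i).
have oo : dot o o = 1.
  rewrite /dot (bigD1 i0)//= !mxE eqxx -expr2 ww (eq_bigr (fun i => t 0 i ^+ 2)) -/S ?subrK//.
  by move=> i ii; rewrite !mxE (negbTE ii) expr2.
have o1 : enorm o = 1 by rewrite /enorm oo sqrtr1.
(* [e] is the signed distance from [x0] to the hyperplane, and [x0 + e *: o] is the foot of the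
   perpendicular. *)
pose p := t 0 i0; pose e := p - dot o x0.
have ed : `|e| < d.
  have E : e = (p - x0 0 i0) + ((1 - w) * x0 0 i0 - \sum_(i < n | i != i0) t 0 i * x0 0 i).
    rewrite /e /dot (bigD1 i0)//= !mxE eqxx (eq_bigr (fun i => t 0 i * x0 0 i)); first by ring.
    by move=> i ii; rewrite !mxE (negbTE ii).
  apply: le_lt_trans kD; rewrite E (le_trans (ler_normD _ _))//.
  have -> : k * D = k + (n%:R * k * `|x0| + n%:R * (k * `|x0|)) by rewrite /D; ring.
  apply: lerD.
    by apply: le_trans tk; have := norm_coord (t - c0) i0; rewrite !mxE eqxx.
  apply: le_trans (ler_normB _ _) _; apply: lerD.
    rewrite normrM ler_pM// ?norm_coord//; apply: le_trans Sk.
    have w1 : w <= 1 by rewrite -[leRHS]sqrtr1 ler_wsqrtr// lerBlDr lerDl.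
    by rewrite ger0_norm ?subr_ge0//; nra.
  apply: sum_bd => [|i /ti h]; first by rewrite mulr_ge0// ltW.
  by rewrite normrM ler_pM// norm_coord.
exists (o, p); last first.
  by apply/rowP => i; rewrite !mxE /=; case: eqP => // ->.
split=> //=; last exact: (tuy_at_const n2 o1 gq).
exists (x0 + e *: o); split.
  by rewrite /hyperplane /= addrC dotDr oo /e; ring.
apply: Bd; rewrite addrAC subrr add0r normrZ; apply: le_lt_trans ed.
by rewrite ler_piMr// (le_trans (norm_le_enorm _))// o1.
Qed.

End Tuy.

(** * Limit directions of secants *)

Section Directions.
Context {R : realType} {n : nat}.

Lemma compact_sphere : compact [set x : 'rV[R]_n | enorm x = 1].
Proof.
apply: (@subclosed_compact _ _ [set x : 'rV[R]_n | `|x - 0| <= 1]).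
- rewrite (_ : [set x | _] = (enorm : 'rV[R]_n -> R) @^-1` [set y : R | y = 1]); last by apply/seteqP; split=> x.
  by apply: closed_comp; [move=> x _; exact: enorm_cont|exact: (@closed_eq R 1)].
- exact: cube_compact.
- by move=> x /= x1; rewrite subr0 (le_trans (norm_le_enorm _))// x1.
Qed.

Lemma seq_min (T : eqType) (s : seq T) (r : T -> R) : (forall x, x \in s -> 0 < r x) ->
  exists2 d, 0 < d & forall x, x \in s -> d <= r x.
Proof.
elim: s => [|x s IH] H; first by exists 1.
have [|d d0 Hd] := IH; first by move=> y ys; apply: H; rewrite inE ys orbT.
exists (Num.min d (r x)); first by rewrite lt_min d0 H// mem_head.
move=> y; rewrite inE => /orP[/eqP->|ys]; first by rewrite ge_min lexx orbT.
by rewrite ge_min Hd.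
Qed.

(** Otherwise each unit vector has a neighbourhood that the directions of all short elements of [D]
    avoid; finitely many of these cover the sphere. *)
Lemma small_directions (D : set 'rV[R]_n) :
  (forall d, 0 < d -> exists y, [/\ D y, y != 0 & enorm y < d]) ->
  exists2 e, enorm e = 1 & forall d, 0 < d ->
    exists y, [/\ D y, y != 0, enorm y < d & `|(enorm y)^-1 *: y - e| < d].
Proof.
move=> HD; apply: contrapT => H.
have /choice[r rP] : forall e, exists r : R, enorm e = 1 ->
    0 < r /\ forall y, D y -> y != 0 -> enorm y < r -> ~ `|(enorm y)^-1 *: y - e| < r.
  move=> e; have [e1|e1] := pselect (enorm e = 1); last by exists 0.
  apply: contrapT => H2; apply: H; exists e => // d d0; apply: contrapT => H3.
  apply: H2; exists d => _; split=> // y Dy y0 yd ye; apply: H3; by exists y.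
have [x x1|s sS sc] := finite_ball_cover (r := r) compact_sphere; first by have [] := rP x x1.
have [x xs|d d0 ds] := @seq_min _ s r; first by have [] := rP x (sS x xs).
have [y [Dy y0 yd]] := HD d d0.
have [|x xs xy] := sc ((enorm y)^-1 *: y).
  by rewrite /= enormZ ?invr_ge0 ?enorm_ge0// mulVf// gt_eqF// enorm_gt0.
have [_ /(_ y Dy y0)] := rP x (sS x xs).
by apply=> //; exact: lt_le_trans yd (ds x xs).
Qed.

(** If [G] were locally constant at every parameter, the set where it equals [G a] would be open and
    closed in the connected interval. *)
Lemma nonconstant_point (a b : R) (G : R -> 'rV[R]_n) : a <= b ->
  (forall s, {for s, continuous (G : R^o -> 'rV[R]_n)}) ->
  ~ (forall s, s \in `[a, b] -> G s = G a) ->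
  exists2 s0, s0 \in `[a, b] & forall d, 0 < d ->
    exists s, [/\ s \in `[a, b], G s <> G s0 & `|s - s0| < d].
Proof.
move=> ab cG nG; apply: contrapT => H; apply: nG.
have /choice[r rP] : forall s0, exists r : R, s0 \in `[a, b] ->
    0 < r /\ forall s, s \in `[a, b] -> `|s - s0| < r -> G s = G s0.
  move=> s0; have [s0ab|s0ab] := pselect (s0 \in `[a, b]); last by exists 0.
  apply: contrapT => H2; apply: H; exists s0 => // d d0; apply: contrapT => H3.
  apply: H2; exists d => _; split=> // s sab sd; apply: contrapT => E; apply: H3; by exists s.
pose A : set R := `[a, b]%classic; pose Z : set R := A `&` [set s | G s = G a].
suff ZA : Z = A by move=> s sab; have : A s by []; rewrite -ZA => -[].
have cA : connected A by exact: segment_connected.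
apply: cA.
- by exists a; split => //; rewrite /A /= in_itv /= lexx.
- exists (\bigcup_(s in Z) [set t | `|t - s| < r s]).
    apply: bigcup_open => s [sab _]; rewrite (_ : [set t | _] = ball s (r s)); first exact: ball_open.
    by apply/seteqP; split=> t /=; rewrite -ball_normE /= distrC.
  apply/seteqP; split=> t.
    move=> Zt; split; first by case: Zt.
    by exists t => //=; rewrite subrr normr0; have [] := rP t Zt.1.
  move=> [tab [s [sab /= Gs] ts]]; split=> //=; rewrite -Gs.
  by have [_] := rP s sab; apply.
- exists [set s | G s = G a] => //.
  rewrite (_ : [set s | _] = (fun s => enorm (G s - G a)) @^-1` [set y : R | y = 0]); last first.
    apply/seteqP; split=> s /=.
      by move=> ->; rewrite subrr /enorm /dot big1 ?sqrtr0// => i _; rewrite mxE mul0r.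
    by move=> /eqP; rewrite eq_le enorm_ge0 andbT leNgt enorm_gt0 negbK subr_eq0 => /eqP.
  apply: closed_comp; last exact: (@closed_eq R 0).
  move=> s _; apply: (@continuous_comp _ _ _ (fun s : R^o => G s - G a) (enorm : 'rV[R]_n -> R)); last exact: enorm_cont.
  by apply: continuousB; [exact: cG|exact: cst_continuous].
Qed.

(** Compactness of the sphere yields a limit of secant directions even at a point where the velocity
    vanishes. *)
Lemma curve_secant (a b : R) (G : R -> 'rV[R]_n) : a <= b ->
  (forall s, {for s, continuous (G : R^o -> 'rV[R]_n)}) ->
  ~ (forall s, s \in `[a, b] -> G s = G a) ->
  exists s0 e, [/\ s0 \in `[a, b], enorm e = 1 & forall d, 0 < d -> exists s u t,
    [/\ s \in `[a, b], G s = G s0 + t *: u, `|u - e| < d, t != 0 & `|t| < d]].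
Proof.
move=> ab cG nG; have [s0 s0ab Hs] := nonconstant_point ab cG nG.
pose D := [set y | exists2 s, s \in `[a, b] & y = G s - G s0].
have [d d0|e e1 He] := @small_directions D; last first.
  exists s0, e; split=> // d d0; have [y [[s sab yE] y0 yd ye]] := He d d0.
  have ey : 0 < enorm y by rewrite enorm_gt0.
  exists s, ((enorm y)^-1 *: y), (enorm y); split=> //; last by rewrite gtr0_norm.
    by rewrite scalerA mulfV ?gt_eqF// scale1r yE addrC subrK.
  by rewrite gt_eqF.
have c : {for s0, continuous ((fun s => enorm (G s - G s0)) : R^o -> R^o)}.
  apply: (@continuous_comp _ _ _ (fun s : R^o => G s - G s0) (enorm : 'rV[R]_n -> R)); last exact: enorm_cont.
  by apply: continuousB; [exact: cG|exact: cst_continuous].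
have /near_normP[r r0 Hr] : \forall s \near (s0 : R^o), `|enorm (G s0 - G s0) - enorm (G s - G s0)| < d.
  by have /cvgrPdist_lt := c; exact.
have [s [sab Gs sr]] := Hs r r0; exists (G s - G s0); split; first by exists s.
  by rewrite subr_eq0; exact/eqP.
have := Hr s sr; have -> : enorm (G s0 - G s0) = 0.
  by rewrite subrr /enorm /dot big1 ?sqrtr0// => i _; rewrite mxE mul0r.
by rewrite sub0r normrN ger0_norm// enorm_ge0.
Qed.

End Directions.

(** * Density of test functions in the Schwartz space *)

Section SchwartzDensity.
Context {R : realType} {n : nat}.
Implicit Types (f g phi : 'rV[R]_n -> R) (s t : seq 'I_n) (u : distr R n).

Lemma partial_rcons s i f : partial (rcons s i) f = partial s (partial [:: i] f).
Proof. by rewrite /partial map_rcons -cats1 iter_derive_cat. Qed.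

Lemma leibniz_bound s : forall f g x Mf Mg, smooth_in setT (f : _ -> R^o) -> smooth_in setT (g : _ -> R^o) ->
  (forall t, (size t <= size s)%N -> `|partial t f x| <= Mf) ->
  (forall t, (size t <= size s)%N -> `|partial t g x| <= Mg) ->
  `|partial s (fun x => f x * g x) x| <= 2 ^+ size s * (Mf * Mg).
Proof.
elim/last_ind: s => [|s i IH] f g x Mf Mg sf sg Hf Hg.
  by rewrite mul1r normrM ler_pM//; [exact: (Hf [::])|exact: (Hg [::])].
have oT : open [set: 'rV[R]_n] by exact: openT.
have sDf : smooth_in setT (partial [:: i] f : _ -> R^o) by exact: smooth_in_derive.
have sDg : smooth_in setT (partial [:: i] g : _ -> R^o) by exact: smooth_in_derive.
rewrite partial_rcons.
have -> : partial [:: i] (fun x => f x * g x) = fun x => f x * partial [:: i] g x + g x * partial [:: i] f x.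
  apply/funext => y.
  have df := smooth_in_is_derive (basis_vec i) sf (Logic.I : setT y).
  have dg := smooth_in_is_derive (basis_vec i) sg (Logic.I : setT y).
  by have [_] := is_deriveM df dg.
rewrite /partial (iter_deriveD _ oT) //; [|exact: smooth_inM|exact: smooth_inM].
rewrite size_rcons exprS -mulrA mulr_natl mulr2n (le_trans (ler_normD _ _))// lerD//.
  apply: IH => // t ts; first by apply: Hf; rewrite size_rcons leqW.
  by rewrite -partial_rcons Hg// !size_rcons ltnS.
rewrite (mulrC Mf); apply: IH => // t ts; first by apply: Hg; rewrite size_rcons leqW.
by rewrite -partial_rcons Hf// !size_rcons ltnS.
Qed.

Lemma derive_scale f k x v : smooth_in setT (f : _ -> R^o) ->
  'D_v ((fun z => f (k *: z)) : _ -> R^o) x = k * 'D_v (f : _ -> R^o) (k *: x).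
Proof.
move=> sf.
have dZ i : is_derive x v (fun z : 'rV[R]_n => (k *: z) 0 i : R^o) (k * v 0 i).
  rewrite (_ : (fun z => _) = fun z : 'rV[R]_n => k * z 0 i : R^o).
    exact: (is_deriveZ k (is_derive_coord x v i)).
  by apply/funext => z; rewrite mxE.
have [|_ ->] := @is_derive_comp _ _ _ setT f (fun z : 'rV[R]_n => k *: z) x v openT sf Logic.I.
  by move=> i; have [] := dZ i.
rewrite (derive_dir v openT sf)// mulr_sumr; apply: eq_bigr => i _.
by rewrite mulrA; congr (_ * _); have [_ ->] := dZ i.
Qed.

Lemma partial_scale s f k x : smooth_in setT (f : _ -> R^o) ->
  partial s (fun z => f (k *: z)) x = k ^+ size s * partial s f (k *: x).
Proof.
move=> sf; elim: s x => [|i s IH] x; first by rewrite mul1r.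
have sp : smooth_in setT (partial s f : _ -> R^o) by exact: smooth_in_iter.
rewrite /partial /= -/(partial s _) (_ : partial s _ = fun x => k ^+ size s * partial s f (k *: x)); last exact/funext.
have spk : smooth_in setT (fun z => partial s f (k *: z) : R^o).
  apply: (@smooth_in_comp _ _ _ setT (partial s f) setT (fun z => k *: z)) => //; [exact: openT|exact: openT|].
  move=> j; apply: (@smooth_in_ext _ _ setT (fun z : 'rV[R]_n => k * z 0 j : R^o)) => //.
  - exact: openT.
  - by move=> z _; rewrite mxE.
  - by apply: smooth_inM; [exact: openT|exact: smooth_in_cst|exact: smooth_in_coord].
have [d _] := smooth_in_is_derive (basis_vec i) spk (Logic.I : setT x).
rewrite (@deriveZ _ _ _ (fun z => partial s f (k *: z) : R^o))// derive_scale//.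
by rewrite [_ *: _]mulrA -exprSr.
Qed.

Lemma partialB s f g x : smooth_in setT (f : _ -> R^o) -> smooth_in setT (g : _ -> R^o) ->
  partial s (fun x => f x - g x) x = partial s f x - partial s g x.
Proof.
move=> sf sg; have oT : open [set: 'rV[R]_n] by exact: openT.
rewrite -mulN1r -(iter_deriveZ (-1) _ oT sg Logic.I) -(iter_deriveD _ oT sf) //; last first.
  by apply: smooth_inM => //; exact: smooth_in_cst.
by congr (iter_derive _ _ x); apply/funext => y; rewrite mulN1r.
Qed.

Let chi := cube_bump (0 : 'rV[R]_n) 1.

Lemma smooth_supp_cutoff k phi : 0 < k -> smooth_in setT (phi : _ -> R^o) ->
  smooth_in setT (fun x => chi (k^-1 *: x) : R^o) /\
  smooth_supp [set x | `|x - 0| <= 2 * k] (fun x => chi (k^-1 *: x) * phi x).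
Proof.
move=> k0 sphi; have oT : open [set: 'rV[R]_n] by exact: openT.
have ki0 : 0 <= k^-1 by rewrite invr_ge0 ltW.
have sck : smooth_in setT (fun x => chi (k^-1 *: x) : R^o).
  apply: (@smooth_in_comp _ _ _ setT chi setT (fun z => k^-1 *: z)) => //; first exact: smooth_cube_bump.
  move=> j; apply: (@smooth_in_ext _ _ setT (fun z : 'rV[R]_n => k^-1 * z 0 j : R^o)) => //.
  - by move=> z _; rewrite mxE.
  - by apply: smooth_inM; [exact: openT|exact: smooth_in_cst|exact: smooth_in_coord].
split=> //; split; first exact: smooth_inM.
move=> x /= /negP; rewrite -ltNge subr0 => xk; rewrite /chi cube_bump0 ?mul0r// mulr1 subr0.
by rewrite normrZ ger0_norm// mulrC ltr_pdivlMr.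
Qed.

(** The difference vanishes for [|x| < k]; beyond, one more power of the weight than the order of
    [u] requires gains a factor [1 / k]. Derivatives of the rescaled cutoff are bounded uniformly in
    [k >= 1]. *)
Lemma tempered_cutoff u phi e : tempered_distr u -> schwartz phi -> 0 < e ->
  exists k0 : R, forall k, k0 <= k -> 0 < k ->
   `|u phi - u (fun x => chi (k^-1 *: x) * phi x)| <= e.
Proof.
move=> /tempered_distrE[ul [N [C [C0 uC]]]] sp e0.
have oT : open [set: 'rV[R]_n] by exact: openT.
have sc : smooth_in setT (chi : _ -> R^o) by exact: smooth_cube_bump.
have sphi : smooth_in setT (phi : _ -> R^o) by case: sp.
have cS := @cube_compact R n 0 2.
have spc : smooth_supp [set x | `|x - 0| <= 2] chi.
  by split=> // x /= /negP; rewrite -ltNge => x2; apply: cube_bump0; rewrite ?mulr1.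
have [t M M' MM H x|t|M M0 HM] := @seq_bound R 'I_n (fun t M => forall x, `|partial t chi x| <= M) _ _ N.
- exact: le_trans (H x) MM.
- have [M M0 HM] := compact_bound cS (fun x _ => smooth_in_cont (smooth_in_iter [seq basis_vec i | i <- t] sc) (Logic.I : setT x)).
  exists M => // x; have [Sx|nSx] := pselect ([set x | `|x - 0| <= 2] x); first exact: HM.
  by rewrite (partial_off_supp _ _ spc nSx) ?normr0//; exact: compact_closed.
have [t L L' LL H x|t|L L0 HL] := @seq_bound R 'I_n
    (fun t L => forall x, (1 + `|x|) ^+ N.+1 * `|partial t phi x| <= L) _ _ N.
- exact: le_trans (H x) LL.
- have [_ /(_ N.+1 t)[L HL]] := sp; exists L => //; apply: le_trans (HL 0).
  by rewrite mulr_ge0// exprn_ge0// addr_ge0.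
pose D := (1 + 2 ^+ N * M) * L.
have D0 : 0 <= D by rewrite mulr_ge0// addr_ge0// mulr_ge0// exprn_ge0.
exists (Num.max 1 (C * D / e)) => k; rewrite ge_max => /andP[k1 ke] k0.
have ki0 : 0 <= k^-1 by rewrite invr_ge0 ltW.
have ki1 : k^-1 <= 1 by rewrite invf_le1.
have [sck ssupp] := smooth_supp_cutoff k0 sphi.
have smul := ssupp.1.
have ssch := smooth_supp_schwartz (@cube_compact R n 0 (2 * k)) ssupp.
have sdiff : schwartz (fun x => phi x - chi (k^-1 *: x) * phi x).
  have [_ Hp] := sp; have [_ Hq] := ssch; split.
    by have [] : smooth_in setT (fun x => phi x - chi (k^-1 *: x) * phi x : R^o) by exact: smooth_inB.
  move=> N' s; have [M1 H1] := Hp N' s; have [M2 H2] := Hq N' s; exists (M1 + M2) => x.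
  have W0 : 0 <= (1 + `|x|) ^+ N' by rewrite exprn_ge0// addr_ge0.
  rewrite partialB// (le_trans (ler_wpM2l W0 (ler_normB _ _)))// mulrDr.
  exact: lerD.
rewrite -(linear_onB ul sp ssch).
have kk : 0 <= D / k by rewrite divr_ge0// ltW.
apply: (le_trans (uC _ (D / k) sdiff kk _)); last first.
  by rewrite mulrA ler_pdivrMr// (mulrC e) -ler_pdivrMr.
move=> s x sN.
have x1 : 0 < 1 + `|x| by rewrite ltr_pwDl.
have [xk|xk] := ltrP `|x| k.
  rewrite /partial (@iter_derive_ext _ _ [set y | `|y - 0| < k] _ (fun=> 0)) ?iter_derive_cst0 ?normr0 ?mulr0//.
  - exact: open_norm_ball.
  - move=> y /=; rewrite subr0 => yk; rewrite /chi cube_bump1 ?mul1r ?subrr// subr0.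
    by rewrite normrZ ger0_norm// mulrC ler_pdivrMr// mul1r ltW.
  - by rewrite /= subr0.
rewrite partialB//.
pose B := L / (1 + `|x|) ^+ N.+1.
have B0 : 0 <= B by rewrite divr_ge0// exprn_ge0// ltW.
have HB t : (size t <= N)%N -> `|partial t phi x| <= B.
  by move=> tN; rewrite ler_pdivlMr ?exprn_gt0// mulrC HL.
have HMk t : (size t <= N)%N -> `|partial t (fun x => chi (k^-1 *: x)) x| <= M.
  move=> tN; rewrite partial_scale// normrM; apply: le_trans (HM t tN (k^-1 *: x)).
  by rewrite ler_piMl// normrX ger0_norm// exprn_ile1.
have := @leibniz_bound s _ _ x M B sck sphi (fun t ts => HMk t (leq_trans ts sN)) (fun t ts => HB t (leq_trans ts sN)).
move=> HP; have H2 : 2 ^+ size s <= 2 ^+ N :> R by rewrite ler_eXn2l// ltr1n.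
have HQ : `|partial s phi x - partial s (fun x => chi (k^-1 *: x) * phi x) x| <= (1 + 2 ^+ N * M) * B.
  apply: le_trans (ler_normB _ _) _; rewrite mulrDl mul1r lerD// ?HB//.
  by apply: le_trans HP _; rewrite -mulrA ler_wpM2r// mulr_ge0.
have W0 : 0 <= (1 + `|x|) ^+ N by rewrite exprn_ge0// ltW.
apply: le_trans (ler_wpM2l W0 HQ) _.
have -> : (1 + `|x|) ^+ N * ((1 + 2 ^+ N * M) * B) = D / (1 + `|x|).
  by rewrite /B /D exprS; field; rewrite expf_neq0 ?gt_eqF.
rewrite ler_wpM2l// lef_pV2 ?posrE//; lra.
Qed.

End SchwartzDensity.

(** * Uniqueness of the potential *)

Section KernelOrthogonality.
Context {R : realType} {n : nat}.
Implicit Types (K : 'rV[R]_n -> R) (S T L U : set 'rV[R]_n).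

(** Differentiate the constant function [(1 + t) ^ d * K ((1 + t) y)] at [t = 0]. *)
Lemma homog_euler d K y : homog d K -> y != 0 -> 'D_y (K : _ -> R^o) y = - (d%:R * K y).
Proof.
move=> [sK hK] y0; have dK := smooth_in_is_derive y sK y0.
have yE : y + 0 *: y = y by rewrite scale0r addr0.
have dl : is_derive (0 : R) (1 : R) (fun t : R => K (y + t *: y) : R^o) ('D_y (K : _ -> R^o) y).
  have h := @is_derive_line _ _ _ (K : _ -> R^o) y y 0; rewrite yE in h.
  by apply: h; case: dK.
have dp : is_derive (0 : R) (1 : R) (fun t : R => (1 + t) ^+ d : R^o) (d%:R).
  have d1 : is_derive (0 : R) (1 : R) (fun t : R => 1 + t : R^o) 1.
    have h := is_deriveD (is_derive_cst (1 : R^o) (0 : R) (1 : R)) (is_derive_id (0 : R^o) (1 : R^o)).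
    by apply: is_derive_eq h _; rewrite add0r.
  have h := is_deriveX d d1; rewrite exprfctE addr0 expr1n mulr1 in h.
  by apply: is_derive_eq h _; rewrite [_ *: _]mulr1.
have [_] := is_deriveM dp dl; rewrite yE addr0 expr1n.
have -> : 'D_1 ((fun t : R => (1 + t) ^+ d : R^o) * (fun t : R => K (y + t *: y) : R^o)) 0 = 0.
  rewrite -[RHS](derive_cst (K y : R^o) (0 : R) (1 : R)); apply: near_eq_derive.
  have N1 : \forall t \near (0 : R^o), `|t : R| < 1.
    by apply/near_normP; exists 1 => // t; rewrite subr0.
  near=> t; have t1 : 0 < 1 + (t : R).
    have : `|t : R| < 1 by near: t; exact: N1.
    by rewrite ltr_norml => /andP[? _]; lra.
  have -> : ((fun t : R => (1 + t) ^+ d : R^o) * (fun t : R => K (y + t *: y) : R^o)) t = (1 + t) ^+ d * K (y + t *: y) by [].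
  rewrite (_ : y + t *: y = (1 + t) *: y); last by rewrite scalerDl scale1r.
  by rewrite hK// mulrA -exprMn divff ?gt_eqF// expr1n mul1r.
by rewrite [_ *: _]mul1r [_ *: _]mulrC => /eqP; rewrite eq_sym addr_eq0 => /eqP.
Unshelve. all: by end_near. Qed.

(** The divergence of [y] contributes [n] and Euler's relation [- (n - 1)], which leaves exactly one
    copy of [K]. *)
Lemma divergence_homog K y : (0 < n)%N -> homog n.-1 K -> y != 0 ->
  \sum_i partial [:: i] (fun y => y 0 i * K y) y = K y.
Proof.
move=> n0 hK y0; have [sK _] := hK.
have := homog_euler hK y0; rewrite (derive_dir _ open_neq0 sK)// => E.
have -> : \sum_i partial [:: i] (fun y => y 0 i * K y) y =
    \sum_i (y 0 i * 'D_(basis_vec i) (K : _ -> R^o) y + K y).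
  apply: eq_bigr => i _.
  have [_] := is_deriveM (is_derive_coord y (basis_vec i) i) (smooth_in_is_derive (basis_vec i) sK y0).
  rewrite /partial /= => ->; rewrite /basis_vec mxE !eqxx [in X in _ + X]/GRing.scale /=.
  by rewrite mulr1.
rewrite big_split /= E sumr_const card_ord addrC -[X in X - _]mulr_natl -mulrBl.
by rewrite -[n in n%:R - _]prednK// -natr1 addrAC subrr add0r mul1r.
Qed.

Section Orthogonality.
Variables (a b : R) (gamma G : R -> 'rV[R]_n) (f g : field R n) (w : distr R n) (L U : set 'rV[R]_n) (r0 : R).
Hypotheses (n0 : (0 < n)%N) (ab : a < b) (cG : forall s, {for s, continuous (G : R^o -> 'rV[R]_n)}).
Hypothesis gammaG : forall s, s \in `[a, b] -> gamma s = G s.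
Hypotheses (r0_gt0 : 0 < r0) (oU : open U) (cL : compact L) (LU : L `<=` U).
Hypothesis UG : forall x s, U x -> s \in `[a, b] -> 2 * r0 < `|x - G s|.
Hypotheses (cf : compact_field f) (cg : compact_field g) (tw : test_distr w).
Hypotheses (fL : forall i, supp (f i) `<=` L) (gL : forall i, supp (g i) `<=` L) (wL : supp w `<=` L).
Hypothesis fg : moment_transform_eq a b gamma f g.
Hypothesis fgw : forall i S phi, compact S -> smooth_supp S phi ->
  f i phi - g i phi = - w (partial [:: i] phi).

(* With [h = f - g = d w] and [y = x - G s0], the moment transform gives
   [h (y K y) = 0]; integrating by parts and using [div (y K) = K] (Euler) this
   is [w K = 0]. *)
Lemma kernel_orthogonal (c : 'rV[R]_n -> R) S W K s0 : compact S -> smooth_supp S c ->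
  open W -> supp w `<=` W -> (forall x, W x -> c x = 1) -> homog n.-1 K ->
  s0 \in `[a, b] -> ~ S (G s0) -> w (fun x => c x * K (x - G s0)) = 0.
Proof.
move=> cS sc oW wW c1 hK s0ab nSq; set q := G s0 in nSq *.
have oT : open [set: 'rV[R]_n] by exact: openT.
have [c2 [S2 [sc2 _ [cS2 S2U] c20 [W2 [oW2 LW2 W2S2 c21]]]]] := cutoff cL oU LU.
have fU i : supp (f i) `<=` U by move=> x /fL; exact: LU.
have gU i : supp (g i) `<=` U by move=> x /gL; exact: LU.
have MK := moment_kernel ab cG gammaG hK r0_gt0 oU UG cf cg fU gU fg s0ab.
pose A (i : 'I_n) (y : 'rV[R]_n) : R := y 0 i * punctured r0 K y.
have sF i : smooth_in setT (fun x => A i (x - q) : R^o).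
  have sA : smooth_in setT (A i : _ -> R^o).
    apply: smooth_inM; [exact: openT|exact: smooth_in_coord|].
    by apply: smooth_punctured => //; case: hK.
  by apply: smooth_in_shift sA.
have spF i : smooth_supp S2 (fun x => c2 x * A i (x - q)).
  split; last by move=> x nS; rewrite c20// mul0r.
  by apply: smooth_inM oT sc2 _; exact: sF.
have loc (u : distr R n) i : compact_distr u -> supp u `<=` L ->
    u (fun x => A i (x - q)) = u (fun x => c2 x * A i (x - q)).
  move=> cu uL; apply: (compact_distr_local cu oW2 (subset_trans uL LW2) (sF i) (spF i).1).
  by move=> x Ox; rewrite c21// mul1r.
have clS2 : closed S2 by exact: compact_closed.
have spD i : smooth_supp S2 (partial [:: i] (fun x => c2 x * A i (x - q))).
  split; first by apply: smooth_in_derive; exact: (spF i).1.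
  by move=> x nx; exact: (partial_off_supp _ clS2 (spF i) nx).
have z0 S' : smooth_supp S' (fun _ : 'rV[R]_n => 0) by split=> //; exact: smooth_in_cst.
pose Sg x := \sum_i partial [:: i] (fun x => c2 x * A i (x - q)) x.
have wSg : w Sg = 0.
  have [wl _] := tw cS2.
  rewrite (linear_on_sum wl) //; last first.
    by move=> p p' sp sp'; have := smooth_supp_lin 1 sp sp'; under eq_fun do rewrite mul1r.
  apply/eqP; rewrite -oppr_eq0 -sumrN.
  under eq_bigr => i _ do rewrite -(fgw i cS2 (spF i)) -(loc _ i (cf i) (@fL i)) -(loc _ i (cg i) (@gL i)).
  by rewrite sumrB [X in X - _]MK subrr.
have sSg : smooth_supp S2 Sg.
  split; first by apply: smooth_in_sum => // i _; exact: (spD i).1.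
  by move=> x nS; rewrite /Sg big1// => i _; exact: (spD i).2.
have sKq : smooth_near S (fun x => K (x - q)).
  apply: (smooth_near_shift open_neq0 (proj1 hK)) => x Sx /=.
  by rewrite subr_eq0; apply/eqP => E; apply: nSq; rewrite -E.
have scK : smooth_supp S (fun x => c x * K (x - q)) by apply: smooth_cutoff_mul => //; exact: compact_closed.
pose S3 := S2 `|` S.
have cS3 : compact S3 by exact: compactU.
have [wl _] := tw cS3.
have s1 : smooth_supp S3 Sg by apply: smooth_suppW sSg => x; left.
have s2 : smooth_supp S3 (fun x => c x * K (x - q)) by apply: smooth_suppW scK => x; right.
apply/eqP; rewrite -oppr_eq0 -[- _]add0r -{1}wSg -(linear_onB wl s1 s2); apply/eqP.
(* The divergence of the field cut off by [c2] and the kernel cut off by [c] agree where both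
   cutoffs are 1, a neighbourhood of [supp w]. *)
apply: (supp_vanish (S := S3 `\` (W2 `&` W)) tw).
- apply: compact_closedI => //; apply: open_closedC; exact: openI.
- by move=> x [_ nOW] wx; apply: nOW; split; [apply: LW2; exact: wL|exact: wW].
split; first by apply: smooth_inB; [exact: openT|exact: s1.1|exact: s2.1].
move=> x nS; have [[Ox Wx]|nOW] := pselect ((W2 `&` W) x); last first.
  have nS3 : ~ S3 x by move=> S3x; apply: nS.
  by rewrite s1.2// s2.2// subrr.
have xq y : W2 y -> 2 * r0 < `|y - q| by move=> Oy; apply: UG => //; apply: S2U; exact: W2S2.
have xq0 : x - q != 0.
  by rewrite -normr_gt0; apply: lt_trans (xq x Ox); rewrite mulr_gt0.
rewrite c1// mul1r /Sg -[X in _ - X](divergence_homog n0 hK xq0); apply/eqP; rewrite subr_eq0; apply/eqP.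
apply: eq_bigr => i _.
transitivity (partial [:: i] (fun x => (x - q) 0 i * K (x - q)) x); last first.
  by rewrite /partial (iter_derive_shift_arg (fun y : 'rV[R]_n => y 0 i * K y : R^o)).
apply: (iter_derive_ext _ oW2) => // y Oy.
by rewrite c21// mul1r /A puncturedE//; exact: xq.
Qed.
End Orthogonality.
End KernelOrthogonality.

Section PotentialVanishes.
Context {R : realType} {n : nat}.
Implicit Types (B K : set 'rV[R]_n) (f g : field R n) (u v w : distr R n).

Lemma smooth_decaying_offW K K' v : K `<=` K' -> smooth_decaying_off K v -> smooth_decaying_off K' v.
Proof.
move=> KK [h [sh vh dh]]; exists h; split=> //.
- by move=> s x nx; apply: sh => /KK.
- move=> phi [sp [cp subp]]; apply: vh; split=> //; split=> // x /subp nx; by move=> /KK.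
Qed.

Lemma compact_field_supp B f : bounded_set B -> field_supp f `<=` B -> compact (field_supp f).
Proof.
move=> /bounded_norm[M M0 BM] fB.
apply: (@subclosed_compact _ _ [set x : 'rV[R]_n | `|x - 0| <= M]).
- by apply: closed_bigcup => [|i _]; [exact: finite_finset|exact: closed_supp].
- exact: cube_compact.
- by move=> x /fB /BM; rewrite /= subr0.
Qed.

(* Seen from [q], the set [T] lies in the cone over [B], of which only one of two
   opposite rays is a part. *)
Lemma off_one_ray B (T : set 'rV[R]_n) q e : dot e e = 1 ->
  (forall x, T x -> exists2 t, 0 <= t & B (q + t *: (x - q))) ->
  ~ ((exists2 t : R, 0 <= t & B (q + t *: e)) /\ (exists2 t : R, t <= 0 & B (q + t *: e))) ->
  (forall x, T x -> off_ray e (x - q)) \/ (forall x, T x -> off_ray (- e) (x - q)).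
Proof.
move=> e1 TB H; have e1' : dot (- e) (- e) = 1.
  by rewrite -e1; apply: eq_bigr => i _; rewrite !mxE mulrNN.
apply: contrapT => /not_orP[/existsNP[x /not_implyP[Tx nx]] /existsNP[y /not_implyP[Ty ny]]].
apply: H; split.
- have /(rho_le0 e1)[t t0 E] : rho e (x - q) <= 0 by rewrite leNgt; apply/negP.
  have [s s0] := TB x Tx; rewrite E scalerA => Bs; exists (s * t) => //; exact: mulr_ge0.
- have /(rho_le0 e1')[t t0 E] : rho (- e) (y - q) <= 0 by rewrite leNgt; apply/negP.
  have [s s0] := TB y Ty; rewrite E scalerA scalerN -scaleNr => Bs; exists (- (s * t)) => //.
  by rewrite oppr_le0 mulr_ge0.
Qed.

Section Secant.
Variables (a b : R) (G : R -> 'rV[R]_n) (w : distr R n) (s0 : R) (e : 'rV[R]_n).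
Hypotheses (n1 : (1 < n)%N) (e1 : enorm e = 1).
Hypotheses (tw : test_distr w) (cT : compact (supp w)).
Hypothesis wray : forall x, supp w x -> off_ray e (x - G s0).
Hypothesis sec : forall d, 0 < d -> exists s (u : 'rV[R]_n) t,
  [/\ s \in `[a, b], G s = G s0 + t *: u, `|u - e| < d, t != 0 & `|t| < d].
Hypothesis orth : forall c S W (K : 'rV[R]_n -> R) s, compact S -> smooth_supp S c ->
  open W -> supp w `<=` W -> (forall x, W x -> c x = 1) -> homog n.-1 K ->
  s \in `[a, b] -> ~ S (G s) -> w (fun x => c x * K (x - G s)) = 0.

(** Translating [q] to the origin and multiplying by a cutoff off the ray of [e] turns [w] into a
    distribution near a compact set, seen by the sources on the secants. *)
Lemma test_distr_eq0 S phi : compact S -> smooth_supp S phi -> w phi = 0.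
Proof.
move=> cS0 sphi; pose q := G s0; have wray' : forall x, supp w x -> off_ray e (x - q) := wray.
have ee : dot e e = 1 by rewrite -enorm_sqr e1 expr1n.
pose U := [set x | off_ray e (x - q)].
have oU : open U.
  have oR := @open_off_ray R n e; apply: open_comp oR => x _.
  by apply: continuousB; [exact: cvg_id|exact: cst_continuous].
have [c [S1 [sc _ [cS1 S1U] c0 [W [oW wW _ c1]]]]] := cutoff cT oU wray'.
have sc1 : smooth_supp S1 c by split.
have oT : open [set: 'rV[R]_n] by exact: openT.
pose Z (x : 'rV[R]_n) := x - q.
have sZ i : smooth_in setT (fun x => Z x 0 i : R^o).
  apply: (@smooth_in_ext _ _ setT (fun x : 'rV[R]_n => x 0 i - q 0 i : R^o)) => //.
    by move=> x _; rewrite /Z !mxE.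
  by apply: smooth_inB => //; [exact: smooth_in_coord|exact: smooth_in_cst].
have g1 := test_distr_germ cS1 sc1 tw.
have g2 := germ_distr_pull cS1 oT (@subsetT _ S1) sZ (@smooth_in_cst _ _ setT 1) g1.
have cZ : compact (Z @` S1) by exact: compact_shift.
have nq : ~ S1 q by move=> /S1U; rewrite /U /= subrr => /off_ray_neq0; rewrite eqxx.
have oS1 : open (~` S1) by apply: closed_openC; exact: compact_closed.
have /near_normP[d d0 Hd] := open_near oS1 nq.
have Vt m : 0 < m -> exists (u : 'rV[R]_n) (t : R), [/\ `|u - e| < m, t != 0, `|t| < m &
    forall K : 'rV[R]_n -> R, homog n.-1 K -> w (fun x => c x * (1 * K (Z x - t *: u))) = 0].
  (* With [|u| <= 2] and [|t| < d / 2], the source [G s] stays within [d] of [q], hence off the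
     support of the cutoff. *)
  move=> m0; pose m' := Num.min m (Num.min 1 (d / 2)).
  have m'0 : 0 < m' by rewrite !lt_min m0 ltr01 divr_gt0.
  have [s [u [t [sab Gs]]]] := sec m'0.
  rewrite !lt_min => /and3P[um u1 _] t0 /and3P[tm _ td].
  exists u, t; split=> // K hK; rewrite (_ : (fun x => _) = fun x => c x * K (x - G s)); last first.
    by apply/funext => x; rewrite mul1r Gs /Z -/q opprD addrA.
  apply: (orth cS1 sc1 oW wW c1 hK sab); apply: Hd; rewrite Gs -/q addrAC subrr add0r normrZ.
  have u2 : `|u| <= 2.
    rewrite -(subrK e u) (le_trans (ler_normD _ _))// (_ : 2 = 1 + 1)// lerD//; first exact: ltW.
    by rewrite -e1 norm_le_enorm.
  apply: le_lt_trans (ler_wpM2l (normr_ge0 t) u2) _.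
  by rewrite -ltr_pdivlMr.
have d0' : (0 < n.-1)%N by rewrite -ltnS prednK// ltnW.
have Ze : Z @` S1 `<=` off_ray e by move=> _ [x Sx <-]; exact: S1U.
have V0 psi := germ_distr_zero cZ g2 ee d0' Ze Vt (phi := psi).
have [wl _] := tw cS0.
have scphi : smooth_supp S (fun x => c x * phi x) by exact: smooth_suppM.
have -> : w phi = w (fun x => c x * phi x).
  apply/eqP; rewrite -subr_eq0 -(linear_onB wl sphi scphi); apply/eqP.
  apply: (supp_vanish (S := S `\` W) tw).
  - by apply: compact_closedI => //; exact: open_closedC.
  - by move=> x [_ nW] /wW.
  - split; first by apply: smooth_inB oT sphi.1 scphi.1.
    move=> x nS; have [Wx|nW] := pselect (W x); first by rewrite c1// mul1r subrr.
    by rewrite sphi.2 ?mulr0 ?subr0// => Sx; apply: nS.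
rewrite -(V0 (fun y => phi (y - (- q)))).
  by congr w; apply/funext => x; rewrite mul1r /Z opprK subrK.
by apply: smooth_nearW; apply: smooth_in_shift sphi.1.
Qed.

End Secant.
End PotentialVanishes.

Lemma tempered_eq_test {R : realType} {n : nat} (u v : distr R n) :
  tempered_distr u -> tempered_distr v ->
  (forall S phi, compact S -> smooth_supp S phi -> u phi = v phi) -> tempered_eq u v.
Proof.
move=> tu tv uv phi sp; apply/eqP; rewrite -subr_eq0 -normr_le0.
apply/ler_addgt0Pl => e e0; rewrite addr0.
have e2 : 0 < e / 2 by rewrite divr_gt0.
have [k1 H1] := tempered_cutoff tu sp e2; have [k2 H2] := tempered_cutoff tv sp e2.
pose k := Num.max 1 (Num.max k1 k2).
have k0 : 0 < k by rewrite lt_max ltr01.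
have {}H1 := H1 k _ k0; have {}H2 := H2 k _ k0.
move: H1 H2; rewrite !le_max !lexx !orbT => /(_ isT) + /(_ isT).
have sphi : smooth_in setT (phi : _ -> R^o) by case: sp.
have [_ /(uv _ _ (@cube_compact R n 0 (2 * k))) E] := smooth_supp_cutoff k0 sphi.
rewrite E => H1 H2.
set z := v (fun x => _) in H1 H2; rewrite (_ : u phi - v phi = (u phi - z) - (v phi - z)); last by ring.
by rewrite (le_trans (ler_normB _ _))// [e]splitr lerD.
Qed.

Theorem theorem11 (R : realType) (n : nat) (n_ge2 : (2 <= n)%N)
    (B : set 'rV[R]_n) (B_domain : bounded_domain B)
    (a b : R) (a_lt_b : a < b) (gamma : R -> 'rV[R]_n)
    (gamma_smooth : smooth_curve a b gamma)
    (gamma_encompasses : encompasses a b gamma B)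
    (gamma_tuy : kirillov_tuy a b gamma B)
    (f g : field R n)
    (f_compact : compact_field f) (g_compact : compact_field g)
    (f_supp : field_supp f `<=` B) (g_supp : field_supp g `<=` B)
    (fs gs : field R n) (vf vg : distr R n)
    (f_parts : solenoidal_potential_parts f fs vf)
    (g_parts : solenoidal_potential_parts g gs vg)
    (same_transform : moment_transform_eq a b gamma f g)
    (same_solenoidal : tempered_field_eq fs gs) :
  tempered_eq vf vg.
Proof.
have n0 : (0 < n)%N by exact: ltnW.
have [oB _ B0 bB] := B_domain.
have [G [sG gG]] := gamma_smooth.
have cG s : {for s, continuous (G : R^o -> 'rV[R]_n)} by have [] := sG [::] s Logic.I.
have [[_ tvf] [_ dvf] fE _] := f_parts.
have [[_ tvg] [_ dvg] gE _] := g_parts.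
pose K := field_supp f `|` field_supp g.
have cK : compact K.
  by apply: compactU; [exact: compact_field_supp f_supp|exact: compact_field_supp g_supp].
have KB : K `<=` B by move=> x [/f_supp|/g_supp].
have fK i : supp (f i) `<=` K by move=> x fx; left; exists i.
have gK i : supp (g i) `<=` K by move=> x gx; right; exists i.
have tvf' := tempered_test_distr tvf; have tvg' := tempered_test_distr tvg.
pose w : distr R n := fun phi => vf phi - vg phi.
have tw : test_distr w by exact: test_distrB.
have fgw i S phi : compact S -> smooth_supp S phi -> f i phi - g i phi = - w (partial [:: i] phi).
  move=> cS sphi; have sch := smooth_supp_schwartz cS sphi.
  by rewrite fE// gE// same_solenoidal// /w /grad /distr_partial; ring.
have grad0 i S phi : compact S -> smooth_supp S phi -> (forall y, S y -> ~ K y) ->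
    vf (partial [:: i] phi) - vg (partial [:: i] phi) = 0.
  move=> cS sphi SK; apply/eqP; rewrite -oppr_eq0 -/(w _) -(fgw i S)//; apply/eqP.
  rewrite (supp_vanish (compact_test_distr (f_compact i)) cS _ sphi); last by move=> x /SK nK /fK.
  rewrite (supp_vanish (compact_test_distr (g_compact i)) cS _ sphi) ?subrr//.
  by move=> x /SK nK /gK.
have dvf' : smooth_decaying_off K vf by apply: smooth_decaying_offW dvf => x; left.
have dvg' : smooth_decaying_off K vg by apply: smooth_decaying_offW dvg => x; right.
(* A ray from [x] that misses [K] would take [x] out of [supp w]. *)
have hit x xi : supp w x -> xi != 0 -> exists2 t : R, 0 <= t & K (x + t *: xi).
  move=> wx xi0; apply: contrapT => H.
  apply: (ray_not_supp cK tvf' tvg' dvf' dvg' grad0 xi0 _ wx) => t t0 Kt.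
  by apply: H; exists t.
have gcurve s : s \in `[a, b] -> curve a b gamma (G s).
  by move=> sab; exists s => //; exact: gG.
have [curveB cone] := gamma_encompasses.
(* From a curve point in [supp w], two opposite rays would both meet [B]. *)
have off s : s \in `[a, b] -> ~ supp w (G s).
  move=> sab wq; have xi0 : basis_vec (Ordinal n0) != 0 :> 'rV[R]_n.
    by apply/eqP => /rowP /(_ (Ordinal n0)); rewrite !mxE !eqxx /=; apply/eqP; rewrite oner_eq0.
  apply: (cone _ _ (gcurve s sab) xi0); split.
    by have [t t0 /KB] := hit _ _ wq xi0; exists t.
  have xi0' : - basis_vec (Ordinal n0) != 0 :> 'rV[R]_n by rewrite oppr_eq0.
  have [t t0 /KB] := hit _ _ wq xi0'; rewrite scalerN -scaleNr => Bt.
  by exists (- t) => //; rewrite oppr_le0.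
(* Continue beyond [x], away from the curve point: the ray hits [K], which lies in [B]. *)
have TB s x : s \in `[a, b] -> supp w x -> exists2 t, 0 <= t & B (G s + t *: (x - G s)).
  move=> sab wx; have x0 : x - G s != 0.
    by rewrite subr_eq0; apply/eqP => E; apply: (off s sab); rewrite -E.
  have [t t0 /KB Bt] := hit _ _ wx x0; exists (1 + t); first by rewrite addr_ge0.
  by rewrite (_ : _ + _ = x + t *: (x - G s))//; apply/rowP => i; rewrite !mxE; ring.
have cT : compact (supp w).
  have [M M0 KM] := compact_norm_bound cK.
  apply: (@subclosed_compact _ _ [set x : 'rV[R]_n | `|x - 0| <= M]).
  - exact: closed_supp.
  - exact: cube_compact.
  (* The ray from [x] in the direction [x] increases the norm and still has to hit [K]. *)
  - move=> x wx; rewrite /= subr0; have [->|x0] := eqVneq x 0; first by rewrite normr0.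
    have [t t0 /KM] := hit x x wx x0; rewrite -{1}[x]scale1r -scalerDl normrZ.
    by apply: le_trans; rewrite ler_peMl// ger0_norm ?addr_ge0// lerDl.
have nconst : ~ forall s, s \in `[a, b] -> G s = G a.
  move=> H; apply: (@kirillov_tuy_nonconst R n a b gamma B (G a)) => // s sab.
  by rewrite gG// H.
have [s0 [e [s0ab e1 sec]]] := curve_secant (ltW a_lt_b) cG nconst.
pose L := K `|` supp w.
have cL : compact L by exact: compactU.
(* With [d] a margin between [L] and the curve, points within [d / 2] of [L] are at distance more
   than [d / 2 = 2 * r0] from the curve. *)
have [r0 r00 [U [oU LU UG]]] : exists2 r0 : R, 0 < r0 & exists U, [/\ open U, L `<=` U &
    forall x s, U x -> s \in `[a, b] -> 2 * r0 < `|x - G s|].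
  have cC : compact (neg_curve a b (fun s => - G s)).
    by apply: compact_neg_curve => s; apply: continuousN; exact: cG.
  have oC : open (~` neg_curve a b (fun s => - G s)).
    by apply: closed_openC; exact: compact_closed.
  have LC : L `<=` ~` neg_curve a b (fun s => - G s).
    move=> x Lx [s sab]; rewrite opprK => E; case: Lx; rewrite -E; last exact: off.
    by move=> /KB Bs; have : (curve a b gamma `&` B) (G s); [split=> //; exact: gcurve|rewrite curveB].
  have [d d0 Hd] := compact_margin cL oC LC.
  exists (d / 4); first by rewrite divr_gt0.
  exists (\bigcup_(x in L) [set y | `|y - x| < d / 2]); split.
  - by apply: bigcup_open => x _; exact: open_norm_ball.
  - by move=> x Lx; exists x => //=; rewrite subrr normr0 divr_gt0.
  - move=> y s [x Lx /= yx] sab; rewrite ltNge; apply/negP => ys.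
    apply: (Hd x (G s) Lx); last by exists s => //; rewrite opprK.
    rewrite (_ : G s - x = (y - x) - (y - G s)); last by apply/rowP => i; rewrite !mxE; ring.
    by apply: le_lt_trans (ler_normB _ _) _; lra.
have orth := @kernel_orthogonal R n a b gamma G f g w L U r0 n0 a_lt_b cG gG r00 oU cL LU UG
  f_compact g_compact tw (fun i x fx => or_introl (fK i x fx)) (fun i x gx => or_introl (gK i x gx))
  (fun x wx => or_intror wx) same_transform fgw.
apply: (tempered_eq_test tvf tvg) => S phi cS sphi; apply/eqP; rewrite -subr_eq0 -/(w phi); apply/eqP.
have ee : dot e e = 1 by rewrite -enorm_sqr e1 expr1n.
have e0 : e != 0 by rewrite -enorm_gt0 e1.
have [he|he] := off_one_ray ee (fun x => TB s0 x s0ab) (cone _ _ (gcurve s0 s0ab) e0).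
  exact: (test_distr_eq0 n_ge2 e1 tw cT he sec orth cS sphi).
have e1' : enorm (- e) = 1.
  by rewrite -e1 /enorm; congr Num.sqrt; apply: eq_bigr => i _; rewrite !mxE mulrNN.
(* The same secants serve for [- e], with [u] and [t] replaced by their opposites. *)
apply: (test_distr_eq0 n_ge2 e1' tw cT he _ orth cS sphi) => d d0.
have [s [u [t [sab Gs ue t0 td]]]] := sec d d0.
exists s, (- u), (- t); split=> //; first by rewrite scalerN scaleNr opprK.
- by rewrite -opprD normrN.
- by rewrite oppr_eq0.
- by rewrite normrN.
Qed.
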